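(* There is a deterministic algorithm which is given as input an explicit description of a polynomial $q(y)=\sum_{i=1}^K(\lambda_iy_i^2+\mu_iy_i)+\tau$ and $\epsilon>0$, where $\lambda_i,\mu_i\in\mathbb{Z}$, $K=\tilde{O}(1/\epsilon^4)$, and each coefficient $\lambda_i,\mu_i,\tau$ is a $B$-bit integer. It runs in $O(KB)\cdot\mathrm{polylog}(1/\epsilon)+\mathrm{poly}(1/\epsilon)$ bit operations and outputs a value $v\in[0,1]$ such that \[ \left|\Pr_{y\sim\mathcal{N}(0,1)^K}[q(y)\ge0]-v\right|\le\epsilon. \]
   Context: $\mathcal{N}(0,1)^K$ is the standard Gaussian distribution on $\mathbb{R}^K$; $\tilde{O}$ hides polylogarithmic factors. *)

(* Defs.v *)
From HB Require Import structures.
From mathcomp Require Import all_boot all_order all_algebra.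
From mathcomp Require Import all_classical all_reals all_analysis.

Set Implicit Arguments.
Unset Strict Implicit.
Unset Printing Implicit Defensive.

Import Order.TTheory GRing.Theory Num.Theory.
Import numFieldNormedType.Exports.

Local Open Scope classical_set_scope.
Local Open Scope ring_scope.

(** * Deterministic multi-tape Turing machines *)

Inductive symbol (G : Type) := Blank | Bit (b : bool) | Sep | Work (g : G).
Arguments Blank {G}.
Arguments Bit {G}.
Arguments Sep {G}.

Definition is_blank G (s : symbol G) := if s is Blank then true else false.

Inductive direction := MoveL | MoveR | Stay.

(* Bi-infinite tape: the first item of [cells_right] is the scanned cell, the
   first item of [cells_left] is its left neighbour; every cell that is not
   listed is blank. *)
Record tape G := Tape {
  cells_left : seq (symbol G);
  cells_right : seq (symbol G) }.

Definition scan G (t : tape G) := head Blank (cells_right t).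

Definition write G (s : symbol G) (t : tape G) :=
  Tape (cells_left t) (s :: behead (cells_right t)).

Definition move_head G (m : direction) (t : tape G) :=
  match m with
  | MoveL => Tape (behead (cells_left t)) (head Blank (cells_left t) :: cells_right t)
  | MoveR => Tape (scan t :: cells_left t) (behead (cells_right t))
  | Stay => t
  end.

(* The machine has [ntapes.+1] tapes; the input tape is tape [ord0] and the
   output tape is tape [ord_max]. *)
Record machine := Machine {
  ntapes : nat;
  work : finType;
  state : finType;
  start : state;
  halting : pred state;
  delta : state -> ntapes.+1.-tuple (symbol work) ->
          state * ntapes.+1.-tuple (symbol work * direction) }.

Definition config (M : machine) : Type :=
  state M * (ntapes M).+1.-tuple (tape (work M)).

Definition step (M : machine) (c : config M) : config M :=
  if halting c.1 then c else
  let: (q, acts) := delta c.1 [tuple scan (tnth c.2 i) | i < (ntapes M).+1] in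
  (q, [tuple move_head (tnth acts i).2 (write (tnth acts i).1 (tnth c.2 i))
        | i < (ntapes M).+1]).

Definition init (M : machine) (w : seq (symbol (work M))) : config M :=
  (start M, [tuple (if i == ord0 then Tape [::] w else Tape [::] [::])
              | i < (ntapes M).+1]).

Definition run (M : machine) (w : seq (symbol (work M))) (n : nat) : config M :=
  iter n (@step M) (init w).

(* The output is read on the output tape from the head up to the first blank. *)
Definition output (M : machine) (c : config M) : seq (symbol (work M)) :=
  let r := cells_right (tnth c.2 ord_max) in take (find (@is_blank _) r) r.

(** * Binary encodings *)

(* The [w] low-order binary digits of [n], most significant first. *)
Definition bits (w n : nat) : seq bool :=
  [seq odd (n %/ 2 ^ i)%N | i <- rev (iota 0 w)].

Definition bits_val (s : seq bool) : nat :=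
  foldl (fun n (b : bool) => (n.*2 + b)%N) 0%N s.

Definition bit_integer (B : nat) (z : int) : Prop := (`|z| < 2 ^ B)%N.

(* Sign bit, then the [B] digits of the absolute value. *)
Definition encode_int G (B : nat) (z : int) : seq (symbol G) :=
  map Bit ((z < 0) :: bits B `|z|%N) ++ [:: Sep].

(* The digits of numerator and denominator, zero-padded on the left to the same
   length, are interleaved. In this way the order of magnitude of a rational
   number x < 1 is visible on the first O(log(1/x)) digits, even when its
   numerator and denominator are much longer than that. *)
Definition encode_rat G (x : rat) : seq (symbol G) :=
  let a := `|numq x|%N in let b := `|denq x|%N in
  let w := up_log 2 (maxn a b).+1 in
  flatten [seq [:: Bit p.1; Bit p.2] | p <- zip (bits w a) (bits w b)].

Definition encode_instance G (K B : nat) (lambda mu : 'I_K -> int) (tau : int)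
    (eps : rat) : seq (symbol G) :=
  flatten [seq encode_int G B (lambda i) ++ encode_int G B (mu i)
          | i <- enum 'I_K]
  ++ encode_int G B tau ++ Sep :: encode_rat G eps.

(* On input [w], [M] halts after at most [n] steps with the fraction [v] on its
   output tape, written as numerator, separator, denominator. *)
Definition outputs_within (M : machine) (w : seq (symbol (work M))) (n : nat)
    (v : rat) : Prop :=
  let c := run w n in
  halting c.1 /\
  exists s t : seq bool,
    [/\ output c = map Bit s ++ Sep :: map Bit t,
        (0 < bits_val t)%N &
        v = (bits_val s)%:R / (bits_val t)%:R].

Arguments outputs_within : clear implicits.

(** * The standard Gaussian distribution on R^n *)

Section std_gaussian.
Context {R : realType}.
Let T := measurableTypeR R.

Definition tuple_cons n (p : T * n.-tuple T) : n.+1.-tuple T :=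
  [tuple of p.1 :: p.2].

Lemma measurable_tuple_cons n : measurable_fun setT (@tuple_cons n).
Proof.
by apply: measurable_cons; [exact: measurable_fst|exact: measurable_snd].
Qed.

HB.instance Definition _ n :=
  isMeasurableFun.Build _ _ _ _ (@tuple_cons n) (@measurable_tuple_cons n).

Fixpoint std_gaussian (n : nat) : probability (n.-tuple T) R :=
  match n with
  | 0 => dirac [tuple]
  | n'.+1 =>
      distribution ((normal_prob 0 1 : probability T R) \x std_gaussian n')%E
        (@tuple_cons n')
  end.

Lemma measurable_box n (A : 'I_n -> set T) : (forall i, measurable (A i)) ->
  measurable [set y : n.-tuple T | forall i, A i (tnth y i)].
Proof.
move=> mA.
rewrite (_ : [set y | _] = \bigcap_(i in [set: 'I_n]) ((@tnth n T ^~ i) @^-1` A i)).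
  apply: fin_bigcap_measurable => // i _.
  by rewrite -[X in measurable X]setTI; apply: measurable_tnth.
by apply/seteqP; split=> y /= Ay i; [move=> _; exact: Ay|exact: (Ay i I)].
Qed.

Lemma std_gaussian_box n (A : 'I_n -> set T) : (forall i, measurable (A i)) ->
  std_gaussian n [set y | forall i, A i (tnth y i)] =
  (\prod_(i < n) normal_prob 0 1 (A i))%E.
Proof.
elim: n A => [|n IHn] A mA /=.
  by rewrite big_ord0 diracE mem_set// => -[].
have mA' i : measurable (A (lift ord0 i)) by exact: mA.
rewrite big_ord_recl -(IHn _ mA') -product_measure1E; last 2 first.
- exact: mA.
- exact: measurable_box mA'.
rewrite /distribution /pushforward; congr (product_measure1 _ _ _).
apply/seteqP; split=> -[x y] /= H.
  split; first exact: (H ord0).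
  by move=> i; have := H (lift ord0 i); rewrite tnthS.
by move=> i; have [j ->|->] := unliftP ord0 i; [rewrite tnthS; exact: H.2|exact: H.1].
Qed.

End std_gaussian.

Definition quadratic (R : realType) (K : nat) (lambda mu : 'I_K -> int)
    (tau : int) (y : K.-tuple R) : R :=
  \sum_(i < K) ((lambda i)%:~R * tnth y i ^+ 2 + (mu i)%:~R * tnth y i)
  + tau%:~R.

(* Main.v *)
Require Import Defs.
From mathcomp Require Import all_boot all_order all_algebra.
From mathcomp Require Import all_classical all_reals all_analysis.
From mathcomp Require Import measurable_realfun lebesgue_measure.
From mathcomp Require Import zify ring lra.

Set Implicit Arguments.
Unset Strict Implicit.
Unset Printing Implicit Defensive.

Import Order.TTheory GRing.Theory Num.Theory.
Import numFieldNormedType.Exports.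

(* Only the O(log 1/eps) leading bits of the coefficients, counted from the
   largest one, matter: a coordinate with a large coefficient makes q(y)
   anticoncentrated (Fubini), so the truncation moves the sign of q only with
   small probability.  Each Gaussian coordinate is then replaced by the grid of
   step 1/m, where |y| = j/m gets the integer weight f^(j^2)(W0) with
   f(w) = w - floor(w/N); this imitates exp(-j^2/(2 m^2)) within a total variation
   controlled by Gaussian tail bounds.  The weighted number of grid points where
   the truncated quadratic is nonnegative is obtained from one big integer, the
   product over the coordinates of the sums of weight * 2^(L * value): its base-2^L
   digits count the points with a given value of the quadratic, so that multiplying
   by a block sum_u 2^(L u) adds up the digits above the threshold.  A Turing
   machine computes this product by shift-and-add; it is compiled from a language
   of unary counters and bounded loops, and it reads the O(K B) input bits only in
   linear passes, all remaining work being polynomial in 1/eps. *)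

Local Open Scope nat_scope.

(** Every parameter is a monomial in one power of two [A = 2 ^ a], where [a] is affine in the number
    of leading zero digits of eps. So [A] is found by counting input cells, is polynomial in 1/eps,
    and fixes everything else. Since any polynomial in 1/eps is affordable, all numbers except two
    big binary ones are kept in unary, and repeated addition replaces multiplication; only the
    passes over the coefficients are charged exactly. Two difficulties shape the analysis. The
    coefficients may differ wildly in magnitude, so one coordinate is selected whose coefficient is
    within a polynomial factor of the largest one; if there is none, the constant term dominates q
    on the box [-A, A]^K. And the Gaussian density is never evaluated: the answer is a ratio of two
    sums of weights, so the normalising constant cancels and the value lies in [0, 1] by
    construction. Each error term carries a factor K from the K coordinates. [A] absorbs it because
    K is polynomial in 1/eps, a logarithm being bounded by a power. *)

Notation sym := (symbol void).

(** * Tapes as functions of the position *)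

Definition atape : Type := (nat -> sym) * (nat -> sym).

Definition spush (s : sym) (f : nat -> sym) : nat -> sym :=
  fun i => if i is k.+1 then f k else s.

Definition spop (f : nat -> sym) : nat -> sym := fun i => f i.+1.

Definition ascan (a : atape) : sym := a.2 0.

Definition aact (x : sym * direction) (a : atape) : atape :=
  match x.2 with
  | Stay => (a.1, spush x.1 (spop a.2))
  | MoveR => (spush x.1 a.1, spop a.2)
  | MoveL => (spop a.1, spush (a.1 0) (spush x.1 (spop a.2)))
  end.

(** Lists that differ by trailing blanks denote the same tape. As functions of the position they
    become equal, so tape states can be rewritten by equations. *)
Definition abs (t : tape void) : atape :=
  (nth Blank (cells_left t), nth Blank (cells_right t)).

Lemma nth_spush (s : sym) l : nth Blank (s :: l) = spush s (nth Blank l).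
Proof. by apply/funext => -[|i]. Qed.

Lemma nth_spop (l : seq sym) : nth Blank (behead l) = spop (nth Blank l).
Proof. by apply/funext => i; rewrite /spop nth_behead. Qed.

Lemma abs_act s d t : abs (move_head d (write s t)) = aact (s, d) (abs t).
Proof.
case: d; rewrite /abs /aact /= ?nth_spush ?nth_spop ?nth0 //.
Qed.

Lemma scan_abs t : scan t = ascan (abs t).
Proof. by rewrite /scan /ascan /= nth0. Qed.

Lemma aact_stay a : aact (ascan a, Stay) a = a.
Proof. by case: a => l r; rewrite /aact /=; congr pair; apply/funext => -[|i]. Qed.

(** * Structured programs on the tapes of a Turing machine *)

Section Kernel.
Variable n : nat.

(** Indexing by [nat] instead of a tuple keeps the syntax of programs free of the number of tapes;
    tapes beyond [n] scan as blank and are never changed. *)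
Definition tapes := nat -> atape.

Definition scans (T : tapes) : nat -> sym :=
  fun i => if i <= n then ascan (T i) else Blank.

Definition apply_act (a : nat -> sym * direction) (T : tapes) : tapes :=
  fun i => if i <= n then aact (a i) (T i) else T i.

Inductive kcmd :=
| KAct of (nat -> sym) -> nat -> sym * direction
| KSeq of kcmd & kcmd
| KIf of pred (nat -> sym) & kcmd & kcmd
| KWhile of pred (nat -> sym) & kcmd.

Inductive kexec : kcmd -> tapes -> nat -> tapes -> Prop :=
| XAct f T : kexec (KAct f) T 1 (apply_act (f (scans T)) T)
| XSeq c1 c2 T1 n1 T2 n2 T3 :
    kexec c1 T1 n1 T2 -> kexec c2 T2 n2 T3 -> kexec (KSeq c1 c2) T1 (n1 + n2) T3
| XIf b c1 c2 T n1 T' : kexec (if b (scans T) then c1 else c2) T n1 T' ->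
    kexec (KIf b c1 c2) T n1.+1 T'
| XWhile0 (b : pred _) c T : b (scans T) = false -> kexec (KWhile b c) T 1 T
| XWhile1 (b : pred _) c T1 n1 T2 n2 T3 : b (scans T1) -> kexec c T1 n1 T2 ->
    kexec (KWhile b c) T2 n2 T3 -> kexec (KWhile b c) T1 (n1 + n2).+1 T3.

(** States are control points: [unit] for an action, and an extra [None] for the instant at which a
    test is evaluated, which costs one step and leaves the tapes alone. *)
Fixpoint kstate (c : kcmd) : finType :=
  match c with
  | KAct _ => unit
  | KSeq a b => (kstate a + kstate b)%type
  | KIf _ a b => option (kstate a + kstate b)%type
  | KWhile _ a => option (kstate a)
  end.

Fixpoint kstart (c : kcmd) : kstate c :=
  match c with
  | KAct _ => tt
  | KSeq a b => inl (kstart a)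
  | KIf _ a b => None
  | KWhile _ a => None
  end.

Definition idle (s : nat -> sym) : nat -> sym * direction := fun i => (s i, Stay).

(** A first component [None] means that the command exits; the enclosing command decides where
    control goes next. *)
Fixpoint kstep (c : kcmd) :
    kstate c -> (nat -> sym) -> option (kstate c) * (nat -> sym * direction) :=
  match c return
    kstate c -> (nat -> sym) -> option (kstate c) * (nat -> sym * direction) with
  | KAct f => fun _ s => (None, f s)
  | KSeq a b => fun q s =>
      match q with
      | inl q1 => let r := kstep q1 s in
          (Some (if r.1 is Some q' then inl q' else inr (kstart b)), r.2)
      | inr q2 => let r := kstep q2 s in (omap inr r.1, r.2)
      end
  | KIf t a b => fun q s =>
      match q with
      | None => (Some (Some (if t s then inl (kstart a) else inr (kstart b))), idle s)
      | Some (inl q1) => let r := kstep q1 s in (omap (Some \o inl) r.1, r.2)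
      | Some (inr q2) => let r := kstep q2 s in (omap (Some \o inr) r.1, r.2)
      end
  | KWhile t a => fun q s =>
      match q with
      | None => (if t s then Some (Some (kstart a)) else None, idle s)
      | Some q1 => let r := kstep q1 s in (Some r.1, r.2)
      end
  end.

Inductive kruns c : kstate c -> tapes -> nat -> tapes -> Prop :=
| RExit q T : (kstep q (scans T)).1 = None ->
    kruns q T 1 (apply_act (kstep q (scans T)).2 T)
| RNext q q' T k T' : (kstep q (scans T)).1 = Some q' ->
    kruns q' (apply_act (kstep q (scans T)).2 T) k T' -> kruns q T k.+1 T'.

Lemma apply_idle T : apply_act (idle (scans T)) T = T.
Proof.
apply/funext => i; rewrite /apply_act /idle /scans.
by case: leqP => // _; rewrite aact_stay.
Qed.

Lemma kruns_exit c (q : kstate c) T a : kstep q (scans T) = (None, a) ->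
  kruns q T 1 (apply_act a T).
Proof.
move=> E; have := @RExit _ q T; rewrite E; exact.
Qed.

Lemma kruns_next c (q q' : kstate c) T a k T' : kstep q (scans T) = (Some q', a) ->
  kruns q' (apply_act a T) k T' -> kruns q T k.+1 T'.
Proof.
by move=> E r; apply: (@RNext _ q q'); rewrite E.
Qed.

Lemma kruns_seq2 a b (q : kstate b) T k T' : kruns q T k T' ->
  @kruns (KSeq a b) (inr q) T k T'.
Proof.
elim=> {q T k T'} [q T E|q q' T k T' E _ IH].
  by apply: kruns_exit => /=; rewrite E.
by apply: kruns_next IH => /=; rewrite E.
Qed.

Lemma kruns_seq a b (q : kstate a) T k T' k2 T2 : kruns q T k T' ->
  kruns (kstart b) T' k2 T2 -> @kruns (KSeq a b) (inl q) T (k + k2) T2.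
Proof.
move=> H r2; elim: H r2 => {q T k T'} [q T E|q q' T k T' E _ IH] r2.
  by apply: kruns_next (kruns_seq2 _ r2) => /=; rewrite E.
by rewrite addSn; apply: kruns_next (IH r2) => /=; rewrite E.
Qed.

Lemma kruns_if1 t a b (q : kstate a) T k T' : kruns q T k T' ->
  @kruns (KIf t a b) (Some (inl q)) T k T'.
Proof.
elim=> {q T k T'} [q T E|q q' T k T' E _ IH].
  by apply: kruns_exit => /=; rewrite E.
by apply: kruns_next IH => /=; rewrite E.
Qed.

Lemma kruns_if2 t a b (q : kstate b) T k T' : kruns q T k T' ->
  @kruns (KIf t a b) (Some (inr q)) T k T'.
Proof.
elim=> {q T k T'} [q T E|q q' T k T' E _ IH].
  by apply: kruns_exit => /=; rewrite E.
by apply: kruns_next IH => /=; rewrite E.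
Qed.

Lemma kruns_while t a (q : kstate a) T k T' k2 T2 : kruns q T k T' ->
  @kruns (KWhile t a) None T' k2 T2 -> @kruns (KWhile t a) (Some q) T (k + k2) T2.
Proof.
move=> H r2; elim: H r2 => {q T k T'} [q T E|q q' T k T' E _ IH] r2.
  by apply: kruns_next r2 => /=; rewrite E.
by rewrite addSn; apply: kruns_next (IH r2) => /=; rewrite E.
Qed.

Lemma kexec_kruns c T k T' : kexec c T k T' -> kruns (kstart c) T k T'.
Proof.
elim=> {c T k T'} /=.
- by move=> f T; exact: kruns_exit.
- by move=> c1 c2 T1 n1 T2 n2 T3 _ r1 _ r2; exact: kruns_seq r1 r2.
- move=> b c1 c2 T n1 T' _ r; apply: kruns_next => //; rewrite apply_idle.
  by case: (b _) r => r; [exact: kruns_if1|exact: kruns_if2].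
- move=> b c T E; rewrite -[T in X in kruns _ _ _ X]apply_idle.
  by apply: kruns_exit; rewrite /= E.
- move=> b c T1 n1 T2 n2 T3 E _ r1 _ r2.
  apply: kruns_next; first by rewrite /= E.
  by rewrite apply_idle; exact: kruns_while r1 r2.
Qed.

Definition kmachine (c : kcmd) : machine :=
  @Machine n void (option (kstate c)) (Some (kstart c)) (fun q => ~~ isSome q)
    (fun q s => if q is Some q' then
        let r := kstep q' (fun i => nth Blank s i) in
        (r.1, [tuple r.2 i | i < n.+1])
      else (None, [tuple (tnth s i, Stay) | i < n.+1])).

Definition models (T : tapes) (t : n.+1.-tuple (tape void)) :=
  forall i : 'I_n.+1, abs (tnth t i) = T i.

Lemma models_step c q T t : models T t ->
  let r := kstep q (scans T) in
  exists2 t', @step (kmachine c) (Some q, t) = (r.1, t') & models (apply_act r.2 T) t'.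
Proof.
move=> mT r; set sc := [tuple scan (tnth t i) | i < n.+1].
have Esc : (fun i => nth Blank sc i) = scans T.
  apply/funext => i; rewrite /scans; case: leqP => li.
    by rewrite -[i]/(val (Ordinal (li : i < n.+1))) -tnth_nth tnth_mktuple scan_abs mT.
  by rewrite nth_default // size_tuple.
eexists; first by rewrite /step /= -/sc Esc -/r; reflexivity.
move=> i; rewrite tnth_mktuple abs_act tnth_mktuple mT /apply_act -ltnS ltn_ord.
by congr aact; case: (r.2 i).
Qed.

Lemma kruns_machine c (q : kstate c) T k T' : kruns q T k T' ->
  forall t, models T t ->
  exists2 t', iter k (@step (kmachine c)) (Some q, t) = (None, t') & models T' t'.
Proof.
elim=> {q T k T'} [q T E|q q' T k T' E _ IH] t mT.
  have [t' S m] := models_step q mT; exists t' => //=.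
  by rewrite S E.
have [t1 S m1] := models_step q mT.
have [t' S' m'] := IH _ m1; exists t' => //.
by rewrite iterSr S E.
Qed.

Lemma iter_halted c k t : iter k (@step (kmachine c)) (None, t) = (None, t).
Proof. by elim: k => // k IH; rewrite iterS IH. Qed.

Definition init_tapes (w : seq sym) : tapes :=
  fun i => if i == 0 then abs (Tape [::] w) else abs (Tape [::] [::]).

(** A halted configuration is a fixed point of [step], so an upper bound [k'] on the running time
    serves as well as the exact count. *)
Lemma kexec_run c w k k' T' : kexec c (init_tapes w) k T' -> k <= k' ->
  exists2 t', @run (kmachine c) w k' = (None, t') & models T' t'.
Proof.
move=> /kexec_kruns/kruns_machine r /subnK <-.
have m0 : models (init_tapes w) (init (M := kmachine c) w).2.
  by move=> i; rewrite tnth_mktuple /init_tapes -val_eqE /=; case: ifP.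
have [t' E m'] := r _ m0; exists t' => //.
by rewrite /run iterD [X in iter _ _ X](E : _ = _) iter_halted.
Qed.

End Kernel.

(** * Unary counters, bounded loops and bit tapes *)

(* [gtape e P f] has the cell [f i] at every position [i >= 0], the end symbol
   [e] at position -1, and its head at position [P]; the head of [gend e f] is
   at position -1. *)
Definition gtape (e : sym) (P : nat) (f : nat -> sym) : atape :=
  (fun i => if i < P then f (P - i.+1) else if i == P then e else Blank,
   fun i => f (P + i)).

Definition gend (e : sym) (f : nat -> sym) : atape := (fun=> Blank, spush e f).

Definition fset (f : nat -> sym) (P : nat) (s : sym) : nat -> sym :=
  fun i => if i == P then s else f i.

Lemma fset_id f P : fset f P (f P) = f.
Proof. by apply/funext => i; rewrite /fset; case: eqP => // ->. Qed.

Lemma ascan_gtape e P f : ascan (gtape e P f) = f P.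
Proof. by rewrite /ascan /= addn0. Qed.

Lemma gtape_R e P f s : aact (s, MoveR) (gtape e P f) = gtape e P.+1 (fset f P s).
Proof.
rewrite /aact /gtape /=; congr pair; apply/funext => i; rewrite /spush /spop /fset.
  case: i => [|i]; first by rewrite /= subn1 eqxx.
  by rewrite ltnS eqSS subSS; case: ltnP => // lt; case: eqP => //; lia.
by rewrite -addSnnS; case: eqP => //; lia.
Qed.

Lemma gtape_S e P f s : aact (s, Stay) (gtape e P f) = gtape e P (fset f P s).
Proof.
rewrite /aact /gtape /=; congr pair; apply/funext => i; rewrite /spush /spop /fset.
  by case: ltnP => // lt; case: eqP => //; lia.
case: i => [|i]; first by rewrite addn0 eqxx.
by case: eqP => //; lia.
Qed.

Lemma gtape_L e P f s :
  aact (s, MoveL) (gtape e P.+1 f) = gtape e P (fset f P.+1 s).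
Proof.
rewrite /aact /gtape /=; congr pair; apply/funext => i; rewrite /spush /spop /fset.
  rewrite ltnS eqSS subSS; case: ltnP => // lt; case: eqP => //; lia.
case: i => [|[|i]]; rewrite ?addn0 ?addn1 ?eqxx ?subn1 //=.
  by case: eqP => //; lia.
rewrite addSnnS; case: eqP => //; lia.
Qed.

Lemma gtape_L0 e f s : aact (s, MoveL) (gtape e 0 f) = gend e (fset f 0 s).
Proof.
rewrite /aact /gtape /gend /=; congr pair; apply/funext => i.
by case: i => [|[|i]].
Qed.

Lemma gend_R e f : aact (e, MoveR) (gend e f) = gtape e 0 f.
Proof.
rewrite /aact /gtape /gend /=; congr pair; apply/funext => i.
by case: i.
Qed.

Arguments gtape : simpl never.
Arguments gend : simpl never.
Arguments ascan : simpl never.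

Definition blank : atape := (fun=> Blank, fun=> Blank).

Definition unary (k : nat) : nat -> sym := fun i => if i < k then Bit true else Blank.

Definition ctr (k : nat) : atape := gtape Blank k (unary k).

Lemma unaryS k : fset (unary k) k (Bit true) = unary k.+1.
Proof. by apply/funext => i; rewrite /fset /unary; case: eqP => [->|?]; repeat case: ltnP => ? //; exfalso; lia. Qed.

Lemma unaryP k : fset (unary k.+1) k Blank = unary k.
Proof. by apply/funext => i; rewrite /fset /unary; case: eqP => [->|?]; repeat case: ltnP => ? //; exfalso; lia. Qed.

Lemma gtape_blank P : gtape Blank P (unary 0) = blank.
Proof. by congr pair; apply/funext => i; case: ifP => //; case: ifP. Qed.

Lemma gend_blank : gend Blank (unary 0) = blank.
Proof. by congr pair; apply/funext => -[|i]. Qed.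

Lemma ctr0 : ctr 0 = blank. Proof. exact: gtape_blank. Qed.

Lemma ctr_inc k : aact (Bit true, MoveR) (ctr k) = ctr k.+1.
Proof. by rewrite /ctr gtape_R unaryS. Qed.

Definition isbit (s : sym) := if s is Bit _ then true else false.

(** * Commands with private loop tapes *)

Notation last_tape := 34.

Definition upd (T : tapes) x a : tapes := fun i => if i == x then a else T i.

Lemma upd_eq T x a : upd T x a x = a. Proof. by rewrite /upd eqxx. Qed.
Lemma upd_ne T x y a : (y == x) = false -> upd T x a y = T y.
Proof. by rewrite /upd => ->. Qed.
Lemma upd_upd T x a b : upd (upd T x a) x b = upd T x b.
Proof. by apply/funext => i; rewrite /upd; case: eqP. Qed.
Lemma upd_id T x : upd T x (T x) = T.
Proof. by apply/funext => i; rewrite /upd; case: eqP => // ->. Qed.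
Lemma upd_same T x a : T x = a -> upd T x a = T.
Proof. by move=> <-; exact: upd_id. Qed.

Definition acts := seq (nat * ((nat -> sym) -> sym * direction)).

Definition kact (al : acts) : kcmd :=
  KAct (fun s i => foldr (fun p k => if i == p.1 then p.2 s else k) (s i, Stay) al).

Definition acts_on (al : acts) (s : nat -> sym) (T : tapes) : tapes :=
  foldr (fun p T' => upd T' p.1 (aact (p.2 s) (T p.1))) T al.

Lemma kact_exec al T : all (fun p => p.1 <= last_tape) al ->
  kexec last_tape (kact al) T 1 (acts_on al (scans last_tape T) T).
Proof.
move=> ok; have := XAct last_tape (fun s i =>
  foldr (fun p k => if i == p.1 then p.2 s else k) (s i, Stay) al) T.
congr kexec; apply/funext => i; rewrite /apply_act /acts_on.
elim: al ok => [|p al IH] /= ok.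
  by case: ifP => // li; rewrite /scans li aact_stay.
case/andP: ok => okp /IH {}IH; rewrite /upd.
case: eqP => [->|_]; first by rewrite okp.
exact: IH.
Qed.

(** Tapes 1 to 10 hold only loop counters. Basic actions and tests see a masked scan in which these
    tapes are blank, so they behave the same whatever an enclosing loop keeps there. *)
Definition is_loop i := 0 < i <= 10.
Definition ok_tape i := ~~ is_loop i && (i <= last_tape).

Definition merge (T lp : tapes) : tapes := fun i => if is_loop i then lp i else T i.

Definition mscan (T : tapes) : nat -> sym :=
  fun i => if ok_tape i then ascan (T i) else Blank.

Definition mask (s : nat -> sym) : nat -> sym :=
  fun i => if is_loop i then Blank else s i.

Lemma mask_merge T lp : mask (scans last_tape (merge T lp)) = mscan T.
Proof.
apply/funext => i; rewrite /mask /scans /merge /mscan /ok_tape.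
by case: (is_loop i).
Qed.

(** The argument is the nesting depth: a loop at depth [d] keeps its counter on tape [d.+1] and runs
    its body at depth [d.+1]. *)
Definition cmd := nat -> kcmd.

Definition Act (al : acts) : cmd :=
  fun _ => kact [seq (p.1, fun s => p.2 (mask s)) | p <- al].
Definition Seq (c1 c2 : cmd) : cmd := fun d => KSeq (c1 d) (c2 d).
Definition If (b : pred (nat -> sym)) (c1 c2 : cmd) : cmd :=
  fun d => KIf (b \o mask) (c1 d) (c2 d).
Definition While (b : pred (nat -> sym)) (c : cmd) : cmd :=
  fun d => KWhile (b \o mask) (c d).
Notation "c1 ;; c2" := (Seq c1 c2) (at level 100, right associativity).

(* [tri D c T t T'] : with [D] free loop tapes, [c] leads from [T] to [T'] in at
   most [t] steps, whatever is on the loop tapes in use outside. *)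
Definition tri (D : nat) (c : cmd) (T : tapes) (t : nat) (T' : tapes) : Prop :=
  forall d lp, d + D <= 10 -> (forall i, d < i -> lp i = blank) ->
  exists2 k, k <= t & kexec last_tape (c d) (merge T lp) k (merge T' lp).

Lemma tri_le D D' c T t t' T' : D <= D' -> t <= t' -> tri D c T t T' -> tri D' c T t' T'.
Proof.
move=> lD lt H d lp ld bl; have [|k lk ex] := H d lp _ bl; first by lia.
by exists k => //; lia.
Qed.

Lemma tri_wk D D' c T t t' T' : tri D c T t T' -> D <= D' -> t <= t' -> tri D' c T t' T'.
Proof. by move=> H lD lt; exact: tri_le H. Qed.

Lemma tri_seq D c1 c2 T1 t1 T2 t2 T3 :
  tri D c1 T1 t1 T2 -> tri D c2 T2 t2 T3 -> tri D (c1 ;; c2) T1 (t1 + t2) T3.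
Proof.
move=> H1 H2 d lp ld bl; have [k1 l1 e1] := H1 d lp ld bl.
have [k2 l2 e2] := H2 d lp ld bl; exists (k1 + k2); first exact: leq_add.
exact: XSeq e1 e2.
Qed.

Lemma upd_merge T lp x a : ~~ is_loop x -> upd (merge T lp) x a = merge (upd T x a) lp.
Proof.
move=> nl; apply/funext => i; rewrite /upd /merge.
by case: eqP => // ->; rewrite (negbTE nl).
Qed.

Lemma upd_merge_loop T lp x a : is_loop x -> upd (merge T lp) x a = merge T (upd lp x a).
Proof.
move=> nl; apply/funext => i; rewrite /upd /merge.
by case: eqP => // ->; rewrite nl.
Qed.

Lemma merge_ok T lp x : ~~ is_loop x -> merge T lp x = T x.
Proof. by rewrite /merge => /negbTE ->. Qed.

Lemma merge_loop T lp x : is_loop x -> merge T lp x = lp x.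
Proof. by rewrite /merge => ->. Qed.

Lemma tri_act al T : all (fun p => ok_tape p.1) al ->
  tri 0 (Act al) T 1 (acts_on al (mscan T) T).
Proof.
move=> ok d lp _ _; exists 1 => //.
have E : acts_on [seq (p.1, fun s => p.2 (mask s)) | p <- al]
            (scans last_tape (merge T lp)) (merge T lp)
        = merge (acts_on al (mscan T) T) lp.
  rewrite -[mscan T](mask_merge _ lp) /acts_on.
  elim: al ok => [|p al IH] //= /andP[/andP[okp _] ok].
  by rewrite IH // upd_merge // merge_ok.
rewrite -E; apply: kact_exec; rewrite all_map; apply: sub_all ok.
by move=> p /andP[].
Qed.

Lemma tri_if D (b : pred _) c1 c2 T t T' :
  tri D (if b (mscan T) then c1 else c2) T t T' -> tri D (If b c1 c2) T t.+1 T'.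
Proof.
move=> H d lp ld bl; have [k lk ex] := H d lp ld bl; exists k.+1 => //.
by apply: XIf; rewrite /= mask_merge; move: ex; case: ifP.
Qed.

Lemma tri_while0 D (b : pred _) c T : b (mscan T) = false -> tri D (While b c) T 1 T.
Proof.
move=> E d lp ld bl; exists 1 => //; apply: XWhile0; by rewrite /= mask_merge.
Qed.

Lemma tri_while1 D (b : pred _) c T1 t1 T2 t2 T3 : b (mscan T1) ->
  tri D c T1 t1 T2 -> tri D (While b c) T2 t2 T3 ->
  tri D (While b c) T1 (t1 + t2).+1 T3.
Proof.
move=> E H1 H2 d lp ld bl; have [k1 l1 e1] := H1 d lp ld bl.
have [k2 l2 e2] := H2 d lp ld bl; exists (k1 + k2).+1; first by lia.
by apply: XWhile1 e1 e2; rewrite /= mask_merge.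
Qed.

Lemma tri_while D (b : pred _) c k t (F : nat -> tapes) :
  (forall i, i < k -> b (mscan (F i)) /\ tri D c (F i) t (F i.+1)) ->
  b (mscan (F k)) = false -> tri D (While b c) (F 0) (k * t.+1).+1 (F k).
Proof.
elim: k F => [|k IH] F H H0; first exact: tri_while0.
have [b0 c0] := H 0 isT.
have := IH (fun i => F i.+1) (fun i li => H i.+1 li) H0.
move=> /(tri_while1 b0 c0); apply: tri_le => //; lia.
Qed.

Definition loop_tape k := if k is k'.+1 then gtape Blank k' (unary k) else blank.

(** The count is first copied to the loop tape, and each pass erases one mark there. Hence the body
    is free to change the counter [x]; for instance [For x (Inc x)] doubles it. *)
Definition For (x : nat) (c : cmd) : cmd := fun d =>
  KSeq (kact [:: (x, fun s => (s x, MoveL))])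
 (KSeq (KWhile (fun s => isbit (s x))
    (kact [:: (d.+1, fun=> (Bit true, MoveR)); (x, fun s => (s x, MoveL))]))
 (KSeq (kact [:: (x, fun s => (s x, MoveR))])
 (KSeq (KWhile (fun s => isbit (s x)) (kact [:: (x, fun s => (s x, MoveR))]))
 (KSeq (kact [:: (d.+1, fun s => (s d.+1, MoveL))])
 (KWhile (fun s => isbit (s d.+1))
   (KSeq (kact [:: (d.+1, fun=> (Blank, MoveL))]) (c d.+1))))))).

Lemma kact_exec' al T T' : all (fun p => p.1 <= last_tape) al ->
  acts_on al (scans last_tape T) T = T' -> kexec last_tape (kact al) T 1 T'.
Proof. by move=> ok <-; exact: kact_exec. Qed.

Lemma kwhile_exec (b : pred _) c k t (F : nat -> tapes) :
  (forall i, i < k -> b (scans last_tape (F i)) /\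
     exists2 j, j <= t & kexec last_tape c (F i) j (F i.+1)) ->
  b (scans last_tape (F k)) = false ->
  exists2 j, j <= (k * t.+1).+1 & kexec last_tape (KWhile b c) (F 0) j (F k).
Proof.
elim: k F => [|k IH] F H H0; first by exists 1 => //; exact: XWhile0.
have [b0 [j0 l0 c0]] := H 0 isT.
have [j1 l1 c1] := IH (fun i => F i.+1) (fun i li => H i.+1 li) H0.
exists (j0 + j1).+1; first by rewrite mulSn; lia.
exact: XWhile1 c0 c1.
Qed.

(** The tape of [x] during the copy: contents unchanged, [q] marks still to be copied, head on the
    last of them. *)
Definition back_tape k q := if q is q'.+1 then gtape Blank q' (unary k) else gend Blank (unary k).

Lemma ascan_back k q : q <= k -> isbit (ascan (back_tape k q)) = (0 < q).
Proof. by case: q => [|q] lq //; rewrite /back_tape ascan_gtape /unary lq. Qed.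

Lemma ascan_loop k : isbit (ascan (loop_tape k)) = (0 < k).
Proof. by case: k => [|q] //; rewrite /loop_tape ascan_gtape /unary ltnSn. Qed.

Lemma scans_ok T x : x <= last_tape -> scans last_tape T x = ascan (T x).
Proof. by rewrite /scans => ->. Qed.

Lemma tri_for D x c k t T (F : nat -> tapes) : ok_tape x -> T x = ctr k ->
  (forall i, i < k -> tri D c (F i) t (F i.+1)) -> F 0 = T ->
  tri D.+1 (For x c) T (k * (t + 6) + 8) (F k).
Proof.
move=> /andP[nl lx] Tx body F0 d lp ld bl.
have il : is_loop d.+1 by rewrite /is_loop; lia.
have ll : d.+1 <= last_tape by lia.
have nxd : (x == d.+1) = false by apply/negP => /eqP E; rewrite E il in nl.
have ndx : (d.+1 == x) = false by rewrite eq_sym.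
have lpd : lp d.+1 = blank by apply: bl.
pose M := merge T lp.
have Mx : M x = ctr k by rewrite /M merge_ok.
have Md : M d.+1 = blank by rewrite /M merge_loop.
pose U q r := upd (upd M x r) d.+1 q.
have UE q r : upd (upd M d.+1 q) x r = U q r.
  apply/funext => i; rewrite /U /upd; case: eqP => // ->; by rewrite nxd.
have U0 : M = U (ctr 0) (ctr k).
  by rewrite /U ctr0 (upd_same Mx) (upd_same Md).
have Ux q r : U q r x = r by rewrite /U upd_ne // upd_eq.
have Ud q r : U q r d.+1 = q by rewrite /U upd_eq.
have Uux q r r' : upd (U q r) x r' = U q r'.
  by rewrite -UE upd_upd UE.
have Uud q r q' : upd (U q r) d.+1 q' = U q' r by rewrite /U upd_upd.
have E1 : kexec last_tape (kact [:: (x, fun s => (s x, MoveL))]) M 1 (U (ctr 0) (back_tape k k)).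
  apply: kact_exec'; first by rewrite /= lx.
  rewrite [X in acts_on _ _ X]U0 /acts_on /= U0 Uux scans_ok // !Ux; congr U.
  rewrite /ctr ascan_gtape; case: (k) => [|k'].
    by rewrite gtape_L0 fset_id.
  by rewrite gtape_L fset_id.
have [j2 l2 E2] : exists2 j, j <= (k * 2).+1 & kexec last_tape (KWhile (fun s => isbit (s x))
    (kact [:: (d.+1, fun=> (Bit true, MoveR)); (x, fun s => (s x, MoveL))]))
    (U (ctr 0) (back_tape k k)) j (U (ctr k) (back_tape k 0)).
  have := @kwhile_exec (fun s => isbit (s x)) (kact [:: (d.+1, fun=> (Bit true, MoveR)); (x, fun s => (s x, MoveL))])
    k 1 (fun i => U (ctr i) (back_tape k (k - i))).
  rewrite subn0 subnn; apply; last by rewrite scans_ok // Ux.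
  move=> i li; split; first by rewrite scans_ok // Ux ascan_back ?leq_subr //; lia.
  exists 1 => //; apply: kact_exec'; first by rewrite /= lx ll.
  rewrite /acts_on /= Uux Uud Ud ctr_inc scans_ok // Ux; congr U.
  have -> : k - i = (k - i.+1).+1 by lia.
  rewrite /back_tape ascan_gtape; case: (k - i.+1) => [|q].
    by rewrite gtape_L0 fset_id.
  by rewrite gtape_L fset_id.
have E3 : kexec last_tape (kact [:: (x, fun s => (s x, MoveR))]) (U (ctr k) (back_tape k 0))
   1 (U (ctr k) (gtape Blank 0 (unary k))).
  apply: kact_exec'; first by rewrite /= lx.
  by rewrite /acts_on /= Uux scans_ok // !Ux /= (gend_R Blank).
have [j4 l4 E4] : exists2 j, j <= (k * 2).+1 & kexec last_tape
    (KWhile (fun s => isbit (s x)) (kact [:: (x, fun s => (s x, MoveR))]))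
    (U (ctr k) (gtape Blank 0 (unary k))) j (U (ctr k) (ctr k)).
  have := @kwhile_exec (fun s => isbit (s x)) (kact [:: (x, fun s => (s x, MoveR))])
    k 1 (fun i => U (ctr k) (gtape Blank i (unary k))).
  apply; last by rewrite scans_ok // Ux ascan_gtape /unary ltnn.
  move=> i li; split; first by rewrite scans_ok // Ux ascan_gtape /unary li.
  exists 1 => //; apply: kact_exec'; first by rewrite /= lx.
  by rewrite /acts_on /= Uux scans_ok // !Ux ascan_gtape gtape_R fset_id.
have E5 : kexec last_tape (kact [:: (d.+1, fun s => (s d.+1, MoveL))]) (U (ctr k) (ctr k)) 1
    (U (loop_tape k) (ctr k)).
  apply: kact_exec'; first by rewrite /= ll.
  rewrite /acts_on /= Uud scans_ok // !Ud; congr U.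
  rewrite /ctr ascan_gtape; case: (k) => [|k'].
    by rewrite gtape_L0 fset_id gend_blank.
  by rewrite gtape_L fset_id.
(* After [i] rounds the loop tape holds the [k - i] remaining ones. *)
pose G i := merge (F i) (upd lp d.+1 (loop_tape (k - i))).
have G0 : U (loop_tape k) (ctr k) = G 0.
  by rewrite /G subn0 F0 -upd_merge_loop // /U (upd_same Mx).
have [j6 l6 E6] : exists2 j, j <= (k * t.+2).+1 & kexec last_tape
    (KWhile (fun s => isbit (s d.+1))
   (KSeq (kact [:: (d.+1, fun=> (Blank, MoveL))]) (c d.+1))) (G 0) j (G k).
  apply: kwhile_exec; last by rewrite scans_ok // /G merge_loop // upd_eq subnn.
  move=> i li; split.
    by rewrite scans_ok // /G merge_loop // upd_eq ascan_loop subn_gt0.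
  (* The body runs one level deeper, where this loop tape belongs to the outside; this is why [tri]
     quantifies over the contents of the loop tapes in use. *)
  pose lp' := upd lp d.+1 (loop_tape (k - i.+1)).
  have [||j lj Ej] := body i li d.+1 lp'; first by lia.
    by move=> i' li'; rewrite /lp' upd_ne ?bl //; lia.
  exists (1 + j); first by lia.
  apply: XSeq Ej; apply: kact_exec'; first by rewrite /= ll.
  rewrite /acts_on /= /G merge_loop // upd_eq upd_merge_loop // upd_upd /lp'.
  congr (merge _ (upd _ _ _)).
  have -> : k - i = (k - i.+1).+1 by lia.
  rewrite /loop_tape; case: (k - i.+1) => [|q].
    by rewrite gtape_L0 unaryP gend_blank.
  by rewrite gtape_L unaryP.
have Gk : G k = merge (F k) lp by rewrite /G subnn (upd_same lpd).
exists (1 + (j2 + (1 + (j4 + (1 + j6))))); first by lia.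
rewrite -Gk; apply: XSeq E1 _; apply: XSeq E2 _; apply: XSeq E3 _; apply: XSeq E4 _.
by apply: XSeq E5 _; rewrite G0.
Qed.

(** * Tape layout, binary numbers and counter operations *)

Notation tIn := 0.  Notation tA0 := 11. Notation tA := 12. Notation tM := 13.
Notation tJ := 14.  Notation tN := 15.  Notation tW0 := 16. Notation tL := 17.
Notation tOff := 18. Notation tS := 19. Notation tLen := 20. Notation tP := 21.
Notation tj := 22.  Notation tw := 23.  Notation tr := 24.  Notation tLam := 25.
Notation tMu := 26. Notation tThr := 27. Notation tOr := 28. Notation tAcc := 29.
Notation tNew := 30. Notation tCar := 31. Notation tSl := 32. Notation tSm := 33.
Notation tOut := 34.

Definition issep (s : sym) := if s is Sep then true else false.
Definition isone (s : sym) := if s is Bit true then true else false.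
Definition cell (b : bool) : sym := if b then Bit true else Blank.

Lemma isone_cell b : isone (cell b) = b. Proof. by case: b. Qed.

Definition bit (v i : nat) : bool := odd (v %/ 2 ^ i).
Definition cells (v : nat) : nat -> sym := fun i => cell (bit v i).
(** Least significant digit at position 0 and zero digits written as blanks: the blank tail supplies
    the leading zeros, so no length has to be recorded. The head position [P] acts as a shift by
    [2 ^ P] in additions. *)
Definition nt (P v : nat) : atape := gtape Sep P (cells v).

Lemma bit_high h b q l i : l < 2 ^ q -> q < i ->
  bit ((h * 2 + nat_of_bool b) * 2 ^ q + l) i = bit h (i - q.+1).
Proof.
move=> ll li; rewrite /bit.
have -> : 2 ^ i = 2 ^ q * (2 * 2 ^ (i - q.+1)) by rewrite -expnS -expnD; congr expn; lia.
rewrite !divnMA divnMDl ?expn_gt0 // (divn_small ll) addn0.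
by rewrite divnMDl // [b %/ 2]divn_small ?addn0 //; case: b.
Qed.

Lemma bit_low a q l i : i < q -> bit (a * 2 ^ q + l) i = bit l i.
Proof.
move=> li; rewrite /bit.
have -> : 2 ^ q = 2 * 2 ^ (q - i.+1) * 2 ^ i by rewrite -expnS -expnD; congr expn; lia.
by rewrite mulnA divnMDl ?expn_gt0 // oddD !oddM /= andbF.
Qed.

Lemma bit_at h b q l : l < 2 ^ q -> bit ((h * 2 + nat_of_bool b) * 2 ^ q + l) q = b.
Proof.
move=> ll; rewrite /bit divnMDl ?expn_gt0 // (divn_small ll) addn0.
by rewrite oddD oddM andbF /= oddb.
Qed.

(** The new and the old digit stand on opposite sides of the hypothesis, which avoids truncated
    subtraction. *)
Lemma fset_cells X X' q (b : bool) : X + b * 2 ^ q = X' + bit X q * 2 ^ q ->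
  fset (cells X) q (cell b) = cells X'.
Proof.
have := divn_eq X (2 ^ q); have := divn_eq (X %/ 2 ^ q) 2.
set l := X %% 2 ^ q; set h := X %/ 2 ^ q %/ 2; rewrite modn2 -/(bit X q) => E1 E2.
have ll : l < 2 ^ q by rewrite ltn_mod expn_gt0.
rewrite E1 in E2 => E; have {E} -> : X' = (h * 2 + b) * 2 ^ q + l by lia.
rewrite [X]E2; apply/funext => i; rewrite /fset /cells.
case: eqP => [->|ne]; first by rewrite bit_at.
case: (ltnP i q) => li; first by rewrite !bit_low.
by rewrite !bit_high //; lia.
Qed.

Lemma bit_modn v k : v %% 2 ^ k.+1 = v %% 2 ^ k + bit v k * 2 ^ k.
Proof.
have := divn_eq v (2 ^ k); have := divn_eq (v %/ 2 ^ k) 2; have := divn_eq v (2 ^ k.+1).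
rewrite modn2 -/(bit v k) -divnMA -expnSr => E3 E1 E2.
rewrite E1 in E2; rewrite expnS in E3 E2 *; lia.
Qed.

Lemma bit_divn v k : v %/ 2 ^ k = v %/ 2 ^ k.+1 * 2 + bit v k.
Proof. by rewrite expnSr divnMA {1}(divn_eq (v %/ 2 ^ k) 2) modn2. Qed.

Lemma nt_scan P v : ascan (nt P v) = cell (bit v P).
Proof. exact: ascan_gtape. Qed.

Definition moveS i d : cmd := Act [:: (i, fun s => (s i, d))].
Definition Inc x : cmd := Act [:: (x, fun=> (Bit true, MoveR))].
Definition Clr x : cmd := moveS x MoveL ;;
  While (fun s => isbit (s x)) (Act [:: (x, fun=> (Blank, MoveL))]).
(** At 0 the left move meets a blank, and stepping back restores 0; the decrement is truncated. *)
Definition Dec x : cmd := moveS x MoveL ;;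
  Act [:: (x, fun s => if isbit (s x) then (Blank, Stay) else (Blank, MoveR))].
Definition IfZ x c : cmd := moveS x MoveL ;;
  If (fun s => isbit (s x)) (moveS x MoveR) (moveS x MoveR ;; c).

Lemma mscan_ok T x : ok_tape x -> mscan T x = ascan (T x).
Proof. by rewrite /mscan => ->. Qed.

Lemma tri_act' al T T' : all (fun p => ok_tape p.1) al ->
  acts_on al (mscan T) T = T' -> tri 0 (Act al) T 1 T'.
Proof. by move=> ok <-; exact: tri_act. Qed.

Lemma tri_Inc x k T : ok_tape x -> T x = ctr k -> tri 0 (Inc x) T 1 (upd T x (ctr k.+1)).
Proof.
move=> ok Tx; apply: tri_act'; first by rewrite /= ok.
by rewrite /acts_on /= Tx ctr_inc.
Qed.

Lemma tri_moveS x d T : ok_tape x ->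
  tri 0 (moveS x d) T 1 (upd T x (aact (ascan (T x), d) (T x))).
Proof.
move=> ok; apply: tri_act'; first by rewrite /= ok.
by rewrite /acts_on /= mscan_ok.
Qed.

Lemma tri_moveR x T e P f : ok_tape x -> T x = gtape e P f ->
  tri 0 (moveS x MoveR) T 1 (upd T x (gtape e P.+1 f)).
Proof.
by move=> ok Tx; have := tri_moveS MoveR T ok; rewrite Tx ascan_gtape gtape_R fset_id.
Qed.

Lemma tri_moveL x T e P f : ok_tape x -> T x = gtape e P.+1 f ->
  tri 0 (moveS x MoveL) T 1 (upd T x (gtape e P f)).
Proof.
by move=> ok Tx; have := tri_moveS MoveL T ok; rewrite Tx ascan_gtape gtape_L fset_id.
Qed.

Lemma tri_moveL0 x T e f : ok_tape x -> T x = gtape e 0 f ->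
  tri 0 (moveS x MoveL) T 1 (upd T x (gend e f)).
Proof.
by move=> ok Tx; have := tri_moveS MoveL T ok; rewrite Tx ascan_gtape gtape_L0 fset_id.
Qed.

Lemma tri_moveE x T e f : ok_tape x -> T x = gend e f ->
  tri 0 (moveS x MoveR) T 1 (upd T x (gtape e 0 f)).
Proof.
by move=> ok Tx; have := tri_moveS MoveR T ok; rewrite Tx (gend_R e).
Qed.

Lemma ctr_L x k T : ok_tape x -> T x = ctr k ->
  tri 0 (moveS x MoveL) T 1 (upd T x (loop_tape k)) \/
  k = 0 /\ tri 0 (moveS x MoveL) T 1 T.
Proof.
case: k => [|k] ok Tx; last by left; exact: tri_moveL.
right; split=> //; have := @tri_moveL0 x T _ _ ok Tx.
by rewrite gend_blank upd_same // Tx ctr0.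
Qed.

Lemma tri_Clr x k T : ok_tape x -> T x = ctr k ->
  tri 0 (Clr x) T (k * 2 + 2) (upd T x (ctr 0)).
Proof.
move=> ok Tx.
have H1 : tri 0 (moveS x MoveL) T 1 (upd T x (loop_tape k)).
  case: (ctr_L ok Tx) => // -[k0]; rewrite upd_same // Tx k0 ctr0 //.
have H2 : tri 0 (While (fun s => isbit (s x)) (Act [:: (x, fun=> (Blank, MoveL))]))
    (upd T x (loop_tape k)) (k * 2).+1 (upd T x blank).
  have := @tri_while 0 (fun s => isbit (s x)) (Act [:: (x, fun=> (Blank, MoveL))])
    k 1 (fun i => upd T x (loop_tape (k - i))).
  rewrite subn0 subnn; apply; last by rewrite mscan_ok // upd_eq.
  move=> i li; rewrite mscan_ok // upd_eq ascan_loop; split; first by lia.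
  apply: tri_act'; first by rewrite /= ok.
  rewrite /acts_on /= upd_upd upd_eq; congr upd.
  have -> : k - i = (k - i.+1).+1 by lia.
  rewrite /loop_tape; case: (k - i.+1) => [|q].
    by rewrite gtape_L0 unaryP gend_blank.
  by rewrite gtape_L unaryP.
rewrite ctr0; apply: tri_wk (tri_seq H1 H2) _ _ => //; lia.
Qed.

Lemma tri_Dec x k T : ok_tape x -> T x = ctr k ->
  tri 0 (Dec x) T 2 (upd T x (ctr k.-1)).
Proof.
move=> ok; case: k => [|k] Tx.
  apply: (tri_seq (t1 := 1) (t2 := 1) (tri_moveL0 ok Tx)).
  apply: tri_act'; first by rewrite /= ok.
  by rewrite /acts_on /= mscan_ok // upd_eq /= upd_upd (gend_R Blank).
apply: (tri_seq (t1 := 1) (t2 := 1) (tri_moveL ok Tx)).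
apply: tri_act'; first by rewrite /= ok.
by rewrite /acts_on /= mscan_ok // upd_eq ascan_gtape /unary ltnSn /= upd_upd gtape_S unaryP.
Qed.

Lemma tri_IfZ0 D x c t T T' : ok_tape x -> T x = ctr 0 ->
  tri D c T t T' -> tri D (IfZ x c) T (t + 3) T'.
Proof.
move=> ok Tx H; rewrite addnC.
apply: (tri_seq (t1 := 1) (t2 := t.+2)).
  by apply: tri_wk (tri_moveL0 ok Tx) _ _.
apply: tri_if; rewrite mscan_ok // upd_eq /=.
apply: (tri_seq (t1 := 1) (t2 := t) _ H).
have := tri_moveE ok (upd_eq T x (gend Blank (unary 0))).
by rewrite upd_upd (upd_same Tx) => /tri_wk; exact.
Qed.

Lemma tri_IfZS x c k T : ok_tape x -> T x = ctr k.+1 -> tri 0 (IfZ x c) T 3 T.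
Proof.
move=> ok Tx; apply: (tri_seq (t1 := 1) (t2 := 2) (tri_moveL ok Tx)).
apply: tri_if; rewrite mscan_ok // upd_eq ascan_gtape /unary ltnSn /=.
have := tri_moveR ok (upd_eq T x (gtape Blank k (unary k.+1))).
by rewrite upd_upd (upd_same Tx).
Qed.

(** * Costs as powers of one bound; addition of binary numbers *)

Section Cost.
Variable Y : nat.
Hypothesis Y16 : 16 <= Y.

Lemma leq_Yexp k k' : k <= k' -> Y ^ k <= Y ^ k'.
Proof. by move=> lk; rewrite leq_exp2l //; lia. Qed.

Lemma leq_Y k c : c <= Y -> 0 < k -> c <= Y ^ k.
Proof. by move=> lc lk; apply: leq_trans (leq_Yexp lk); rewrite expn1. Qed.

Lemma triY_le D D' k k' c T T' : D <= D' -> k <= k' ->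
  tri D c T (Y ^ k) T' -> tri D' c T (Y ^ k') T'.
Proof. by move=> lD lk; apply: tri_le lD _; exact: leq_Yexp. Qed.

(** Costs are rounded up to powers of [Y], so the exponent of a nested program is found by
    computation. The factor [Y] lost at each composition only raises the degree of the polynomial in
    1/eps. *)
Lemma triY_seq D1 D2 k1 k2 c1 c2 T1 T2 T3 :
  tri D1 c1 T1 (Y ^ k1) T2 -> tri D2 c2 T2 (Y ^ k2) T3 ->
  tri (maxn D1 D2) (c1 ;; c2) T1 (Y ^ (maxn k1 k2).+1) T3.
Proof.
move=> H1 H2.
have {}H1 := tri_wk H1 (leq_maxl D1 D2) (leqnn _).
have {}H2 := tri_wk H2 (leq_maxr D1 D2) (leqnn _).
apply: tri_wk (tri_seq H1 H2) _ _ => //.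
have := leq_Yexp (leq_maxl k1 k2); have := leq_Yexp (leq_maxr k1 k2).
rewrite expnS; set y := Y ^ maxn k1 k2; nia.
Qed.

Lemma triY_for D x c n k T (F : nat -> tapes) : ok_tape x -> T x = ctr n -> n <= Y ->
  (forall i, i < n -> tri D c (F i) (Y ^ k) (F i.+1)) -> F 0 = T ->
  tri D.+1 (For x c) T (Y ^ k.+2) (F n).
Proof.
move=> ok Tx ln H F0; apply: tri_wk (tri_for ok Tx H F0) _ _ => //.
have : 0 < Y ^ k by rewrite expn_gt0; lia.
rewrite !expnS; set y := Y ^ k => y0.
apply: (@leq_trans (Y * (y + 6) + 8)); first by rewrite leq_add2r leq_mul2r ln orbT.
nia.
Qed.

Lemma triY_for1 D x c n k T i (g : nat -> atape) : ok_tape x -> T x = ctr n -> n <= Y ->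
  (forall q, q < n -> tri D c (upd T i (g q)) (Y ^ k) (upd T i (g q.+1))) -> T i = g 0 ->
  tri D.+1 (For x c) T (Y ^ k.+2) (upd T i (g n)).
Proof.
by move=> ok Tx ln H g0; apply: (triY_for (F := fun q => upd T i (g q))) => //; rewrite upd_same.
Qed.

Lemma triY_cost D c T t T' k : t <= Y -> 0 < k -> tri D c T t T' -> tri D c T (Y ^ k) T'.
Proof. by move=> lt lk; apply: tri_le => //; exact: leq_Y. Qed.

Lemma triY_act D c T T' k : tri D c T 1 T' -> tri D c T (Y ^ k) T'.
Proof. by apply: tri_le => //; rewrite expn_gt0; lia. Qed.

Lemma triY_Clr x k T : ok_tape x -> T x = ctr k -> k <= Y ->
  tri 0 (Clr x) T (Y ^ 2) (upd T x (ctr 0)).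
Proof.
move=> ok Tx lk; apply: tri_wk (tri_Clr ok Tx) _ _ => //.
by rewrite expnS expn1; nia.
Qed.

Definition rewind i : cmd :=
  While (fun s => ~~ issep (s i)) (moveS i MoveL) ;; moveS i MoveR.

Lemma tri_rewind i T P f : ok_tape i -> T i = gtape Sep P f ->
  (forall q, ~~ issep (f q)) -> tri 0 (rewind i) T (P * 2 + 4) (upd T i (gtape Sep 0 f)).
Proof.
move=> ok Ti nf.
pose g q := if q <= P then gtape Sep (P - q) f else gend Sep f.
have H1 : tri 0 (While (fun s => ~~ issep (s i)) (moveS i MoveL)) T (P.+1 * 2).+1
    (upd T i (gend Sep f)).
  have E0 : upd T i (g 0) = T by rewrite upd_same // Ti /g subn0.
  have := @tri_while 0 (fun s => ~~ issep (s i)) (moveS i MoveL) P.+1 1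
    (fun q => upd T i (g q)).
  have EP : g P.+1 = gend Sep f by rewrite /g ltnn.
  rewrite E0 EP; apply; last by rewrite mscan_ok // upd_eq.
  move=> q; rewrite ltnS => lq; rewrite mscan_ok // upd_eq {1}/g lq ascan_gtape nf; split=> //.
  rewrite /g lq; case: (ltnP q P) => lqP.
    have -> : P - q = (P - q.+1).+1 by lia.
    by have := tri_moveL ok (upd_eq T i (gtape Sep (P - q.+1).+1 f)); rewrite upd_upd.
  have -> : P - q = 0 by lia.
  by have := tri_moveL0 ok (upd_eq T i (gtape Sep 0 f)); rewrite upd_upd.
have := tri_moveE ok (upd_eq T i (gend Sep f)); rewrite upd_upd => H2.
apply: tri_wk (tri_seq H1 H2) _ _ => //; lia.
Qed.

Lemma cells_nosep v q : ~~ issep (cells v q).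
Proof. by rewrite /cells; case: bit. Qed.

Lemma triY_rewind i T P f : ok_tape i -> T i = gtape Sep P f ->
  (forall q, ~~ issep (f q)) -> P <= Y -> tri 0 (rewind i) T (Y ^ 2) (upd T i (gtape Sep 0 f)).
Proof.
move=> ok Ti nf lP; apply: tri_wk (tri_rewind ok Ti nf) _ _ => //.
by rewrite expnS expn1; nia.
Qed.

Definition add_step src dst : acts :=
  [:: (dst, fun s => (cell (isone (s dst) (+) isone (s src) (+) isone (s tCar)), MoveR));
      (src, fun s => (s src, MoveR));
      (tCar, fun s => (cell ((isone (s dst) && isone (s src))
                || (isone (s tCar) && (isone (s dst) || isone (s src)))), Stay))].

(** [dst] is entered with its head at some position [P], so the amount added is [v * 2 ^ P]: a shift
    costs only head moves. *)
Definition add src dst : cmd :=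
  For tLen (Act (add_step src dst)) ;; (rewind src ;; rewind dst).

Definition carry (c : bool) : atape := gtape Blank 0 (unary c).

Lemma carry0 : carry false = blank. Proof. exact: gtape_blank. Qed.

Lemma carry_scan c : ascan (carry c) = cell c.
Proof. by rewrite ascan_gtape; case: c. Qed.

Lemma carry_set c b : aact (cell b, Stay) (carry c) = carry b.
Proof.
rewrite /carry gtape_S; congr gtape; apply/funext => -[|i]; rewrite /fset /unary /=.
  by case: b.
by case: b; case: c.
Qed.

(** Ripple-carry addition of [v * 2 ^ P] to [X] after [k] digits: the number then on the tape and
    the pending carry, which is worth [2 ^ (P + k)]. *)
Fixpoint adder (X v P k : nat) : nat * bool :=
  if k is k'.+1 then
    let: (Z, c) := adder X v P k' in
    let x := bit Z (P + k') in let y := bit v k' in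
    (Z + (x (+) y (+) c) * 2 ^ (P + k') - x * 2 ^ (P + k'), (x && y) || (c && (x || y)))
  else (X, false).

Lemma bit_leq Z q : bit Z q * 2 ^ q <= Z.
Proof.
rewrite {2}(divn_eq Z (2 ^ q)); apply: leq_trans (leq_addr _ _); rewrite leq_mul2r.
by rewrite /bit; case: (Z %/ 2 ^ q) => [|[|n]]; rewrite ?orbT //=; case: (odd _); rewrite ?orbT.
Qed.

Lemma adderP X v P k : (adder X v P k).1 + (adder X v P k).2 * 2 ^ (P + k) =
  X + (v %% 2 ^ k) * 2 ^ P.
Proof.
elim: k => [|k IH] /=; first by rewrite modn1 mul0n !addn0.
move: IH; case: (adder X v P k) => Z c /=; rewrite bit_modn mulnDl => IH.
have := bit_leq Z (P + k); rewrite -mulnA -expnD [k + P]addnC addnS expnS.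
move: IH; case: (bit Z _) => /=; case: (bit v k) => /=; case: c => /=; lia.
Qed.

Lemma adder_full X v P k : v < 2 ^ k -> X + v * 2 ^ P < 2 ^ (P + k) ->
  adder X v P k = (X + v * 2 ^ P, false).
Proof.
move=> lv lX; have := adderP X v P k; rewrite modn_small // => E; rewrite -E in lX *.
by case: (adder X v P k) lX E => Z [] /=; rewrite ?mul0n ?addn0 //; lia.
Qed.

Lemma triY_add src dst X v P n T :
  (src == dst) = false -> (src == tCar) = false -> (dst == tCar) = false ->
  ok_tape src -> ok_tape dst ->
  T tLen = ctr n -> T src = nt 0 v -> T dst = nt P X -> T tCar = blank ->
  v < 2 ^ n -> X + v * 2 ^ P < 2 ^ (P + n) -> P + n <= Y ->
  tri 1 (add src dst) T (Y ^ 4) (upd T dst (nt 0 (X + v * 2 ^ P))).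
Proof.
move=> nsd nsc ndc oks okd Tn Ts Td Tc lv lX lY.
have nds : (dst == src) = false by rewrite eq_sym.
have ncs : (tCar == src) = false by rewrite eq_sym.
have ncd : (tCar == dst) = false by rewrite eq_sym.
pose F k := upd (upd (upd T tCar (carry (adder X v P k).2)) src (nt k v)) dst
              (nt (P + k) (adder X v P k).1).
have F0 : F 0 = T.
  rewrite /F /= carry0 addn0; apply/funext => i; rewrite /upd.
  case: eqP => [->|_]; first by rewrite Td.
  case: eqP => [->|_]; first by rewrite Ts.
  by case: eqP => [->|_].
have H1 : tri 1 (For tLen (Act (add_step src dst))) T (Y ^ 2) (F n).
  apply: triY_for => //; first by lia.
  move=> k lk; apply: triY_act; apply: tri_act'; first by rewrite /= oks okd.
  rewrite /acts_on /= !mscan_ok //.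
  have -> : F k dst = nt (P + k) (adder X v P k).1 by rewrite /F upd_eq.
  have -> : F k src = nt k v by rewrite /F upd_ne // upd_eq.
  have -> : F k tCar = carry (adder X v P k).2 by rewrite /F upd_ne // upd_ne // upd_eq.
  rewrite carry_scan !nt_scan !isone_cell carry_set /F /=.
  case E : (adder X v P k) => [Z c] /=.
  rewrite /nt gtape_R fset_id gtape_R (@fset_cells _
     (Z + (bit Z (P + k) (+) bit v k (+) c) * 2 ^ (P + k) - bit Z (P + k) * 2 ^ (P + k))).
    rewrite addnS; apply/funext => i; rewrite /upd.
    case: eqP => [_|_] //; case: eqP => [_|_] //; by case: eqP.
  have := bit_leq Z (P + k); lia.
have F_n : F n = upd (upd T src (nt n v)) dst (nt (P + n) (X + v * 2 ^ P)).
  rewrite /F adder_full // carry0; apply/funext => i; rewrite /upd.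
  case: eqP => [_|_] //; case: eqP => [_|_] //; by case: eqP => [->|_].
rewrite F_n in H1.
have H2 : tri 0 (rewind src) (upd (upd T src (nt n v)) dst (nt (P + n) (X + v * 2 ^ P)))
    (Y ^ 2) (upd T dst (nt (P + n) (X + v * 2 ^ P))).
  have := @triY_rewind src (upd (upd T src (nt n v)) dst (nt (P + n) (X + v * 2 ^ P))) n (cells v) oks.
  rewrite upd_ne // upd_eq => /(_ erefl (@cells_nosep _) _).
  have -> : upd (upd (upd T src (nt n v)) dst (nt (P + n) (X + v * 2 ^ P))) src (gtape Sep 0 (cells v))
     = upd T dst (nt (P + n) (X + v * 2 ^ P)).
    apply/funext => i; rewrite /upd; case: eqP => [->|_]; first by rewrite nsd Ts.
    by [].
  apply; lia.
have H3 := @triY_rewind dst _ _ _ okd (upd_eq T dst (nt (P + n) (X + v * 2 ^ P))) (@cells_nosep _) lY.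
rewrite upd_upd in H3.
exact: (triY_le _ _ (triY_seq H1 (triY_seq H2 H3))).
Qed.

Definition clear i : cmd := For tLen (Act [:: (i, fun=> (Blank, MoveR))]) ;; rewind i.

Lemma triY_clear i v n T : ok_tape i -> T tLen = ctr n -> T i = nt 0 v -> v < 2 ^ n -> n <= Y ->
  tri 1 (clear i) T (Y ^ 3) (upd T i (nt 0 0)).
Proof.
move=> ok Tn Ti lv ln.
have H1 : tri 1 (For tLen (Act [:: (i, fun=> (Blank, MoveR))])) T (Y ^ 2) (upd T i (nt n 0)).
  have := @triY_for1 0 tLen (Act [:: (i, fun=> (Blank, MoveR))]) n 0 T i
    (fun k => nt k (v %/ 2 ^ k * 2 ^ k)) isT Tn ln.
  rewrite [v %/ 2 ^ n]divn_small // mul0n; apply; last by rewrite divn1 muln1.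
  move=> k lk; apply: triY_act; apply: tri_act'; first by rewrite /= ok.
  rewrite /acts_on /= upd_upd upd_eq /nt gtape_R -[Blank]/(cell false).
  rewrite (@fset_cells _ (v %/ 2 ^ k.+1 * 2 ^ k.+1)) //.
  rewrite mul0n addn0 {1}bit_divn mulnDl -mulnA -expnS; congr (_ + _ * _).
  by rewrite /bit mulnK ?expn_gt0.
have := triY_rewind ok (upd_eq T i (nt n 0)) (@cells_nosep _) ln; rewrite upd_upd => H2.
exact: (triY_le _ _ (triY_seq H1 H2)).
Qed.

(** Head positions cannot be negative. Every signed displacement is applied to an offset chosen
    large enough that the subtraction is not truncated. *)
Definition sadd (b : bool) (P a : nat) := if b then P - a else P + a.

Definition sgn_tape (b : bool) : atape := gtape Blank 0 (fset (unary 0) 0 (Bit b)).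

Lemma sgn_scan b : ascan (sgn_tape b) = Bit b.
Proof. exact: ascan_gtape. Qed.

Definition signed_move sg neg i : cmd :=
  Act [:: (i, fun s => (s i, if isone (s sg) (+) neg then MoveL else MoveR))].

Lemma tri_signed_move sg neg i b P v T : ok_tape sg -> ok_tape i -> (sg == i) = false ->
  T sg = sgn_tape b -> (b (+) neg -> 0 < P) ->
  tri 0 (signed_move sg neg i) (upd T i (nt P v)) 1 (upd T i (nt (sadd (b (+) neg) P 1) v)).
Proof.
move=> oks oki nsi Ts lP; apply: tri_act'; first by rewrite /= oki.
rewrite /acts_on /= !mscan_ok // upd_upd upd_eq upd_ne // Ts sgn_scan nt_scan.
have -> : isone (Bit b) = b by case: b {Ts lP}.
congr upd; rewrite /sadd /nt; case: (b (+) neg) lP => [/(_ isT)|_]; last first.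
  by rewrite gtape_R fset_id addn1.
by case: P => // P _; rewrite gtape_L fset_id subn1.
Qed.

Lemma triY_smove D x c k n i (b : bool) a P v T : ok_tape x -> (x == i) = false -> T x = ctr n -> n <= Y ->
  (forall P, (b -> a <= P) ->
     tri D c (upd T i (nt P v)) (Y ^ k) (upd T i (nt (sadd b P a) v))) ->
  (b -> n * a <= P) ->
  tri D.+1 (For x c) (upd T i (nt P v)) (Y ^ k.+2) (upd T i (nt (sadd b P (n * a)) v)).
Proof.
move=> ok nxi Tx ln H lP.
have := @triY_for D x c n k (upd T i (nt P v)) (fun q => upd T i (nt (sadd b P (q * a)) v)).
apply => //; first by rewrite upd_ne.
  move=> q lq; have := H (sadd b P (q * a)).
  have -> : sadd b (sadd b P (q * a)) a = sadd b P (q.+1 * a) by rewrite /sadd mulSn; case: (b); lia.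
  apply=> Hb; rewrite /sadd Hb; have := lP Hb; nia.
by rewrite mul0n /sadd addn0 subn0; case: (b).
Qed.

Lemma triY_moveR i x n P f e T : ok_tape i -> ok_tape x -> (x == i) = false ->
  T x = ctr n -> n <= Y -> T i = gtape e P f ->
  tri 1 (For x (moveS i MoveR)) T (Y ^ 2) (upd T i (gtape e (P + n) f)).
Proof.
move=> oki okx nxi Tx ln Ti.
apply: (@triY_for1 0 _ _ _ _ _ _ (fun q => gtape e (P + q) f)) => //; last by rewrite addn0.
move=> q lq; apply: triY_act; rewrite addnS.
by have := tri_moveR oki (upd_eq T i (gtape e (P + q) f)); rewrite upd_upd.
Qed.

Lemma triY_Incs x y n k T : ok_tape x -> ok_tape y -> (y == x) = false ->
  T x = ctr k -> T y = ctr n -> n <= Y -> tri 1 (For y (Inc x)) T (Y ^ 2) (upd T x (ctr (k + n))).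
Proof.
move=> okx oky nyx Tx Ty ln.
apply: (@triY_for1 0 _ _ _ _ _ _ (fun q => ctr (k + q))) => //; last by rewrite addn0.
move=> q lq; apply: triY_act; rewrite addnS.
by have := tri_Inc okx (upd_eq T x (ctr (k + q))); rewrite upd_upd.
Qed.

End Cost.

(** * The factor contributed by one coordinate *)

Definition decay_fun (N w : nat) := w - w %/ N.
Definition weight (N W0 j : nat) := iter (j * j) (decay_fun N) W0.

(** This is [off + m^2 (lambda y^2 + mu y)] at the grid point [y = j/m] or [y = -j/m], where [l],
    [u] are the absolute values of the two coefficients and [sl], [sm] their signs. The factor [m^2]
    clears denominators; [neg], the sign of [y], only reaches the linear term. *)
Definition shift_pos (off m : nat) (sl sm : bool) (l u : nat) (neg : bool) (j : nat) :=
  sadd (sm (+) neg) (sadd sl off (j * (j * l))) (m * (j * u)).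

(** The index [j = 0] counts twice: the grid cells on both sides of the origin are represented by
    0. *)
Definition coord_sum (off m J N W0 : nat) (sl sm : bool) (l u : nat) :=
  \sum_(j < J) weight N W0 j *
    (2 ^ shift_pos off m sl sm l u false j + 2 ^ shift_pos off m sl sm l u true j).

Ltac upds := let i := fresh "i" in apply/funext => i; rewrite /upd;
  repeat match goal with |- context [i == ?k] =>
    case: (eqVneq i k) => [?|_]; [subst i; rewrite //=|rewrite //=] end.

Section Coord.
Variables Y m J N W0 L off S n p : nat.
Hypothesis Y16 : 16 <= Y.

Definition par (T : tapes) : Prop :=
  (T tM = ctr m /\ T tJ = ctr J /\ T tN = ctr N /\ T tW0 = ctr W0 /\ T tL = ctr L) /\
  (T tOff = ctr off /\ T tS = ctr S /\ T tLen = ctr n /\ T tP = ctr p).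

Definition par_le : bool :=
  [&& m <= Y, J <= Y, N <= Y, W0 <= Y, L <= Y, off + off + n <= Y, S <= Y & p <= Y].
Hypothesis leY : par_le.

Lemma par_leE : (m <= Y /\ J <= Y /\ N <= Y /\ W0 <= Y) /\ (L <= Y /\ off + off + n <= Y /\ S <= Y /\ p <= Y).
Proof. by case/and5P: leY => ? ? ? ? /and4P[]. Qed.

Definition smove3 x y z sg neg : cmd := For x (For y (For z (signed_move sg neg tNew))).

Lemma triY_smove3 x y z sg neg a b c s P v T :
  ok_tape x -> ok_tape y -> ok_tape z -> ok_tape sg ->
  (x == tNew) = false -> (y == tNew) = false -> (z == tNew) = false -> (sg == tNew) = false ->
  T x = ctr a -> T y = ctr b -> T z = ctr c -> T sg = sgn_tape s ->
  a <= Y -> b <= Y -> c <= Y -> (s (+) neg -> a * (b * c) <= P) ->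
  T tNew = nt P v ->
  tri 3 (smove3 x y z sg neg) T (Y ^ 6) (upd T tNew (nt (sadd (s (+) neg) P (a * (b * c))) v)).
Proof.
move=> okx oky okz oks nx ny nz ns Tx Ty Tz Ts la lb lc lP TN.
rewrite -{1}(upd_same TN).
apply: triY_smove => // P1 lP1; apply: triY_smove => // P2 lP2.
rewrite -[c in sadd _ _ c]muln1; apply: triY_smove => //; last by rewrite muln1.
by move=> P3 lP3; apply: triY_act => //; apply: tri_signed_move.
Qed.

Definition place neg : cmd :=
  For tOff (moveS tNew MoveR) ;; (smove3 tj tj tLam tSl false ;; smove3 tM tj tMu tSm neg).

Lemma triY_place neg j l u sl sm X T : par T ->
  T tj = ctr j -> T tLam = ctr l -> T tMu = ctr u -> T tSl = sgn_tape sl -> T tSm = sgn_tape sm ->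
  T tNew = nt 0 X -> j <= Y -> l <= Y -> u <= Y -> j * (j * l) + m * (j * u) <= off ->
  tri 3 (place neg) T (Y ^ 8) (upd T tNew (nt (shift_pos off m sl sm l u neg j) X)).
Proof.
move=> [[TM _] [TO _]] Tj Tl Tu Tsl Tsm TN lj ll lu lo.
have [[lm _] [_ [lof _]]] := par_leE.
have H1 : tri 1 (For tOff (moveS tNew MoveR)) T (Y ^ 2) (upd T tNew (nt off X)).
  by have := @triY_moveR Y Y16 tNew tOff off 0 (cells X) Sep T; apply => //; lia.
have H2 := @triY_smove3 tj tj tLam tSl false j j l sl off X (upd T tNew (nt off X)) isT isT isT isT
  erefl erefl erefl erefl Tj Tj Tl Tsl lj lj ll _ erefl.
have {}H2 := H2 (fun _ => leq_trans (leq_addr _ _) lo); rewrite upd_upd addbF in H2.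
set P := sadd sl off (j * (j * l)) in H2.
have H3 := @triY_smove3 tM tj tMu tSm neg m j u sm P X (upd T tNew (nt P X)) isT isT isT isT
  erefl erefl erefl erefl TM Tj Tu Tsm lm lj lu _ erefl.
have {}H3 : tri 3 (smove3 tM tj tMu tSm neg) (upd T tNew (nt P X)) (Y ^ 6)
    (upd T tNew (nt (shift_pos off m sl sm l u neg j) X)).
  rewrite upd_upd in H3; apply: H3 => _; rewrite /P /sadd; case: (sl); lia.
exact: (triY_le _ _ _ (triY_seq Y16 H1 (triY_seq Y16 H2 H3))).
Qed.

(** Multiplication by the weight is repeated addition; the weights are polynomial in 1/eps and kept
    in unary. *)
Definition contrib neg : cmd := For tw (place neg ;; add tAcc tNew).

Lemma triY_contrib neg j l u sl sm X v w T : par T ->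
  T tj = ctr j -> T tLam = ctr l -> T tMu = ctr u -> T tSl = sgn_tape sl -> T tSm = sgn_tape sm ->
  T tw = ctr w -> T tAcc = nt 0 v -> T tCar = blank ->
  T tNew = nt 0 X -> j <= Y -> l <= Y -> u <= Y -> w <= Y -> j * (j * l) + m * (j * u) <= off ->
  v < 2 ^ n -> X + w * (v * 2 ^ shift_pos off m sl sm l u neg j) < 2 ^ n ->
  tri 4 (contrib neg) T (Y ^ 11)
    (upd T tNew (nt 0 (X + w * (v * 2 ^ shift_pos off m sl sm l u neg j)))).
Proof.
move=> pT Tj Tl Tu Tsl Tsm Tw TA TC TN lj ll lu lw lo lv lX.
set e := shift_pos _ _ _ _ _ _ _ _ in lX *.
have le : e <= off + off.
  by rewrite /e /shift_pos /sadd; case: (_ (+) _); case: (sl); lia.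
have [[lm _] [_ [lof _]]] := par_leE.
apply: (@triY_for1 _ Y16 _ _ _ _ _ _ _ (fun q => nt 0 (X + q * (v * 2 ^ e)))) => //; last first.
  by rewrite mul0n addn0.
move=> q lq; set X' := X + q * _.
have lX' : X' + v * 2 ^ e < 2 ^ n.
  by apply: leq_ltn_trans lX; rewrite /X' -addnA leq_add2l -mulSnr leq_mul2r lq orbT.
have H1 := @triY_place neg j l u sl sm X' (upd T tNew (nt 0 X')) pT Tj Tl Tu Tsl Tsm erefl lj ll lu lo.
rewrite upd_upd -/e in H1.
have H2 := @triY_add Y Y16 tAcc tNew X' v e n (upd T tNew (nt e X')) erefl erefl erefl isT isT.
have {}H2 : tri 1 (add tAcc tNew) (upd T tNew (nt e X')) (Y ^ 4) (upd T tNew (nt 0 (X' + v * 2 ^ e))).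
  rewrite upd_upd in H2; apply: H2 => //; first by case: pT => _ [_ [_ []]].
    by apply: leq_trans lX' _; rewrite leq_exp2l // leq_addl.
  by lia.
have -> : X + q.+1 * (v * 2 ^ e) = X' + v * 2 ^ e by rewrite /X' mulSnr addnA.
exact: (triY_le _ _ _ (triY_seq Y16 H1 H2)).
Qed.

(** [tr] is counted down from [N] once per unit of [w], so it reaches zero [w %/ N] times, and each
    time one unit is taken from [tw]. That [tw] shrinks during the loop is harmless, its count
    having been copied. *)
Definition decay : cmd :=
  For tN (Inc tr) ;; (For tw (Dec tr ;; IfZ tr (Dec tw ;; For tN (Inc tr))) ;; Clr tr).

Lemma triY_decay w T : par T -> T tw = ctr w -> T tr = ctr 0 -> 0 < N -> w <= Y ->
  tri 2 decay T (Y ^ 9) (upd T tw (ctr (decay_fun N w))).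
Proof.
move=> pT Tw Tr N0 lw; have [[_ [_ [lN _]]] _] := par_leE.
have TN : T tN = ctr N by case: pT => -[_ [_ []]].
have H1 := triY_Incs Y16 (isT : ok_tape tr) (isT : ok_tape tN) erefl Tr TN lN.
rewrite add0n in H1.
pose F i := upd (upd T tw (ctr (w - i %/ N))) tr (ctr (N - i %% N)).
have F0 : F 0 = upd T tr (ctr N).
  by rewrite /F div0n mod0n !subn0; congr upd; rewrite upd_same.
have H2 : tri 2 (For tw (Dec tr ;; IfZ tr (Dec tw ;; For tN (Inc tr)))) (upd T tr (ctr N)) (Y ^ 7) (F w).
  apply: (triY_for Y16) => // i li.
  have D1 := @tri_Dec tr (N - i %% N) (F i) isT erefl.
  have iN : i %% N < N by rewrite ltn_mod.
  have [E|E] := eqVneq (i %% N).+1 N.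
    have ES : i.+1 = (i %/ N).+1 * N by rewrite {1}(divn_eq i N) -addnS E mulSnr.
    set T1 := upd (F i) tr _ in D1.
    have T10 : T1 tr = ctr 0 by rewrite /T1 upd_eq; congr ctr; lia.
    have D2 := @tri_Dec tw (w - i %/ N) T1 isT erefl.
    set T2 := upd T1 tw _ in D2.
    have D3 := triY_Incs Y16 (isT : ok_tape tr) (isT : ok_tape tN) erefl (T10 : T2 tr = _) (TN : T2 tN = _) lN.
    have -> : F i.+1 = upd T2 tr (ctr (0 + N)).
      rewrite /F ES mulnK // modnMl subn0 add0n /T2 /T1 /F.
      apply/funext => k; rewrite /upd; case: eqP => // _; case: eqP => // _.
      by congr ctr; lia.
    have lY2 : 2 <= Y by lia.
    have D4 := tri_IfZ0 (isT : ok_tape tr) T10 (triY_seq Y16 (triY_cost Y16 lY2 (isT : 0 < 1) D2) D3).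
    apply: tri_wk (tri_seq (tri_wk D1 (leq0n 1) (leqnn _)) D4) _ _ => //.
    have := leq_Yexp Y16 (isT : 3 <= 4); have := leq_Yexp Y16 (isT : 1 <= 4).
    rewrite /maxn /= [in X in _ <= X]expnS expn1; set y := Y ^ 4; nia.
  have -> : F i.+1 = upd (F i) tr (ctr (N - i %% N).-1).
    have ES : i.+1 = i %/ N * N + (i %% N).+1 by rewrite {1}(divn_eq i N) addnS.
    have lt : (i %% N).+1 < N by rewrite ltn_neqAle E.
    have Ed : i.+1 %/ N = i %/ N by rewrite ES divnMDl // (divn_small lt) addn0.
    have Em : i.+1 %% N = (i %% N).+1 by rewrite ES modnMDl (modn_small lt).
    by rewrite /F Ed Em upd_upd; congr upd; congr ctr; lia.
  have D2 := @tri_IfZS tr (Dec tw ;; For tN (Inc tr)) (N - i %% N).-2 (upd (F i) tr (ctr (N - i %% N).-1)) isT.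
  apply: tri_wk (tri_seq D1 (D2 _)) _ _ => //.
    rewrite upd_eq; congr ctr; have : (i %% N).+1 < N by rewrite ltn_neqAle E.
    by lia.
  by apply: leq_trans (_ : Y ^ 1 <= _); [rewrite expn1; lia|exact: leq_Yexp].
have H3 := @tri_Clr tr (N - w %% N) (F w) isT erefl.
have E3 : upd (F w) tr (ctr 0) = upd T tw (ctr (decay_fun N w)).
  rewrite /F upd_upd; apply/funext => k; rewrite /upd; case: eqP => // ->.
  by [].
rewrite E3 in H3.
have {}H3 : tri 0 (Clr tr) (F w) (Y ^ 2) (upd T tw (ctr (decay_fun N w))).
  apply: tri_wk H3 _ _ => //; rewrite expnS expn1; have : N - w %% N <= Y by lia.
  nia.
exact: (triY_le _ _ _ (triY_seq Y16 H1 (triY_seq Y16 H2 H3))).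
Qed.

(** Since [(j + 1)^2 = j^2 + (2 j + 1)], another [2 j + 1] decays turn the weight of [j] into that
    of [j + 1]. *)
Definition coord_step : cmd :=
  contrib false ;; (contrib true ;; (For tj (decay ;; decay) ;; (decay ;; Inc tj))).

(** One offset per coordinate is added to [tThr], which thus follows the position of the value 0 of
    the quadratic. *)
Definition coord : cmd :=
  For tW0 (Inc tw) ;; (For tJ coord_step ;; (Clr tj ;; (Clr tw ;; (Clr tLam ;; (Clr tMu ;;
  (clear tAcc ;; (add tNew tAcc ;; (clear tNew ;; For tOff (Inc tThr))))))))).

Lemma weight_le w0 k : iter k (decay_fun N) w0 <= w0.
Proof. by elim: k => // k IH; rewrite iterS; apply: leq_trans IH; exact: leq_subr. Qed.

Lemma triY_coord_step j l u sl sm X v w T : par T ->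
  T tj = ctr j -> T tLam = ctr l -> T tMu = ctr u -> T tSl = sgn_tape sl -> T tSm = sgn_tape sm ->
  T tw = ctr w -> T tAcc = nt 0 v -> T tCar = blank -> T tr = ctr 0 -> 0 < N ->
  T tNew = nt 0 X -> j <= Y -> l <= Y -> u <= Y -> w <= Y -> j * (j * l) + m * (j * u) <= off ->
  v < 2 ^ n ->
  X + w * (v * 2 ^ shift_pos off m sl sm l u false j)
    + w * (v * 2 ^ shift_pos off m sl sm l u true j) < 2 ^ n ->
  tri 4 coord_step T (Y ^ 15)
    (upd (upd (upd T tj (ctr j.+1)) tw (ctr (iter (j + j).+1 (decay_fun N) w))) tNew
     (nt 0 (X + w * (v * 2 ^ shift_pos off m sl sm l u false j)
              + w * (v * 2 ^ shift_pos off m sl sm l u true j)))).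
Proof.
move=> pT Tj Tl Tu Tsl Tsm Tw TA TC Tr N0 TN lj ll lu lw lo lv lX.
have H1 := triY_contrib pT Tj Tl Tu Tsl Tsm Tw TA TC TN lj ll lu lw lo lv
  (leq_ltn_trans (leq_addr _ _) lX).
set X1 := X + _ in H1 lX *; set T1 := upd T tNew _ in H1.
have H2 := @triY_contrib true j l u sl sm X1 v w T1 pT Tj Tl Tu Tsl Tsm Tw TA TC erefl lj ll lu lw lo lv lX.
set X2 := X1 + _ in H2 lX *; rewrite upd_upd in H2; set T2 := upd T tNew _ in H2.
pose f := decay_fun N.
have H3 : tri 3 (For tj (decay ;; decay)) T2 (Y ^ 12) (upd T2 tw (ctr (iter (j + j) f w))).
  rewrite addnn; apply: (@triY_for1 _ Y16 _ _ _ _ _ _ _ (fun q => ctr (iter q.*2 f w))) => //.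
  move=> q lq; have lq' : iter q.*2 f w <= Y by apply: leq_trans (weight_le _ _) lw.
  have D1 := @triY_decay (iter q.*2 f w) (upd T2 tw (ctr (iter q.*2 f w))) pT erefl Tr N0 lq'.
  rewrite upd_upd in D1.
  have lq1 : decay_fun N (iter q.*2 f w) <= Y by apply: leq_trans (leq_subr _ _) lq'.
  have D2 := @triY_decay _ (upd T2 tw (ctr (decay_fun N (iter q.*2 f w)))) pT erefl Tr N0 lq1.
  rewrite upd_upd in D2.
  exact: (triY_le _ _ _ (triY_seq Y16 D1 D2)).
have lw' : iter (j + j) f w <= Y by apply: leq_trans (weight_le _ _) lw.
have H4 := @triY_decay _ (upd T2 tw (ctr (iter (j + j) f w))) pT erefl Tr N0 lw'.
rewrite upd_upd -[decay_fun N _]/(iter (j + j).+1 f w) in H4.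
have H5 := @tri_Inc tj j (upd T2 tw (ctr (iter (j + j).+1 f w))) isT Tj.
have E5 : upd (upd T2 tw (ctr (iter (j + j).+1 f w))) tj (ctr j.+1) =
  upd (upd (upd T tj (ctr j.+1)) tw (ctr (iter (j + j).+1 f w))) tNew (nt 0 X2).
  by rewrite /T2; upds.
rewrite E5 in H5.
exact: (triY_le _ _ _ (triY_seq Y16 H1 (triY_seq Y16 H2 (triY_seq Y16 H3 (triY_seq Y16 H4 (triY_act Y16 0 H5)))))).
Qed.

Lemma triY_coord l u sl sm v thr T : par T ->
  T tj = ctr 0 -> T tLam = ctr l -> T tMu = ctr u -> T tSl = sgn_tape sl -> T tSm = sgn_tape sm ->
  T tw = ctr 0 -> T tAcc = nt 0 v -> T tCar = blank -> T tr = ctr 0 -> 0 < N ->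
  T tNew = nt 0 0 -> T tThr = ctr thr -> l <= Y -> u <= Y ->
  (forall j, j < J -> j * (j * l) + m * (j * u) <= off) ->
  v < 2 ^ n -> v * coord_sum off m J N W0 sl sm l u < 2 ^ n ->
  tri 5 coord T (Y ^ 26)
    (upd (upd (upd (upd T tLam (ctr 0)) tMu (ctr 0)) tAcc
      (nt 0 (v * coord_sum off m J N W0 sl sm l u))) tThr (ctr (thr + off))).
Proof.
move=> pT Tj Tl Tu Tsl Tsm Tw TA TC Tr N0 TN Tt ll lu lo lv lV.
have [[_ [lJ [lN lW]]] [_ [lof _]]] := par_leE.
have [[_ [TJ [TNN [TW TL]]]] [TO [TS [Tn TP]]]] := pT.
have H1 := triY_Incs Y16 (isT : ok_tape tw) (isT : ok_tape tW0) erefl Tw TW lW.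
rewrite add0n in H1.
pose e neg j := shift_pos off m sl sm l u neg j.
(* [X k] is the new accumulator after the grid indices below [k]. It grows with [k] and ends at the
   full product, whose bound therefore excludes overflow at every intermediate addition. *)
pose X k := \sum_(j < k) weight N W0 j * (v * 2 ^ e false j + v * 2 ^ e true j).
have XJ : X J = v * coord_sum off m J N W0 sl sm l u.
  by rewrite /X /coord_sum big_distrr; apply: eq_bigr => j _ /=; rewrite -mulnDr mulnCA.
pose F k := upd (upd (upd T tj (ctr k)) tw (ctr (weight N W0 k))) tNew (nt 0 (X k)).
have F0 : F 0 = upd T tw (ctr W0).
  by rewrite /F /X big_ord0 /weight -TN upd_same // -Tj [upd T tj _]upd_same.
have XS k : X k.+1 = X k + weight N W0 k * (v * 2 ^ e false k) + weight N W0 k * (v * 2 ^ e true k).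
  by rewrite /X big_ord_recr /= mulnDr addnA.
have leX k : k <= J -> X k <= X J.
  move=> lk; rewrite -(subnK lk); elim: (J - k) => // d IH.
  by rewrite addSn XS; apply: leq_trans IH _; rewrite -addnA leq_addr.
have H2 : tri 5 (For tJ coord_step) (upd T tw (ctr W0)) (Y ^ 17) (F J).
  apply: (triY_for Y16) => // k lk.
  have wk : weight N W0 k <= Y by apply: leq_trans (weight_le _ _) lW.
  have lX : X k + weight N W0 k * (v * 2 ^ e false k) + weight N W0 k * (v * 2 ^ e true k) < 2 ^ n.
    by rewrite -XS; apply: leq_ltn_trans (leX _ lk) _; rewrite XJ.
  have := @triY_coord_step k l u sl sm (X k) v (weight N W0 k) (F k) pT erefl Tl Tu Tsl Tsm erefl TA TC Tr N0
    erefl (leq_trans (ltnW lk) lJ) ll lu wk (lo _ lk) lv lX.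
  rewrite -XS; congr tri.
  have -> : iter (k + k).+1 (decay_fun N) (weight N W0 k) = weight N W0 k.+1.
    by rewrite /weight -iterD (_ : _ + k * k = k.+1 * k.+1) //; lia.
  by rewrite /F; upds.
have wJ : weight N W0 J <= Y by apply: leq_trans (weight_le _ _) lW.
set T3 := F J in H2.
have H3 := @triY_Clr Y Y16 tj J T3 isT erefl lJ; set T4 := upd T3 _ _ in H3.
have H4 := @triY_Clr Y Y16 tw _ T4 isT erefl wJ; set T5 := upd T4 _ _ in H4.
have H5 := @triY_Clr Y Y16 tLam l T5 isT Tl ll; set T6 := upd T5 _ _ in H5.
have H6 := @triY_Clr Y Y16 tMu u T6 isT Tu lu; set T7 := upd T6 _ _ in H6.
have nY : n <= Y by lia.
have H7 := @triY_clear Y Y16 tAcc v n T7 isT Tn TA lv nY; set T8 := upd T7 _ _ in H7.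
rewrite -XJ in lV *.
have H8 := @triY_add Y Y16 tNew tAcc 0 (X J) 0 n T8 erefl erefl erefl isT isT Tn erefl erefl TC lV.
rewrite !add0n muln1 in H8; have {}H8 := H8 lV nY; set T9 := upd T8 _ _ in H8.
have H9 := @triY_clear Y Y16 tNew (X J) n T9 isT Tn erefl lV nY; set T10 := upd T9 _ _ in H9.
have lof' : off <= Y by lia.
have H10 := triY_Incs Y16 (isT : ok_tape tThr) (isT : ok_tape tOff) erefl (Tt : T10 tThr = _) (TO : T10 tOff = _) lof'.
set T11 := upd T10 _ _ in H10.
have E11 : T11 = upd (upd (upd (upd T tLam (ctr 0)) tMu (ctr 0)) tAcc (nt 0 (X J))) tThr (ctr (thr + off)).
  rewrite /T11 /T10 /T9 /T8 /T7 /T6 /T5 /T4 /T3 /F; upds.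
rewrite -E11.
exact: (triY_le _ _ _ (triY_seq Y16 H1 (triY_seq Y16 H2 (triY_seq Y16 H3 (triY_seq Y16 H4 (triY_seq Y16 H5
  (triY_seq Y16 H6 (triY_seq Y16 H7 (triY_seq Y16 H8 (triY_seq Y16 H9 H10)))))))))).
Qed.
End Coord.

(** * The constant term and the output *)

Definition emits (V E k : nat) : seq bool := [seq bit V (E - i.+1) | i <- iota 0 k].

Lemma emitsS V E k : emits V E k.+1 = rcons (emits V E k) (bit V (E - k.+1)).
Proof. by rewrite /emits -{1}[k.+1]addn1 iotaD map_cat cats1. Qed.

Lemma bits_val_rcons s (b : bool) : bits_val (rcons s b) = (bits_val s).*2 + b.
Proof. by rewrite /bits_val foldl_rcons. Qed.

Lemma bits_val_emits V E k : k <= E -> bits_val (emits V E k) = (V %/ 2 ^ (E - k)) %% 2 ^ k.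
Proof.
elim: k => [|k IH] lk; first by rewrite modn1.
rewrite emitsS bits_val_rcons IH ?(ltnW lk) //.
have -> : E - k = (E - k.+1).+1 by lia.
rewrite [V %/ 2 ^ (E - k.+1)]bit_divn; set a := V %/ _; set b := bit V _.
have -> : (a * 2 + b) %% 2 ^ k.+1 = a %% 2 ^ k * 2 + b; last by rewrite -muln2.
have la : a %% 2 ^ k * 2 + b < 2 ^ k.+1.
  have : a %% 2 ^ k < 2 ^ k by rewrite ltn_mod expn_gt0.
  rewrite expnS; case: b => /=; lia.
by rewrite -[RHS](modn_small la) {1}(divn_eq a (2 ^ k)) mulnDl -addnA -mulnA -expnSr modnMDl.
Qed.

Lemma fset_nth (l : seq sym) s : fset (nth Blank l) (size l) s = nth Blank (rcons l s).
Proof.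
apply/funext => i; rewrite /fset nth_rcons; case: eqP => [->|ne]; first by rewrite ltnn.
by case: ltnP => // lt; rewrite nth_default.
Qed.

Section Readout.
Variables Y m J N W0 L off S n p : nat.
Hypothesis Y16 : 16 <= Y.
Hypothesis leY : par_le Y m J N W0 L off S n p.
Local Notation par := (par m J N W0 L off S n p).

(** The constant term is a pure shift, so one addition of the accumulator into the empty [tNew]
    suffices. *)
Definition tau_step : cmd :=
  For tOff (moveS tNew MoveR) ;; (smove3 tM tM tLam tSl false ;;
  (add tAcc tNew ;; For tOff (Inc tThr))).

Lemma triY_tau l sl v thr T : par T -> T tLam = ctr l -> T tSl = sgn_tape sl ->
  T tAcc = nt 0 v -> T tCar = blank -> T tNew = nt 0 0 -> T tThr = ctr thr ->
  l <= Y -> m * (m * l) <= off -> v < 2 ^ n -> v * 2 ^ sadd sl off (m * (m * l)) < 2 ^ n ->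
  tri 3 tau_step T (Y ^ 9) (upd (upd T tNew (nt 0 (v * 2 ^ sadd sl off (m * (m * l))))) tThr (ctr (thr + off))).
Proof.
move=> pT Tl Ts TA TC TN Tt ll lo lv lV.
have [[lm _] [_ [lof _]]] := par_leE leY.
have [[TM _] [TO [_ [Tn _]]]] := pT.
have lof' : off <= Y by lia.
have H1 := @triY_moveR Y Y16 tNew tOff off 0 (cells 0) Sep T isT isT erefl TO lof' TN.
rewrite add0n in H1; set T1 := upd T _ _ in H1.
have H2 := @triY_smove3 Y Y16 tM tM tLam tSl false m m l sl off 0 T1 isT isT isT isT
  erefl erefl erefl erefl TM TM Tl Ts lm lm ll (fun _ => lo) erefl.
rewrite addbF in H2; set P := sadd _ _ _ in H2 lV *; set T2 := upd T1 _ _ in H2.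
have lP : P + n <= Y by rewrite /P /sadd; case: (sl); lia.
have H3 := @triY_add Y Y16 tAcc tNew 0 v P n T2 erefl erefl erefl isT isT Tn TA erefl TC lv _ lP.
have {}H3 := H3 (leq_trans lV _); rewrite add0n in H3.
have {}H3 := H3 (leq_pexp2l (isT : 0 < 2) (leq_addl P n)).
set T3 := upd T2 _ _ in H3.
have H4 := triY_Incs Y16 (isT : ok_tape tThr) (isT : ok_tape tOff) erefl (Tt : T3 tThr = _) (TO : T3 tOff = _) lof'.
have E : upd T3 tThr (ctr (thr + off)) = upd (upd T tNew (nt 0 (v * 2 ^ P))) tThr (ctr (thr + off)).
  by rewrite /T3 /T2 /T1 !upd_upd.
rewrite -E.
exact: (triY_le _ _ _ (triY_seq Y16 H1 (triY_seq Y16 H2 (triY_seq Y16 H3 H4)))).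
Qed.

Definition goto_field : cmd := For tS (For tL (moveS tNew MoveR)).

Lemma triY_goto P V T : par T -> T tNew = nt P V -> tri 2 goto_field T (Y ^ 4) (upd T tNew (nt (P + S * L) V)).
Proof.
move=> pT TN; have [_ [lL [_ [lS _]]]] := par_leE leY.
have [[_ [_ [_ [_ TL]]]] [_ [TS _]]] := pT.
apply: (@triY_for1 _ Y16 _ _ _ _ _ _ _ (fun q => nt (P + q * L) V)) => //; last by rewrite mul0n addn0.
move=> q lq.
have := @triY_moveR Y Y16 tNew tL L (P + q * L) (cells V) Sep (upd T tNew (nt (P + q * L) V)) isT isT erefl TL lL erefl.
by rewrite upd_upd -addnA -mulSnr.
Qed.

(** A zero is written as [Bit false] and not as a blank, because the output is read up to the first
    blank. Moving left yields the most significant digit first. *)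
Definition emit : cmd :=
  For tL (moveS tNew MoveL ;; Act [:: (tOut, fun s => (Bit (isone (s tNew)), MoveR))]).

Definition out_tape (o : seq sym) : atape := gtape Blank (size o) (nth Blank o).

Lemma triY_emit E V o T : par T -> T tNew = nt E V -> T tOut = out_tape o -> L <= E ->
  tri 1 emit T (Y ^ 3) (upd (upd T tNew (nt (E - L) V)) tOut (out_tape (o ++ map Bit (emits V E L)))).
Proof.
move=> pT TN TO lE; have [_ [lL _]] := par_leE leY.
have [[_ [_ [_ [_ TL]]]] _] := pT.
pose F k := upd (upd T tNew (nt (E - k) V)) tOut (out_tape (o ++ map Bit (emits V E k))).
have F0 : F 0 = T.
  by rewrite /F cats0 subn0 [upd T tNew _]upd_same // upd_same.
apply: (@triY_for _ Y16 _ _ _ _ _ _ F) => // k lk.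
have EE : E - k = (E - k.+1).+1 by lia.
have FkN : F k tNew = gtape Sep (E - k.+1).+1 (cells V) by rewrite -EE.
have H1 := @tri_moveL tNew (F k) Sep (E - k.+1) (cells V) isT FkN.
set T1 := upd _ tNew (gtape Sep (E - k.+1) (cells V)) in H1.
have H2 : tri 0 (Act [:: (tOut, fun s => (Bit (isone (s tNew)), MoveR))]) T1 1 (F k.+1).
  have ST : ascan (T1 tNew) = cell (bit V (E - k.+1)) by rewrite /T1 upd_eq ascan_gtape.
  apply: tri_act' => //; rewrite /acts_on /= mscan_ok // ST isone_cell.
  have -> : T1 tOut = out_tape (o ++ map Bit (emits V E k)) by [].
  rewrite /out_tape gtape_R fset_nth [F k.+1]/F emitsS map_rcons -rcons_cat /out_tape size_rcons.
  by rewrite /T1 /F; upds.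
exact: (triY_seq Y16 (triY_act Y16 0 H1) (triY_act Y16 0 H2)).
Qed.

Definition rewind_out : cmd := moveS tOut MoveL ;;
  (While (fun s => ~~ is_blank (s tOut)) (moveS tOut MoveL) ;; moveS tOut MoveR).

Lemma triY_rewind_out o T : T tOut = out_tape o -> all (fun s => ~~ is_blank s) o -> 0 < size o ->
  size o <= Y -> tri 0 rewind_out T (Y ^ 4) (upd T tOut (gtape Blank 0 (nth Blank o))).
Proof.
move=> TO nb o0 lo.
have nbi i : i < size o -> ~~ is_blank (nth Blank o i) by move=> li; exact: (all_nthP Blank nb).
have H1 := @tri_moveL tOut T Blank (size o).-1 (nth Blank o) isT.
rewrite prednK // in H1; have {}H1 := H1 TO.
pose g q := if q < size o then gtape Blank ((size o).-1 - q) (nth Blank o) else gend Blank (nth Blank o).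
have E0 : gtape Blank (size o).-1 (nth Blank o) = g 0 by rewrite /g o0 subn0.
have EP : g (size o) = gend Blank (nth Blank o) by rewrite /g ltnn.
rewrite E0 in H1.
have H2 : tri 0 (While (fun s => ~~ is_blank (s tOut)) (moveS tOut MoveL)) (upd T tOut (g 0)) (size o * 2).+1
    (upd T tOut (g (size o))).
  apply: (tri_while (F := fun q => upd T tOut (g q))).
    move=> q lq; rewrite mscan_ok // upd_eq {1}/g lq ascan_gtape nbi; last by lia.
    split=> //; rewrite /g lq; case: ltnP => lq'.
      have -> : (size o).-1 - q = ((size o).-1 - q.+1).+1 by lia.
      by have := @tri_moveL tOut _ _ _ _ isT (upd_eq T tOut (gtape Blank ((size o).-1 - q.+1).+1 (nth Blank o))); rewrite upd_upd.
    have -> : (size o).-1 - q = 0 by lia.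
    by have := @tri_moveL0 tOut _ _ _ isT (upd_eq T tOut (gtape Blank 0 (nth Blank o))); rewrite upd_upd.
  by rewrite EP mscan_ok // upd_eq.
rewrite EP in H2.
have H3 := @tri_moveE tOut _ _ _ isT (upd_eq T tOut (gend Blank (nth Blank o))); rewrite upd_upd in H3.
apply: tri_wk (tri_seq H1 (tri_seq H2 H3)) _ _ => //.
have : Y ^ 1 <= Y ^ 3 by exact: leq_Yexp.
by rewrite expn1 [Y ^ 4]expnS; nia.
Qed.

(** The block sum of length [S] has been multiplied in. Hence the base-2^L digit just below position
    [S * L] collects all grid points, and the one just below [thr + S * L] only those at or above
    the threshold: denominator and numerator. *)
Definition readout : cmd :=
  For tThr (moveS tNew MoveR) ;; (goto_field ;; (emit ;;
  (Act [:: (tOut, fun=> (Sep, MoveR))] ;; (rewind tNew ;; (goto_field ;; (emit ;; rewind_out)))))).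

Lemma triY_readout V thr T : par T -> T tNew = nt 0 V -> T tThr = ctr thr -> T tOut = blank ->
  thr + S * L <= Y -> L + L + 1 <= Y -> 0 < S ->
  exists2 T', tri 2 readout T (Y ^ 12) T' &
    T' tOut = gtape Blank 0 (nth Blank (map Bit (emits V (thr + S * L) L) ++
                 Sep :: map Bit (emits V (S * L) L))).
Proof.
move=> pT TN Tt TO lt lL S0; have lSL : L <= S * L by rewrite leq_pmull.
have lt' : thr <= Y by lia.
have H1 := @triY_moveR Y Y16 tNew tThr thr 0 (cells V) Sep T isT isT erefl Tt lt' TN.
rewrite add0n in H1; set T1 := upd T _ _ in H1.
have H2 := @triY_goto thr V T1 pT erefl; set T2 := upd T1 _ _ in H2.
have O2 : T2 tOut = out_tape [::].
  rewrite -[LHS]/(T tOut) TO -(gtape_blank 0); congr gtape; by apply/funext => -[].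
have lE : L <= thr + S * L by lia.
have H3 := @triY_emit (thr + S * L) V [::] T2 pT erefl O2 lE; set T3 := upd _ _ _ in H3.
rewrite cat0s in T3 H3; set o1 := map Bit _ in T3 H3 *.
have H4 : tri 0 (Act [:: (tOut, fun=> (Sep, MoveR))]) T3 1 (upd T3 tOut (out_tape (rcons o1 Sep))).
  apply: tri_act' => //; rewrite /acts_on /=; congr upd.
  by rewrite -[T3 tOut]/(out_tape o1) /out_tape gtape_R fset_nth size_rcons.
set T4 := upd T3 _ _ in H4.
have lP : thr + S * L - L <= Y by lia.
have H5 := @triY_rewind Y Y16 tNew T4 (thr + S * L - L) (cells V) isT erefl (@cells_nosep _) lP.
set T5 := upd T4 _ _ in H5.
have H6 := @triY_goto 0 V T5 pT erefl; rewrite add0n in H6; set T6 := upd T5 _ _ in H6.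
have H7 := @triY_emit (S * L) V (rcons o1 Sep) T6 pT erefl erefl lSL; set T7 := upd _ _ _ in H7.
rewrite cat_rcons in T7 H7; set o := o1 ++ _ in T7 H7 *.
have so : size o = L + L + 1 by rewrite /o size_cat /= !size_map !size_iota; lia.
have H8 := @triY_rewind_out o T7 erefl.
have {}H8 := H8 _ _ _; exists (upd T7 tOut (gtape Blank 0 (nth Blank o))); last by rewrite upd_eq.
have {}H8 : tri 0 rewind_out T7 (Y ^ 4) (upd T7 tOut (gtape Blank 0 (nth Blank o))).
  apply: H8; rewrite ?so //; last by lia.
  by rewrite all_cat /= !all_map; apply/andP; split; apply/allP.
exact: (triY_le _ _ _ (triY_seq Y16 H1 (triY_seq Y16 H2 (triY_seq Y16 H3 (triY_seq Y16 (triY_act Y16 0 H4)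
  (triY_seq Y16 H5 (triY_seq Y16 H6 (triY_seq Y16 H7 H8)))))))).
Qed.

End Readout.

(** * Passes over the input tape *)

Definition ltape (l r : seq sym) : atape := (nth Blank l, nth Blank r).

Lemma lt_scan l x r : ascan (ltape l (x :: r)) = x. Proof. by []. Qed.
Lemma lt_R l x y r : aact (y, MoveR) (ltape l (x :: r)) = ltape (y :: l) r.
Proof. by rewrite /ltape !nth_spush. Qed.
Lemma lt_L l x y z r : aact (y, MoveL) (ltape (x :: l) (z :: r)) = ltape l (x :: y :: r).
Proof. by rewrite /ltape !nth_spush. Qed.
Lemma lt_L0 y z r : aact (y, MoveL) (ltape [::] (z :: r)) = ltape [::] (Blank :: y :: r).
Proof. by rewrite /ltape !nth_spush; congr pair; apply/funext => i; rewrite /spop /= !nth_nil. Qed.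
Lemma lt_blank r : ltape [:: Blank] r = ltape [::] r.
Proof. by congr pair; apply/funext => -[|i] //=; rewrite !nth_nil. Qed.

Lemma tri_ltR x T l y r : ok_tape x -> T x = ltape l (y :: r) ->
  tri 0 (moveS x MoveR) T 1 (upd T x (ltape (y :: l) r)).
Proof. by move=> ok Tx; have := tri_moveS MoveR T ok; rewrite Tx lt_scan lt_R. Qed.

Definition co (o : nat -> bool) : nat -> sym := fun i => cell (o i).

Lemma co_nosep o q : ~~ issep (co o q). Proof. by rewrite /co; case: (o q). Qed.

Definition numw (x : bool * seq bool) : seq sym := Bit x.1 :: map Bit x.2 ++ [:: Sep].

Arguments numw : simpl never.

(** All coefficients have the same number of digits, most significant first. Their digitwise
    disjunction on [tOr] has its first mark at the leading digit of the largest one, found in a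
    linear pass without comparing numbers. *)
Definition or_number : cmd :=
  moveS tIn MoveR ;;
  (While (fun s => isbit (s tIn))
    (Act [:: (tOr, fun s => (cell (isone (s tOr) || isone (s tIn)), MoveR));
             (tIn, fun s => (s tIn, MoveR))]) ;;
  (moveS tIn MoveR ;; rewind tOr)).

Definition or_pass : cmd := While (fun s => ~~ issep (s tIn)) or_number.

Lemma isone_Bit b : isone (Bit b) = b. Proof. by case: b. Qed.

Lemma tri_or_number o s b l r T : T tIn = ltape l (numw (s, b) ++ r) -> T tOr = gtape Sep 0 (co o) ->
  tri 0 or_number T (4 * size b + 8)
    (upd (upd T tIn (ltape (rev (numw (s, b)) ++ l) r)) tOr (gtape Sep 0 (co (fun i => o i || nth false b i)))).
Proof.
move=> TI TO.
have EI : numw (s, b) ++ r = Bit s :: (map Bit b ++ Sep :: r) by rewrite /numw cat_cons -catA.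
rewrite EI in TI.
have H1 := @tri_ltR tIn T _ _ _ isT TI; set T1 := upd T _ _ in H1.
pose F k := upd (upd T tIn (ltape (rev (map Bit (take k b)) ++ Bit s :: l) (map Bit (drop k b) ++ Sep :: r)))
  tOr (gtape Sep k (co (fun i => o i || ((i < k) && nth false b i)))).
have F0 : F 0 = T1.
  rewrite /F take0 drop0 /=; have -> : co (fun i => o i || false) = co o.
    by apply/funext => i; rewrite /co orbF.
  by rewrite upd_same.
have H2 : tri 0 (While (fun s => isbit (s tIn))
    (Act [:: (tOr, fun s => (cell (isone (s tOr) || isone (s tIn)), MoveR));
             (tIn, fun s => (s tIn, MoveR))])) T1 (size b * 2).+1 (F (size b)).
  rewrite -F0; apply: tri_while; last by rewrite /F drop_size.
  move=> k lk; have Ed : drop k b = nth false b k :: drop k.+1 b by rewrite (drop_nth false).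
  have SI : ascan (F k tIn) = Bit (nth false b k) by rewrite -[F k tIn]/(ltape _ _) Ed.
  split; first by rewrite mscan_ok // SI.
  apply: tri_act' => //; rewrite /acts_on /= !mscan_ok // SI isone_Bit.
  have -> : F k tOr = gtape Sep k (co (fun i => o i || ((i < k) && nth false b i))) by [].
  have -> : F k tIn = ltape (rev (map Bit (take k b)) ++ Bit s :: l) (map Bit (drop k b) ++ Sep :: r) by [].
  rewrite ascan_gtape gtape_R Ed lt_R {2}/co ltnn /= orbF isone_cell.
  have -> : fset (co (fun i => o i || ((i < k) && nth false b i))) k (cell (o k || nth false b k)) =
      co (fun i => o i || ((i < k.+1) && nth false b i)).
    apply/funext => i; rewrite /fset /co ltnS; case: eqP => [->|ne]; first by rewrite leqnn.
    by rewrite [i <= k]leq_eqVlt; move/eqP/negbTE: ne => ->.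
  rewrite /F (take_nth false lk) map_rcons rev_rcons.
  by upds.
rewrite /F take_size drop_size in H2; set T2 := upd _ _ _ in H2.
have H3 := @tri_ltR tIn T2 _ _ _ isT erefl; set T3 := upd T2 _ _ in H3.
have H4 := @tri_rewind 16 isT tOr T3 (size b) _ isT erefl (@co_nosep _).
set T4 := upd T3 _ _ in H4.
have E4 : T4 = upd (upd T tIn (ltape (rev (numw (s, b)) ++ l) r)) tOr (gtape Sep 0 (co (fun i => o i || nth false b i))).
  have -> : co (fun i => o i || nth false b i) = co (fun i => o i || ((i < size b) && nth false b i)).
    apply/funext => i; rewrite /co; case: ltnP => // li; by rewrite nth_default.
  have -> : rev (numw (s, b)) ++ l = Sep :: rev (map Bit b) ++ Bit s :: l.
    by rewrite /numw rev_cons rev_cat /= cat_rcons.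
  by rewrite /T4 /T3 /T2; upds.
rewrite -E4; apply: tri_wk (tri_seq H1 (tri_seq H2 (tri_seq H3 H4))) _ _ => //; lia.
Qed.

Lemma tri_or_pass B ns o l r T : all (fun x => size x.2 == B) ns ->
  T tIn = ltape l (flatten (map numw ns) ++ Sep :: r) -> T tOr = gtape Sep 0 (co o) ->
  tri 0 or_pass T (size ns * (4 * B + 9) + 1)
    (upd (upd T tIn (ltape (rev (flatten (map numw ns)) ++ l) (Sep :: r))) tOr
       (gtape Sep 0 (co (fun i => o i || has (fun x => nth false x.2 i) ns)))).
Proof.
elim: ns o l T => [|[s b] ns IH] o l T /=.
  move=> _ TI TO; have -> : co (fun i => o i || false) = co o.
    by apply/funext => i; rewrite /co orbF.
  rewrite [upd T tIn _]upd_same // upd_same // mul0n.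
  by apply: tri_while0; rewrite mscan_ok // TI.
move=> /andP[/eqP sb ans] TI TO; rewrite -catA in TI.
have H1 := tri_or_number TI TO; set T1 := upd _ _ _ in H1.
have H2 := IH _ _ T1 ans erefl erefl.
have bt : ~~ issep (mscan T tIn) by rewrite mscan_ok // TI.
have := @tri_while1 _ (fun s => ~~ issep (s tIn)) _ _ _ _ _ _ bt H1 H2.
have -> : co (fun i => (o i || nth false b i) || has (fun x => nth false x.2 i) ns)
  = co (fun i => o i || (nth false b i || has (fun x => nth false x.2 i) ns)).
  by apply/funext => i; rewrite /co orbA.
rewrite -[Bit s :: _]/(numw (s, b) ++ flatten (map numw ns)) rev_cat -catA => H.
have ET : upd (upd T tIn (ltape (rev (flatten [seq numw i | i <- ns]) ++ rev (numw (s, b)) ++ l) (Sep :: r)))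
      tOr (gtape Sep 0 (co (fun i => o i || (nth false b i || has (fun x => nth false x.2 i) ns)))) =
    upd (upd T1 tIn (ltape (rev (flatten [seq numw i | i <- ns]) ++ rev (numw (s, b)) ++ l) (Sep :: r)))
      tOr (gtape Sep 0 (co (fun i => o i || (nth false b i || has (fun x => nth false x.2 i) ns)))).
  by rewrite /T1; upds.
rewrite ET; apply: tri_wk H _ _ => //; lia.
Qed.

Fixpoint Incn k x : cmd := if k is k'.+1 then Inc x ;; Incn k' x else Act [::].

Lemma tri_Incn k x q T : ok_tape x -> T x = ctr q -> tri 0 (Incn k x) T k.+1 (upd T x (ctr (q + k))).
Proof.
elim: k q T => [|k IH] q T ok Tx /=.
  by rewrite addn0 upd_same //; apply: tri_act'.
have H := tri_seq (tri_Inc ok Tx) (IH q.+1 _ ok (upd_eq _ _ _)).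
by rewrite upd_upd in H; rewrite -addSnnS; exact: H.
Qed.

Definition pairw (p : bool * bool) : seq sym := [:: Bit p.1; Bit p.2].

(** Each leading zero of the numerator adds [alpha] to the exponent [a]. The pass stops at the first
    nonzero digit, so the possibly very long rest of the encoding of eps is never read. *)
Definition eps_pass alpha : cmd := While (fun s => isbit (s tIn) && ~~ isone (s tIn))
  (moveS tIn MoveR ;; (moveS tIn MoveR ;; Incn alpha tA0)).

Lemma tri_eps_pass alpha t ps q l T : t < size ps ->
  (forall i, i < t -> (nth (false, false) ps i).1 = false) ->
  (nth (false, false) ps t).1 -> T tIn = ltape l (flatten (map pairw ps)) -> T tA0 = ctr q ->
  tri 0 (eps_pass alpha) T (t * (alpha + 4) + 1)
    (upd (upd T tIn (ltape (rev (flatten (map pairw (take t ps))) ++ l) (flatten (map pairw (drop t ps)))))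
       tA0 (ctr (q + t * alpha))).
Proof.
move=> lt_ts Hf Ht TI TA.
pose F k := upd (upd T tIn (ltape (rev (flatten (map pairw (take k ps))) ++ l) (flatten (map pairw (drop k ps)))))
       tA0 (ctr (q + k * alpha)).
have F0 : F 0 = T by rewrite /F take0 drop0 mul0n addn0 [upd T tIn _]upd_same // upd_same.
have Sk k : k < size ps -> ascan (F k tIn) = Bit (nth (false, false) ps k).1.
  by move=> lk; rewrite -[F k tIn]/(ltape _ _) (drop_nth (false, false) lk).
have H : tri 0 (eps_pass alpha) (F 0) (t * (alpha + 3).+1).+1 (F t).
  apply: tri_while.
    move=> k lk; have lk' : k < size ps by exact: ltn_trans lk lt_ts.
    rewrite mscan_ok // Sk // Hf //; split=> //.
    have E1 : F k tIn = ltape (rev (flatten (map pairw (take k ps))) ++ l)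
       (Bit (nth (false, false) ps k).1 :: Bit (nth (false, false) ps k).2 :: flatten (map pairw (drop k.+1 ps))).
      by rewrite -[F k tIn]/(ltape _ _) (drop_nth (false, false) lk').
    have H1 := @tri_ltR tIn _ _ _ _ isT E1; set T1 := upd _ _ _ in H1.
    have H2 := @tri_ltR tIn T1 _ _ _ isT erefl; set T2 := upd T1 _ _ in H2.
    have H3 := @tri_Incn alpha tA0 _ T2 isT erefl; set T3 := upd T2 _ _ in H3.
    have -> : F k.+1 = T3.
      rewrite /F (take_nth (false, false) lk') map_rcons flatten_rcons rev_cat /= /T3 /T2 /T1 /F.
      by rewrite -addnA -mulSnr; upds.
    apply: tri_wk (tri_seq H1 (tri_seq H2 H3)) _ _ => //; lia.
  by rewrite mscan_ok // Sk // Ht.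
by rewrite F0 in H; apply: tri_wk H _ _ => //; lia.
Qed.

Definition rewind_in : cmd :=
  While (fun s => ~~ is_blank (s tIn)) (moveS tIn MoveL) ;; moveS tIn MoveR.

Lemma tri_rewind_in l x r T : all (fun s => ~~ is_blank s) l -> ~~ is_blank x ->
  T tIn = ltape l (x :: r) -> tri 0 rewind_in T (size l * 2 + 5) (upd T tIn (ltape [::] (rev l ++ x :: r))).
Proof.
move=> nl nx TI.
have H1 : tri 0 (While (fun s => ~~ is_blank (s tIn)) (moveS tIn MoveL)) T ((size l).+1 * 2).+1
   (upd T tIn (ltape [::] (Blank :: rev l ++ x :: r))).
  elim: l x r T nl nx TI => [|y l IH] x r T /=.
    move=> _ nx TI; have H := @tri_moveS tIn MoveL T isT; rewrite TI lt_scan lt_L0 in H.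
    by apply: (@tri_while1 _ _ _ _ 1 _ 1) H _; [rewrite mscan_ok // TI|exact: tri_while0].
  move=> /andP[ny nl] nx TI; have H := @tri_moveS tIn MoveL T isT; rewrite TI lt_scan lt_L in H.
  have := IH y (x :: r) _ nl ny (upd_eq T tIn (ltape l (y :: x :: r))).
  rewrite upd_upd rev_cons cat_rcons => H2.
  have bt : ~~ is_blank (mscan T tIn) by rewrite mscan_ok // TI.
  exact: (@tri_while1 _ (fun s => ~~ is_blank (s tIn)) _ _ _ _ _ _ bt H H2).
have := @tri_ltR tIn _ _ _ _ isT (upd_eq T tIn (ltape [::] (Blank :: rev l ++ x :: r))).
rewrite upd_upd lt_blank => H2.
by apply: tri_wk (tri_seq H1 H2) _ _ => //; lia.
Qed.

Lemma bits_val_lt s : bits_val s < 2 ^ size s.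
Proof.
elim/last_ind: s => // s b IH; rewrite bits_val_rcons size_rcons expnS.
by case: b => /=; lia.
Qed.

Lemma sgn_set b c : aact (Bit b, Stay) (sgn_tape c) = sgn_tape b.
Proof.
rewrite /sgn_tape gtape_S; congr gtape; apply/funext => i; rewrite /fset; by case: eqP.
Qed.

(** * Reading the coefficients and the main loop *)

Section Main.
Variables Y m J N W0 L off S n p : nat.
Hypothesis Y16 : 16 <= Y.
Hypothesis leY : par_le Y m J N W0 L off S n p.
Hypothesis leLp : L * 2 ^ p <= Y.
Hypothesis N0 : 0 < N.
Local Notation par := (par m J N W0 L off S n p).

Variables (B z : nat) (o : nat -> bool).
Hypothesis zB : z <= B.
Hypothesis oz : forall i, i < z -> o i = false.
Hypothesis oz1 : z < B -> o z.

(** The factor [L] makes every displacement a multiple of [L], so each value of the quadratic has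
    its own base-2^L digit. *)
Definition rd (x : bool * seq bool) := L * bits_val (take p (drop z x.2)).

Lemma rd_le k x : k <= p -> L * bits_val (take k (drop z x)) <= Y.
Proof.
move=> lk; apply: leq_trans leLp; rewrite leq_mul2l; apply/orP; right.
apply: leq_trans (ltnW (bits_val_lt _)) _; rewrite leq_exp2l //.
by apply: leq_trans lk; rewrite size_take; case: ltnP.
Qed.

Definition read_digit : cmd :=
  If (fun s => isbit (s tIn))
    (For tMu (Inc tMu) ;; (If (fun s => isone (s tIn)) (For tL (Inc tMu)) (Act [::]) ;; moveS tIn MoveR))
    (Act [::]).

(** [tOr] steers the head past the common leading zeros, then [p] digits are read by Horner's rule.
    Only head moves depend on [B]: skipping, passing over the rest, and rewinding [tOr], whence the
    term [6 * B]. *)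
Definition read : cmd :=
  Act [:: (tSm, fun s => (s tIn, Stay)); (tIn, fun s => (s tIn, MoveR))] ;;
  (While (fun s => isbit (s tIn) && ~~ isone (s tOr))
     (Act [:: (tIn, fun s => (s tIn, MoveR)); (tOr, fun s => (s tOr, MoveR))]) ;;
  (For tP read_digit ;;
  (While (fun s => isbit (s tIn)) (moveS tIn MoveR) ;; (moveS tIn MoveR ;; rewind tOr)))).

Lemma tri_read s b l r c T : par T -> size b = B ->
  T tIn = ltape l (numw (s, b) ++ r) -> T tOr = gtape Sep 0 (co o) ->
  T tMu = ctr 0 -> T tSm = sgn_tape c ->
  tri 2 read T (6 * B + Y ^ 9)
   (upd (upd (upd T tIn (ltape (rev (numw (s, b)) ++ l) r)) tMu (ctr (rd (s, b)))) tSm (sgn_tape s)).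
Proof.
move=> pT sb TI TO TM TS.
have [_ [lL [_ [_ lp]]]] := par_leE leY.
have [[_ [_ [_ [_ TL]]]] [_ [_ [_ TP]]]] := pT.
have EI : numw (s, b) ++ r = Bit s :: (map Bit b ++ Sep :: r) by rewrite /numw cat_cons -catA.
rewrite EI in TI.
pose I k := ltape (rev (map Bit (take k b)) ++ Bit s :: l) (map Bit (drop k b) ++ Sep :: r).
pose G k q v := upd (upd (upd (upd T tIn (I k)) tOr (gtape Sep q (co o))) tMu (ctr v)) tSm (sgn_tape s).
have Ik k : k < B -> I k = ltape (rev (map Bit (take k b)) ++ Bit s :: l)
    (Bit (nth false b k) :: map Bit (drop k.+1 b) ++ Sep :: r).
  by move=> lk; rewrite /I (drop_nth false) // sb.
have IS k : k < B -> I k.+1 = ltape (Bit (nth false b k) :: rev (map Bit (take k b)) ++ Bit s :: l)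
    (map Bit (drop k.+1 b) ++ Sep :: r).
  by move=> lk; rewrite /I (take_nth false) ?sb // map_rcons rev_rcons.
have IB k : B <= k -> I k = ltape (rev (map Bit b) ++ Bit s :: l) (Sep :: r).
  by move=> lk; rewrite /I take_oversize ?drop_oversize ?sb.
have Ibit k q v : isbit (ascan (G k q v tIn)) = (k < B).
  rewrite -[G k q v tIn]/(I k); case: ltnP => lk; first by rewrite Ik.
  by rewrite IB.
have H1 : tri 0 (Act [:: (tSm, fun s => (s tIn, Stay)); (tIn, fun s => (s tIn, MoveR))]) T 1 (G 0 0 0).
  apply: tri_act' => //; rewrite /acts_on /= mscan_ok // TI lt_scan TS sgn_set lt_R.
  rewrite /G /I take0 drop0 -TO -TM; upds.
have H2 : tri 0 (While (fun s => isbit (s tIn) && ~~ isone (s tOr))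
     (Act [:: (tIn, fun s => (s tIn, MoveR)); (tOr, fun s => (s tOr, MoveR))])) (G 0 0 0) (z * 2).+1 (G z z 0).
  apply: (tri_while (F := fun k => G k k 0)) => [k lk|].
    have lkB : k < B by lia.
    have OR : G k k 0 tOr = gtape Sep k (co o) by [].
    rewrite !mscan_ok // Ibit lkB OR ascan_gtape /co oz //; split=> //.
    apply: tri_act' => //; rewrite /acts_on /= !mscan_ok // OR ascan_gtape gtape_R fset_id.
    have -> : G k k 0 tIn = I k by [].
    rewrite Ik // lt_scan lt_R -IS // /G; upds.
  rewrite !mscan_ok // Ibit; case: ltnP => // /oz1 oz2.
  by rewrite -[G z z 0 tOr]/(gtape Sep z (co o)) ascan_gtape /co oz2.
pose v k := L * bits_val (take k (drop z b)).
have H3 : tri 2 (For tP read_digit) (G z z 0) (Y ^ 8) (G (z + p) z (v p)).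
  apply: (triY_for Y16 (F := fun k => G (z + k) z (v k))) => //; last first.
    by rewrite /v addn0 take0 /bits_val /= muln0.
  move=> k lk.
  have lv : v k <= Y by apply: rd_le; exact: ltnW.
  (* When fewer than [p] digits remain, the head waits on the separator; the number has then been
     read in full. *)
  case: (ltnP (z + k) B) => lzk; last first.
    have -> : G (z + k.+1) z (v k.+1) = G (z + k) z (v k).
      rewrite /G !IB //; last by lia.
      congr (upd (upd _ _ (ctr (L * bits_val _))) _ _).
      by rewrite !take_oversize // size_drop sb; lia.
    apply: tri_wk (tri_if (t := 1) _) _ _; last 2 first.
    - exact: (leq0n 1).
    - by apply: leq_Y => //; lia.
    by rewrite mscan_ok // Ibit ltnNge lzk; apply: tri_act'.
  have Vk : v k.+1 = v k + v k + (if nth false b (z + k) then L else 0).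
    rewrite /v (take_nth false) ?size_drop ?sb; last by lia.
    rewrite nth_drop bits_val_rcons mulnDr -addnn mulnDr.
    by case: nth; rewrite ?muln1 ?muln0.
  have D1 : tri 1 (For tMu (Inc tMu)) (G (z + k) z (v k)) (Y ^ 2) (G (z + k) z (v k + v k)).
    have -> : G (z + k) z (v k + v k) = upd (G (z + k) z (v k)) tMu (ctr (v k + v k)) by rewrite /G; upds.
    apply: (@triY_for1 _ Y16 _ _ _ _ _ _ _ (fun q => ctr (v k + q))) => //; last by rewrite addn0.
    move=> q lq; apply: triY_act => //; rewrite addnS.
    by have := @tri_Inc tMu _ _ isT (upd_eq (G (z + k) z (v k)) tMu (ctr (v k + q))); rewrite upd_upd.
  have SI q : mscan (G (z + k) z q) tIn = Bit (nth false b (z + k)).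
    by rewrite mscan_ok // -[G (z + k) z q tIn]/(I (z + k)) Ik.
  have D2 : tri 1 (If (fun s => isone (s tIn)) (For tL (Inc tMu)) (Act [::]))
      (G (z + k) z (v k + v k)) (Y ^ 3) (G (z + k) z (v k.+1)).
    apply: tri_wk (tri_if (t := Y ^ 2) _) _ _; last 2 first.
    - exact: (leqnn 1).
    - by rewrite expnS; have := leq_Yexp Y16 (isT : 0 <= 2); rewrite expn0; nia.
    rewrite SI isone_Bit Vk; case: nth.
      have := triY_Incs Y16 (isT : ok_tape tMu) (isT : ok_tape tL) erefl
         (erefl : G (z + k) z (v k + v k) tMu = _) (TL : G (z + k) z (v k + v k) tL = _) lL.
      congr tri; rewrite /G; upds.
    by rewrite addn0; apply: tri_wk (tri_act' (T' := G (z + k) z (v k + v k)) (al := [::]) _ _) _ _ => //; apply: leq_Y => //; lia.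
  have D3 : tri 0 (moveS tIn MoveR) (G (z + k) z (v k.+1)) 1 (G (z + k.+1) z (v k.+1)).
    have := @tri_ltR tIn (G (z + k) z (v k.+1)) _ _ _ isT (Ik _ lzk).
    rewrite -IS // addnS; congr tri; rewrite /G; upds.
  apply: tri_wk (tri_if (t := Y ^ 5) _) _ _; last 2 first.
  - exact: (leqnn 1).
  - by rewrite [Y ^ 6]expnS; have := leq_Yexp Y16 (isT : 0 <= 5); rewrite expn0; nia.
  rewrite mscan_ok // Ibit lzk.
  exact: (triY_le _ _ _ (triY_seq Y16 D1 (triY_seq Y16 D2 (triY_act Y16 0 D3)))).
have Iend : G (z + p) z (v p) = G (minn (z + p) B) z (v p).
  case: (leqP (z + p) B) => // lt; rewrite /G; congr (upd (upd (upd (upd _ _ _) _ _) _ _) _ _).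
  by rewrite !IB // ltnW.
rewrite Iend in H3; set e := minn _ _ in H3.
have eB : e <= B by rewrite geq_minr.
have H4 : tri 0 (While (fun s => isbit (s tIn)) (moveS tIn MoveR)) (G e z (v p)) ((B - e) * 2).+1 (G B z (v p)).
  have := @tri_while 0 (fun s => isbit (s tIn)) (moveS tIn MoveR) (B - e) 1 (fun k => G (e + k) z (v p)).
  rewrite addn0 subnKC //; apply; last by rewrite mscan_ok // Ibit ltnn.
  move=> k lk; have lk' : e + k < B by lia.
  rewrite mscan_ok // Ibit lk'; split=> //.
  have := @tri_ltR tIn (G (e + k) z (v p)) _ _ _ isT (Ik _ lk').
  rewrite -IS // addnS; congr tri; rewrite /G; upds.
have H5 := @tri_ltR tIn (G B z (v p)) _ _ _ isT (IB _ (leqnn B)); set T5 := upd _ _ _ in H5.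
have H6 := @tri_rewind 16 isT tOr T5 z (co o) isT erefl (@co_nosep _).
have E6 : upd T5 tOr (gtape Sep 0 (co o)) =
   upd (upd (upd T tIn (ltape (rev (numw (s, b)) ++ l) r)) tMu (ctr (rd (s, b)))) tSm (sgn_tape s).
  have -> : rev (numw (s, b)) ++ l = Sep :: rev (map Bit b) ++ Bit s :: l.
    by rewrite /numw rev_cons rev_cat /= cat_rcons.
  rewrite -TO /T5 /G; upds.
rewrite -E6.
have D2 := fun c T t T' (H : tri 0 c T t T') => tri_wk H (leq0n 2) (leqnn t).
apply: tri_wk (tri_seq (D2 _ _ _ _ H1) (tri_seq (D2 _ _ _ _ H2) (tri_seq H3 (tri_seq (D2 _ _ _ _ H4)
  (tri_seq (D2 _ _ _ _ H5) (D2 _ _ _ _ H6)))))) _ _ => //.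
have := leq_Yexp Y16 (isT : 0 <= 8); rewrite [Y ^ 9]expnS expn0; nia.
Qed.

Definition transfer : cmd :=
  For tMu (Inc tLam) ;; (Clr tMu ;; Act [:: (tSl, fun s => (s tSm, Stay))]).

Lemma triY_transfer q s c T : T tMu = ctr q -> T tLam = ctr 0 -> T tSm = sgn_tape s -> T tSl = sgn_tape c ->
  q <= Y -> tri 1 transfer T (Y ^ 4) (upd (upd (upd T tLam (ctr q)) tMu (ctr 0)) tSl (sgn_tape s)).
Proof.
move=> TM TL TS TSl lq.
have H1 := triY_Incs Y16 (isT : ok_tape tLam) (isT : ok_tape tMu) erefl TL TM lq.
rewrite add0n in H1; set T1 := upd T _ _ in H1.
have H2 := @triY_Clr Y Y16 tMu q T1 isT TM lq; set T2 := upd T1 _ _ in H2.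
have H3 : tri 0 (Act [:: (tSl, fun s => (s tSm, Stay))]) T2 1 (upd T2 tSl (sgn_tape s)).
  apply: tri_act' => //; rewrite /acts_on /= mscan_ok //.
  by rewrite -[T2 tSm]/(T tSm) -[T2 tSl]/(T tSl) TS TSl sgn_scan sgn_set.
exact: (triY_le _ _ _ (triY_seq Y16 H1 (triY_seq Y16 H2 (triY_act Y16 0 H3)))).
Qed.

Definition ready (v thr : nat) (h : bool * seq bool) (T : tapes) : Prop :=
  [/\ par T /\ T tj = ctr 0, T tw = ctr 0 /\ T tr = ctr 0, T tLam = ctr 0 /\ T tMu = ctr (rd h),
    (exists c, T tSl = sgn_tape c) /\ T tSm = sgn_tape h.1 &
    [/\ T tCar = blank /\ T tNew = nt 0 0, T tOut = blank, T tOr = gtape Sep 0 (co o), T tAcc = nt 0 v &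
      T tThr = ctr thr]].

Definition nums (cs : seq ((bool * seq bool) * (bool * seq bool))) tau :=
  flatten [seq [:: c.1; c.2] | c <- cs] ++ [:: tau].

(** The constant term looks like any coefficient and is recognised only by the second separator
    behind it. The loop therefore keeps one number read ahead on [tMu]: the quadratic coefficient of
    the next coordinate or, at exit, the constant term. *)
Definition main_loop : cmd :=
  While (fun s => ~~ issep (s tIn)) (transfer ;; (read ;; (coord ;; read))).

Definition csum (c : (bool * seq bool) * (bool * seq bool)) :=
  coord_sum off m J N W0 c.1.1 c.2.1 (rd c.1) (rd c.2).

Lemma tri_main_loop cs tau v thr l r T h t :
  nums cs tau = h :: t -> all (fun x => size x.2 == B) (h :: t) ->
  (forall j x y, j < J -> j * (j * rd x) + m * (j * rd y) <= off) ->
  (forall k, v * \prod_(c <- take k cs) csum c < 2 ^ n) ->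
  ready v thr h T -> T tIn = ltape l (flatten (map numw t) ++ Sep :: r) ->
  exists2 T', tri 5 main_loop T (size cs * (12 * B + Y ^ 30) + 1) T' &
    ready (v * \prod_(c <- cs) csum c) (thr + size cs * off) tau T'.
Proof.
elim: cs v thr l T h t => [|[x y] cs IH] v thr l T h t.
  case=> <- <- /= _ _ _ rT TI; exists T; first by apply: tri_while0; rewrite mscan_ok // TI.
  by rewrite big_nil muln1 mul0n addn0.
move=> En sB lo lV [[pT Tj] [Tw Tr] [Tl TM] [[c TSl] TSm] [[TC TN] TO TOr TA Tt]] TI.
case: En => Eh Et; move: sB TM TSm TI; rewrite -{}Eh -{}Et {h t} => sB TM TSm TI.
have sx : rd x <= Y by exact: rd_le.
have sy : rd y <= Y by exact: rd_le.
have [t1 [h1 [Et1 st]]] : exists t1 h1, nums cs tau = h1 :: t1 /\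
    flatten (map numw (nums cs tau)) = numw h1 ++ flatten (map numw t1).
  by rewrite /nums; case: (cs) => [|[x1 y1] cs1]; eexists; eexists; split; reflexivity.
have sy2 : size y.2 = B by case/and3P: sB => _ /eqP.
have sB' : all (fun x => size x.2 == B) (h1 :: t1) by rewrite -Et1; case/and3P: sB.
have sh1 : size h1.2 = B by case/andP: sB' => /eqP.
have H1 := triY_transfer TM Tl TSm TSl sx; set T1 := upd _ _ _ in H1.
have TI1 : T1 tIn = ltape l (numw (y.1, y.2) ++ (numw (h1.1, h1.2) ++ flatten (map numw t1) ++ Sep :: r)).
  rewrite -[T1 tIn]/(T tIn) TI; congr (ltape _ _).
  rewrite -[flatten (map numw _)]/(numw y ++ flatten (map numw (nums cs tau))) st.
  by case: (y) => ys yb; case: (h1) => hs hb; rewrite -!catA.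
have H2 := @tri_read y.1 y.2 l _ _ T1 pT sy2 TI1 TOr erefl TSm; set T2 := upd _ _ _ in H2.
have Ey : (y.1, y.2) = y by case: (y).
have Eh1 : (h1.1, h1.2) = h1 by case: (h1).
rewrite Ey in T2 H2.
have lv : v < 2 ^ n by have := lV 0; rewrite take0 big_nil muln1.
have lV1 : v * csum (x, y) < 2 ^ n by have := lV 1; rewrite /= take0 big_seq1.
have H3 := @triY_coord Y m J N W0 L off S n p Y16 leY (rd x) (rd y) x.1 y.1 v thr T2 pT Tj erefl erefl erefl erefl
  Tw TA TC Tr N0 TN Tt sx sy (fun j lj => lo j x y lj) lv lV1; set T3 := upd _ _ _ in H3.
have H4 := @tri_read h1.1 h1.2 _ _ _ T3 pT sh1 erefl TOr erefl erefl; set T4 := upd _ _ _ in H4.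
rewrite Eh1 in T4 H4.
have [||T' H5 R5] := IH (v * csum (x, y)) (thr + off) _ T4 h1 t1 Et1 sB' lo _ _ erefl.
    by move=> k; have := lV k.+1; rewrite /= big_cons mulnA.
  by split=> //; split=> //; exists x.1.
exists T'; last by move: R5; rewrite big_cons mulnA mulSn addnA.
have bt : ~~ issep (mscan T tIn) by rewrite mscan_ok // TI /=.
have HB := tri_seq (tri_wk H1 (isT : 1 <= 5) (leqnn _)) (tri_seq (tri_wk H2 (isT : 2 <= 5) (leqnn _))
  (tri_seq H3 (tri_wk H4 (isT : 2 <= 5) (leqnn _)))).
have := @tri_while1 _ (fun s => ~~ issep (s tIn)) _ _ _ _ _ _ bt HB H5.
move=> /tri_wk; apply => //; rewrite [size (_ :: _) * _]mulSn.
have : Y ^ 4 + Y ^ 9 + Y ^ 26 + Y ^ 9 + 1 <= Y ^ 30.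
  have := leq_Yexp Y16 (isT : 4 <= 26); have := leq_Yexp Y16 (isT : 9 <= 26).
  have := leq_Yexp Y16 (isT : 0 <= 26); have := leq_Yexp Y16 (isT : 27 <= 30).
  by rewrite [Y ^ 27]expnS expn0; set a := Y ^ 26; nia.
set q := size cs * _; move: q (Y ^ 4) (Y ^ 9) (Y ^ 26) (Y ^ 30) => q a4 a9 a26 a30.
lia.
Qed.

End Main.

(** * Initialisation and computation of the parameters *)

Lemma init_blank w i : init_tapes w i.+1 = ctr 0.
Proof. by rewrite ctr0 /init_tapes /=; congr pair; apply/funext => j /=; rewrite nth_nil. Qed.

Lemma blank_sep : aact (Sep, MoveR) (ctr 0) = nt 0 0.
Proof.
rewrite ctr0 /nt /gtape /aact /=; congr pair; apply/funext => i; rewrite /spush /spop /=.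
  by case: i.
by rewrite /cells /bit div0n.
Qed.

Lemma blank_sgn b : aact (Bit b, Stay) (ctr 0) = sgn_tape b.
Proof. by rewrite /ctr gtape_S. Qed.

Lemma nt0_or : nt 0 0 = gtape Sep 0 (co (fun=> false)).
Proof. by rewrite /nt; congr gtape; apply/funext => i; rewrite /cells /co /bit div0n. Qed.

(** Monomials are computed in unary, by loops over the factors nested around an increment. *)
Definition prod_loops (x c : nat) (xs : seq nat) : cmd := foldr For (Incn c x) xs.

Section Params.
Variable Y : nat.
Hypothesis Y16 : 16 <= Y.

Lemma triY_prod_loops x c (xs : seq (nat * nat)) T k : ok_tape x ->
  all (fun y => ok_tape y.1 && (y.1 != x)) xs -> T x = ctr k -> c < Y ->
  foldr (fun y P => (T y.1 = ctr y.2 /\ y.2 <= Y) /\ P) True xs ->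
  tri (size xs) (prod_loops x c (map fst xs)) T (Y ^ ((size xs).*2 + 1))
    (upd T x (ctr (k + foldr muln c (map snd xs)))).
Proof.
move=> ok okx Tx lc HT.
suff : forall k, tri (size xs) (prod_loops x c (map fst xs)) (upd T x (ctr k)) (Y ^ ((size xs).*2 + 1))
    (upd T x (ctr (k + foldr muln c (map snd xs)))).
  by move=> /(_ k); rewrite (upd_same Tx).
move: {k Tx} HT; elim: xs okx => [|[y v] xs IH] /= okx HT k.
  have := @tri_Incn c x k _ ok (upd_eq T x (ctr k)); rewrite upd_upd.
  by move=> /tri_wk; apply => //; rewrite expn1.
case/andP: okx => /andP[oky nyx] okx; case: HT => [[Ty lv] Txs].
have := @triY_for Y Y16 (size xs) y (prod_loops x c (map fst xs)) v ((size xs).*2 + 1)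
  (upd T x (ctr k)) (fun q => upd T x (ctr (k + q * foldr muln c (map snd xs)))) oky.
rewrite doubleS !addSn; apply => //.
- by rewrite upd_ne ?Ty //; apply/negbTE.
- by move=> q lq; rewrite mulSnr addnA; exact: IH.
- by rewrite mul0n addn0.
Qed.

(** The inner loop doubles [tA], which relies on its count being copied before the body changes
    it. *)
Definition set_A : cmd := Inc tA ;; For tA0 (For tA (Inc tA)).

Lemma triY_set_A a T : T tA0 = ctr a -> T tA = ctr 0 -> 2 ^ a <= Y ->
  tri 2 set_A T (Y ^ 5) (upd T tA (ctr (2 ^ a))).
Proof.
move=> Ta TA lY.
have lk k : k <= a -> 2 ^ k <= Y by move=> lk; apply: leq_trans lY; rewrite leq_exp2l.
have la : a <= Y by apply: leq_trans lY; exact: ltnW (ltn_expl _ _).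
have H1 := @tri_Inc tA 0 T isT TA.
have H2 : tri 2 (For tA0 (For tA (Inc tA))) (upd T tA (ctr 1)) (Y ^ 4) (upd T tA (ctr (2 ^ a))).
  apply: (triY_for Y16 (F := fun q => upd T tA (ctr (2 ^ q)))) => // q lq.
  have -> : upd T tA (ctr (2 ^ q.+1)) = upd (upd T tA (ctr (2 ^ q))) tA (ctr (2 ^ q + 2 ^ q)).
    by rewrite upd_upd expnS mul2n addnn.
  apply: (@triY_for1 _ Y16 _ _ _ _ _ _ _ (fun k => ctr (2 ^ q + k))) => //; first exact: lk (ltnW lq).
    move=> k lkq; apply: triY_act => //; rewrite addnS !upd_upd.
    by have := @tri_Inc tA _ _ isT (upd_eq T tA (ctr (2 ^ q + k))); rewrite upd_upd.
  by rewrite addn0.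
exact: (triY_le _ _ _ (triY_seq Y16 (triY_act Y16 0 H1) H2)).
Qed.

End Params.

Section Values.
Variable A : nat.
(** The exponent 8 balances the two sides of the anticoncentration estimate in [small_prob]: both
    become multiples of [K M / A^7], with constants 18 and 289/16. *)
Definition vM := A ^ 8.
Definition vJ := A * vM.
(** The Gaussian exponent at [j/m] is [j^2 / (2 m^2)], so one decay must multiply by about
    [exp (-1/(2 m^2))]. *)
Definition vN := 2 * (vM * vM).
(** Rounding changes a weight by at most [N], that is, by a fraction [1/N] of the initial weight
    [N^2]. *)
Definition vW := vN * vN.
Definition vL := A * (vJ * vW).
(** Truncated coefficients are below [2 ^ (16 * a) = m^2] and grid indices below [J], so each of the
    two terms of a displacement is at most [L m^2 J^2]. *)
Definition vOff := 2 * (vL * (vM * (vM * (vJ * vJ)))).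
Definition vS := A * vOff.
Definition vLen := A * (vL * vS).
Definition vY := 2 * vLen.
End Values.

Definition set_params : cmd :=
  set_A ;; (prod_loops tP 16 [:: tA0] ;; (prod_loops tM 1 (nseq 8 tA) ;;
  (prod_loops tJ 1 [:: tA; tM] ;; (prod_loops tN 2 [:: tM; tM] ;;
  (prod_loops tW0 1 [:: tN; tN] ;; (prod_loops tL 1 [:: tA; tJ; tW0] ;;
  (prod_loops tOff 2 [:: tL; tM; tM; tJ; tJ] ;; (prod_loops tS 1 [:: tA; tOff] ;;
  prod_loops tLen 1 [:: tA; tL; tS])))))))).

Section WithA.
Variables a A : nat.
Hypothesis EA : A = 2 ^ a.
Hypothesis A4 : 4 <= A.
Let Y := vY A.

Lemma muln_gt0' x y : 0 < x -> 0 < y -> 0 < x * y.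
Proof. by rewrite muln_gt0 => -> ->. Qed.

Lemma values_pos : [/\ 0 < vM A, 0 < vJ A, 0 < vN A, 0 < vW A & 0 < vL A] /\
  [/\ 0 < vOff A, 0 < vS A & 0 < vLen A].
Proof.
have A0 : 0 < A by lia.
have M0 : 0 < vM A by rewrite expn_gt0 A0.
have J0 : 0 < vJ A by rewrite muln_gt0 A0.
have N0 : 0 < vN A by do 2 apply: muln_gt0' => //.
have W0 : 0 < vW A by apply: muln_gt0'.
have L0 : 0 < vL A by do 2 apply: muln_gt0' => //.
have Of0 : 0 < vOff A by rewrite /vOff; do 5 (apply: muln_gt0' => //).
have S0 : 0 < vS A by rewrite /vS muln_gt0 A0.
by do !split => //; do 2 apply: muln_gt0' => //.
Qed.

Lemma leq_fac x y z : 0 < y -> x <= z -> x <= y * z.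
Proof. by move=> y0 lxz; apply: leq_trans lxz _; rewrite leq_pmull. Qed.

Lemma values_le : [/\ A <= vM A, vM A <= vJ A, vM A <= vN A, vN A <= vW A & vJ A <= vL A /\ vW A <= vL A] /\
  [/\ vL A <= vOff A, 4 * vOff A <= vS A, 4 * vS A <= vL A * vS A & vL A * vS A * 4 <= vLen A].
Proof.
have [[M0 J0 N0 hW0 L0] [Of0 S0 n0]] := values_pos.
have A0 : 0 < A by lia.
have lAM : A <= vM A by rewrite /vM expnS leq_pmulr // expn_gt0 A0.
have lWL : vW A <= vL A by rewrite /vL; apply: leq_fac => //; exact: leq_fac.
have lNW : vN A <= vW A by rewrite /vW leq_fac.
have lMN : vM A <= vN A by rewrite /vN; apply: leq_fac => //; exact: leq_fac.
split; split=> //; first by rewrite /vJ leq_fac.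
- by split=> //; rewrite /vL; apply: leq_fac => //; exact: leq_pmulr.
- by rewrite /vOff; apply: leq_fac => //; apply: leq_pmulr; do 3 apply: muln_gt0' => //.
- by rewrite /vS leq_mul2r A4 orbT.
- rewrite leq_mul2r; apply/orP; right.
  apply: leq_trans A4 _; apply: leq_trans lAM _; apply: leq_trans lMN _.
  exact: leq_trans lNW lWL.
- by rewrite /vLen [A * _]mulnC leq_mul2l A4 orbT.
Qed.

Lemma Y16A : 16 <= Y.
Proof.
rewrite /Y /vY; have [[? ? ? ? [? ?]] [? ? ? ?]] := values_le; nia.
Qed.

Lemma Y17A : 16 < Y.
Proof.
rewrite /Y /vY; have [[? ? ? ? [? ?]] [? ? ? ?]] := values_le; nia.
Qed.

Lemma par_leA : par_le Y (vM A) (vJ A) (vN A) (vW A) (vL A) (vOff A) (vS A) (vLen A) (16 * a).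
Proof.
have [[l1 l2 l3 l4 [l5 l6]] [l7 l8 l9 l10]] := values_le.
have [[M0 J0 N0 hW0 L0] [Of0 S0 n0]] := values_pos.
have la : a < A by rewrite EA; exact: ltn_expl.
have lA8 : A * 4 <= vM A.
  rewrite /vM expnS leq_mul2l; apply/orP; right; apply: leq_trans A4 _.
  by rewrite expnS leq_pmulr // expn_gt0; lia.
rewrite /par_le /Y /vY; by apply/and5P; split; nia.
Qed.

Lemma leLpA : vL A * 2 ^ (16 * a) <= vOff A.
Proof.
have [[M0 J0 N0 hW0 L0] [Of0 S0 n0]] := values_pos.
rewrite mulnC [16 * a]mulnC expnM -EA /vOff.
have -> : A ^ 16 = vM A * vM A by rewrite /vM -expnD.
have : 0 < vJ A * vJ A by rewrite muln_gt0 J0.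
set j := vJ A * vJ A; set q := vL A; set k := vM A => j0.
have -> : 2 * (q * (k * (k * j))) = 2 * j * (k * k * q) by lia.
by apply: leq_fac => //; lia.
Qed.

Lemma off_bound (z : nat) (x y : bool * seq bool) j : j < vJ A ->
  j * (j * rd (vL A) (16 * a) z x) + vM A * (j * rd (vL A) (16 * a) z y) <= vOff A.
Proof.
move=> lj; have [[l1 l2 _ _ _] _] := values_le.
have rl w : rd (vL A) (16 * a) z w <= vL A * (vM A * vM A).
  rewrite /rd leq_mul2l; apply/orP; right.
  have -> : vM A * vM A = 2 ^ (16 * a).
    by rewrite /vM -expnD [16 * a]mulnC expnM -EA.
  apply: leq_trans (ltnW (bits_val_lt _)) _; rewrite leq_exp2l //.
  by rewrite size_take; case: ltnP => // /ltnW.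
have := rl x; have := rl y; move: (rd _ _ _ x) (rd _ _ _ y) => rx ry ly lx.
rewrite /vOff; move: (vL A) (vM A) (vJ A) l2 lj lx ly => q k J lkJ lj lx ly.
have H1 : j * (j * rx) <= J * (J * (q * (k * k))) by rewrite leq_mul ?leq_mul // ltnW.
have H2 : k * (j * ry) <= J * (J * (q * (k * k))) by rewrite leq_mul ?leq_mul // ltnW.
apply: leq_trans (leq_add H1 H2) _.
have -> : 2 * (q * (k * (k * (J * J)))) = 2 * (J * (J * (q * (k * k)))) by lia.
by rewrite mul2n addnn.
Qed.

Lemma tau_bound (z : nat) (x : bool * seq bool) :
  vM A * (vM A * rd (vL A) (16 * a) z x) <= vOff A.
Proof.
have [[M0 J0 _ _ _] _] := values_pos.
have lJ : (vM A) < vJ A.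
  by rewrite /vJ -[X in X < _]mul1n ltn_mul2r M0 /=; lia.
by have := @off_bound z x x _ lJ; apply: leq_trans; rewrite leq_addr.
Qed.

Local Notation parA := (par (vM A) (vJ A) (vN A) (vW A) (vL A) (vOff A) (vS A) (vLen A) (16 * a)).

Lemma triY_set_params T : T tA0 = ctr a ->
  (forall i, 12 <= i <= 21 -> T i = ctr 0) ->
  exists2 T', tri 8 set_params T (Y ^ 30) T' &
    parA T' /\ (forall i, ~~ (12 <= i <= 21) -> T' i = T i).
Proof.
move=> Ta T0.
have Y16 := Y16A.
have [[lm [lJ [lN lW]]] [lL [lo [lS lp]]]] := par_leE par_leA.
have lA : A <= Y by have [[l1 _ _ _ _] _] := values_le; exact: leq_trans l1 lm.
have la : a <= Y by apply: leq_trans lA; rewrite EA; exact: ltnW (ltn_expl _ _).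
have lO : vOff A <= Y by lia.
have H0 := @triY_set_A Y Y16 a T Ta (T0 tA isT); rewrite -EA in H0; have {}H0 := H0 lA.
set T1 := upd T _ _ in H0.
have l16 : 16 < Y by rewrite /Y; exact: Y17A.
have l1 : 1 < Y by lia.
have l2 : 2 < Y by lia.
have H1 := @triY_prod_loops Y Y16 tP 16 [:: (tA0, a)] T1 0 isT isT (T0 tP isT) l16 (conj (conj Ta la) I).
set T2 := upd T1 _ _ in H1.
have cA : T2 tA = ctr A /\ A <= Y by [].
have H2 := @triY_prod_loops Y Y16 tM 1 (nseq 8 (tA, A)) T2 0 isT isT (T0 tM isT) l1
  (conj cA (conj cA (conj cA (conj cA (conj cA (conj cA (conj cA (conj cA I)))))))).
have EM : 0 + foldr muln 1 (map snd (nseq 8 (tA, A))) = vM A by rewrite /vM /= !expnS.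
rewrite EM in H2; set T3 := upd T2 _ _ in H2.
have cM : T3 tM = ctr (vM A) /\ vM A <= Y by [].
have H3 := @triY_prod_loops Y Y16 tJ 1 [:: (tA, A); (tM, vM A)] T3 0 isT isT (T0 tJ isT) l1
  (conj cA (conj cM I)).
rewrite /= muln1 add0n -/(vJ A) in H3; set T4 := upd T3 _ _ in H3.
have cJ : T4 tJ = ctr (vJ A) /\ vJ A <= Y by [].
have H4 := @triY_prod_loops Y Y16 tN 2 [:: (tM, vM A); (tM, vM A)] T4 0 isT isT (T0 tN isT) l2
  (conj cM (conj cM I)).
have EN : 0 + foldr muln 2 [:: vM A; vM A] = vN A by rewrite /vN /=; lia.
rewrite [map snd _]/= EN in H4; set T5 := upd T4 _ _ in H4.
have cN : T5 tN = ctr (vN A) /\ vN A <= Y by [].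
have H5 := @triY_prod_loops Y Y16 tW0 1 [:: (tN, vN A); (tN, vN A)] T5 0 isT isT (T0 tW0 isT) l1
  (conj cN (conj cN I)).
rewrite /= muln1 add0n -/(vW A) in H5; set T6 := upd T5 _ _ in H5.
have cW : T6 tW0 = ctr (vW A) /\ vW A <= Y by [].
have H6 := @triY_prod_loops Y Y16 tL 1 [:: (tA, A); (tJ, vJ A); (tW0, vW A)] T6 0 isT isT (T0 tL isT) l1
  (conj cA (conj cJ (conj cW I))).
rewrite /= muln1 add0n -/(vL A) in H6; set T7 := upd T6 _ _ in H6.
have cL : T7 tL = ctr (vL A) /\ vL A <= Y by [].
have H7 := @triY_prod_loops Y Y16 tOff 2 [:: (tL, vL A); (tM, vM A); (tM, vM A); (tJ, vJ A); (tJ, vJ A)]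
  T7 0 isT isT (T0 tOff isT) l2 (conj cL (conj cM (conj cM (conj cJ (conj cJ I))))).
have EO : 0 + foldr muln 2 [:: vL A; vM A; vM A; vJ A; vJ A] = vOff A by rewrite /vOff /=; lia.
rewrite [map snd _]/= EO in H7; set T8 := upd T7 _ _ in H7.
have cO : T8 tOff = ctr (vOff A) /\ vOff A <= Y by [].
have H8 := @triY_prod_loops Y Y16 tS 1 [:: (tA, A); (tOff, vOff A)] T8 0 isT isT (T0 tS isT) l1
  (conj cA (conj cO I)).
rewrite /= muln1 add0n -/(vS A) in H8; set T9 := upd T8 _ _ in H8.
have cS : T9 tS = ctr (vS A) /\ vS A <= Y by [].
have H9 := @triY_prod_loops Y Y16 tLen 1 [:: (tA, A); (tL, vL A); (tS, vS A)] T9 0 isT isT (T0 tLen isT) l1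
  (conj cA (conj cL (conj cS I))).
rewrite /= muln1 add0n -/(vLen A) in H9; set T10 := upd T9 _ _ in H9.
exists T10.
  exact: (triY_le _ _ _ (triY_seq Y16 H0 (triY_seq Y16 H1 (triY_seq Y16 H2 (triY_seq Y16 H3 (triY_seq Y16 H4
   (triY_seq Y16 H5 (triY_seq Y16 H6 (triY_seq Y16 H7 (triY_seq Y16 H8 H9)))))))))).
split.
  split; first by [].
  by do !split => //; rewrite -[T10 tP]/(ctr (0 + a * 16)) add0n mulnC.
move=> i ni; rewrite /T10 /T9 /T8 /T7 /T6 /T5 /T4 /T3 /T2 /T1 /upd.
by repeat (case: eqP => [Ei|_]; first by rewrite Ei in ni).
Qed.
End WithA.

(** * The initial accumulator and the whole program *)

Definition block_sum (L S : nat) := \sum_(u < S) 2 ^ (L * u).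

Lemma block_sum_lt L S : 0 < L -> block_sum L S < 2 ^ (L * S).
Proof.
move=> L0; elim: S => [|S IH]; first by rewrite /block_sum big_ord0 expn_gt0.
rewrite /block_sum big_ord_recr /= -/(block_sum L S) mulnS expnD.
have : 2 <= 2 ^ L by rewrite -{1}(expn1 2) leq_exp2l.
by move: (2 ^ L) (2 ^ (L * S)) IH => x y; nia.
Qed.

(** The product starts from the block sum instead of 1, which saves a general multiplication at the
    end. *)
Definition init_acc : cmd :=
  For tS (Act [:: (tAcc, fun=> (Bit true, Stay))] ;; For tL (moveS tAcc MoveR)) ;; rewind tAcc.

Lemma triY_init_acc Y L S T : 16 <= Y -> 0 < L -> T tL = ctr L -> T tS = ctr S -> L <= Y -> S <= Y ->
  S * L <= Y -> T tAcc = nt 0 0 -> tri 2 init_acc T (Y ^ 6) (upd T tAcc (nt 0 (block_sum L S))).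
Proof.
move=> Y16 L0 TL TS lL lS lSL TA.
have H1 : tri 2 (For tS (Act [:: (tAcc, fun=> (Bit true, Stay))] ;; For tL (moveS tAcc MoveR))) T (Y ^ 5)
    (upd T tAcc (nt (S * L) (block_sum L S))).
  apply: (@triY_for1 _ Y16 _ _ _ _ _ _ _ (fun q => nt (q * L) (block_sum L q))) => //; last first.
    by rewrite /block_sum big_ord0.
  move=> q lq; set T1 := upd T _ _.
  have D1 : tri 0 (Act [:: (tAcc, fun=> (Bit true, Stay))]) T1 1 (upd T tAcc (nt (q * L) (block_sum L q.+1))).
    apply: tri_act' => //; rewrite /acts_on /= /T1 upd_upd upd_eq /nt gtape_S -[Bit true]/(cell true).
    rewrite (@fset_cells _ (block_sum L q.+1)) //.
    have -> : bit (block_sum L q) (q * L) = false.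
      by rewrite /bit divn_small // mulnC block_sum_lt.
    by rewrite /block_sum big_ord_recr /= mul0n addn0 mul1n mulnC.
  have D2 := @triY_moveR Y Y16 tAcc tL L (q * L) (cells (block_sum L q.+1)) Sep
    (upd T tAcc (nt (q * L) (block_sum L q.+1))) isT isT erefl TL lL erefl.
  rewrite upd_upd addnC -mulSn in D2.
  exact: (triY_le _ _ _ (triY_seq Y16 (triY_act Y16 0 D1) D2)).
have := @triY_rewind Y Y16 tAcc _ _ _ isT (upd_eq T tAcc (nt (S * L) (block_sum L S))) (@cells_nosep _) lSL.
rewrite upd_upd => H2.
exact: (triY_le _ _ _ (triY_seq Y16 H1 H2)).
Qed.

Lemma shift_pos_le off m sl sm l u neg j :
  j * (j * l) + m * (j * u) <= off -> shift_pos off m sl sm l u neg j <= 2 * off.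
Proof. by move=> lo; rewrite /shift_pos /sadd; case: (_ (+) _); case: (sl); lia. Qed.

Lemma coord_sum_le off m J N W0 L sl sm l u : 2 * (J * W0) <= L ->
  (forall j, j < J -> j * (j * l) + m * (j * u) <= off) ->
  coord_sum off m J N W0 sl sm l u <= 2 ^ (L + 2 * off).
Proof.
move=> lL lo; apply: (@leq_trans (\sum_(j < J) W0 * (2 * 2 ^ (2 * off)))).
  apply: leq_sum => j _; apply: leq_mul; first exact: weight_le.
  by rewrite mul2n -addnn leq_add // leq_exp2l // shift_pos_le // lo.
rewrite sum_nat_const card_ord expnD.
have -> : J * (W0 * (2 * 2 ^ (2 * off))) = 2 * (J * W0) * 2 ^ (2 * off) by lia.
rewrite leq_mul2r; apply/orP; right; apply: leq_trans lL _; exact: ltnW (ltn_expl _ _).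
Qed.

Lemma prod_le_expn (I : Type) (s : seq I) (F : I -> nat) b e : (forall i, F i <= b ^ e) ->
  \prod_(i <- s) F i <= b ^ (size s * e).
Proof.
move=> H; elim: s => [|x s IH]; first by rewrite big_nil.
by rewrite big_cons mulSn expnD leq_mul.
Qed.

(** The coefficients are scanned twice: the first scan finds the leading digit of the largest one,
    the second multiplies the factors in. In between, eps determines all parameters. *)
Definition program alpha beta : cmd :=
  Act [:: (tOr, fun=> (Sep, MoveR)); (tAcc, fun=> (Sep, MoveR)); (tNew, fun=> (Sep, MoveR));
          (tSl, fun=> (Bit false, Stay)); (tSm, fun=> (Bit false, Stay))] ;;
  (or_pass ;; (moveS tIn MoveR ;; (Incn beta tA0 ;; (eps_pass alpha ;; (rewind_in ;;
  (set_params ;; (init_acc ;; (read ;; (main_loop ;; (transfer ;; (tau_step ;; readout))))))))))).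

Lemma cost_sum K B t ta be a Y sl y4 y6 y9 y12 y30 y31 y40 : 0 < K ->
  sl <= t * 2 + (2 * K + 1) * (B + 2) + 1 -> ta <= 5 * a -> a <= Y -> be <= Y -> K <= Y -> t <= a ->
  16 <= Y -> K * y30 <= y31 -> Y <= y31 -> 256 * y31 <= y40 ->
  y4 <= y31 -> y6 <= y31 -> y9 <= y31 -> y12 <= y31 -> y30 <= y31 ->
  1 + ((2 * K + 1) * (4 * B + 9) + 1 + (1 + (be.+1 + (ta + 1 + (sl * 2 + 5 + (y30 + (y6 + (6 * B + y9 +
    (K * (12 * B + y30) + 1 + (y4 + (y9 + y12))))))))))) <= 60 * (K * B) + y40.
Proof.
move=> K0; have : B <= K * B by rewrite leq_pmull.
have -> : (2 * K + 1) * (4 * B + 9) = 8 * (K * B) + 18 * K + 4 * B + 9 by lia.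
have -> : (2 * K + 1) * (B + 2) = 2 * (K * B) + 4 * K + B + 2 by lia.
have -> : K * (12 * B + y30) = 12 * (K * B) + K * y30 by lia.
move: (K * B) (K * y30) => kb ky; lia.
Qed.

Section Program.
Variables (alpha beta t B : nat) (cs : seq ((bool * seq bool) * (bool * seq bool))) (tau : bool * seq bool).
Variable ps : seq (bool * bool).
Let a := beta + t * alpha.
Let A := 2 ^ a.
Let Y := vY A.
Hypothesis alpha0 : 0 < alpha.
Hypothesis A4 : 4 <= A.
Hypothesis csA : size cs + 2 <= A.
Hypothesis cs0 : 0 < size cs.
Hypothesis sB : all (fun x => size x.2 == B) (nums cs tau).
Hypothesis lps : t < size ps.
Hypothesis ps0 : forall i, i < t -> (nth (false, false) ps i).1 = false.
Hypothesis pst : (nth (false, false) ps t).1.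

Definition lead_zeros :=
  find (fun i => has (fun x => nth false x.2 i) (nums cs tau)) (iota 0 B).
Let z := lead_zeros.

Definition final_value :=
  block_sum (vL A) (vS A)
  * \prod_(c <- cs) csum (vM A) (vJ A) (vN A) (vW A) (vL A) (vOff A) (16 * a) z c
  * 2 ^ sadd tau.1 (vOff A) (vM A * (vM A * rd (vL A) (16 * a) z tau)).

Definition final_thr := (size cs).+1 * vOff A.

(** Every prefix of the product must fit, since each one is the accumulator at some time; the factor
    [2 ^ (2 * vOff A)] leaves room for the constant term. *)
Lemma value_bounds k :
  block_sum (vL A) (vS A)
  * \prod_(c <- take k cs) csum (vM A) (vJ A) (vN A) (vW A) (vL A) (vOff A) (16 * a) z c
  * 2 ^ (2 * vOff A) < 2 ^ vLen A.
Proof.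
have [[M0 J0 N0 hW0 L0] [Of0 S0 n0]] := values_pos (erefl : A = 2 ^ a) A4.
have [[l1 l2 l3 l4 [l5 l6]] [l7 l8 l9 l10]] := values_le (erefl : A = 2 ^ a) A4.
have cl c : csum (vM A) (vJ A) (vN A) (vW A) (vL A) (vOff A) (16 * a) z c <= 2 ^ (vL A + 2 * vOff A).
  apply: coord_sum_le; first by rewrite /vL leq_mul2r; apply/orP; right; lia.
  by move=> j lj; exact: (off_bound (erefl : A = 2 ^ a) A4).
have H1 : \prod_(c <- take k cs) csum (vM A) (vJ A) (vN A) (vW A) (vL A) (vOff A) (16 * a) z c
    <= 2 ^ (size cs * (vL A + 2 * vOff A)).
  apply: leq_trans (prod_le_expn _ cl) _; rewrite leq_exp2l // leq_mul2r.
  by apply/orP; right; rewrite size_take; case: ltnP => // /ltnW.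
have H2 := block_sum_lt (vS A) L0.
apply: (@leq_trans (2 ^ (vL A * vS A) * 2 ^ (size cs * (vL A + 2 * vOff A)) * 2 ^ (2 * vOff A))).
  rewrite ltn_pmul2r ?expn_gt0 //; apply: leq_ltn_trans (leq_mul (leqnn _) H1) _.
  by rewrite ltn_pmul2r ?expn_gt0.
rewrite -!expnD leq_exp2l //.
have H3 : size cs * vL A <= vL A * vS A.
  rewrite mulnC leq_mul2l; apply/orP; right.
  apply: (@leq_trans A); first by lia.
  by rewrite /vS leq_pmulr.
have H4 : (size cs).+1 * vOff A <= vS A by rewrite /vS leq_mul2r; apply/orP; right; lia.
rewrite mulSn in H4.
apply: leq_trans l10; rewrite mulnDr mulnCA.
move: (vL A * vS A) (size cs * vL A) (size cs * vOff A) (vOff A) (vS A) H3 H4 l9 => x1 x2 x3 x4 x5.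
lia.
Qed.

Lemma run_program : exists2 T',
  tri 8 (program alpha beta)
    (init_tapes (flatten (map numw (nums cs tau)) ++ Sep :: flatten (map pairw ps)))
    (60 * (size cs * B) + Y ^ 40) T' &
  T' tOut = gtape Blank 0 (nth Blank (map Bit (emits final_value (final_thr + vS A * vL A) (vL A)) ++
                 Sep :: map Bit (emits final_value (vS A * vL A) (vL A)))).
Proof.
set w := flatten _ ++ _.
have EA : A = 2 ^ a by [].
have [[M0 J0 N0 hW0 L0] [Of0 S0 n0]] := values_pos (erefl : A = 2 ^ a) A4.
have [[l1 l2 l3 l4 [l5 l6]] [l7 l8 l9 l10]] := values_le (erefl : A = 2 ^ a) A4.
have Y16 : 16 <= Y := Y16A (erefl : A = 2 ^ a) A4.
have leY := par_leA EA A4.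
have [[lm [lJ [lN lW]]] [lL [lo [lS lp]]]] := par_leE leY.
have lA : A <= Y by exact: leq_trans l1 lm.
have la : a <= Y by apply: leq_trans lA; exact: ltnW (ltn_expl _ _).
have lKY : size cs <= Y by lia.
have lt_a : t <= a by rewrite /a; apply: leq_trans (leq_addl _ _); rewrite leq_pmulr.
have lta2 : t * (alpha + 4) <= 5 * a by rewrite mulnDr /a; lia.
have lSL : vS A * vL A <= Y.
  by rewrite /Y /vY mulnC; move: l10; set q := vL A * vS A; lia.
pose o := fun i => has (fun x => nth false x.2 i) (nums cs tau).
have zB : z <= B by rewrite /z /lead_zeros -{2}(size_iota 0 B) find_size.
have oz i : i < z -> o i = false.
  move=> li; have lB : i < B by exact: leq_trans li zB.
  by have := before_find 0 li; rewrite nth_iota.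
have oz1 : z < B -> o z.
  move=> lB; have hz : has o (iota 0 B) by rewrite has_find size_iota.
  by have := nth_find 0 hz; rewrite -/z nth_iota.
set T0 := init_tapes w.
have H1 : tri 0 (Act [:: (tOr, fun=> (Sep, MoveR)); (tAcc, fun=> (Sep, MoveR)); (tNew, fun=> (Sep, MoveR));
          (tSl, fun=> (Bit false, Stay)); (tSm, fun=> (Bit false, Stay))]) T0 1
   (upd (upd (upd (upd (upd T0 tSm (sgn_tape false)) tSl (sgn_tape false)) tNew (nt 0 0)) tAcc (nt 0 0)) tOr (nt 0 0)).
  apply: tri_act' => //; rewrite /acts_on /= /T0 !init_blank blank_sep blank_sgn //.
set T1 := upd _ _ _ in H1.
have TI1 : T1 tIn = ltape [::] w by [].
have H2 := @tri_or_pass B (nums cs tau) (fun=> false) [::] _ T1 sB TI1 nt0_or.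
rewrite cats0 -/o in H2; set T2 := upd _ _ _ in H2.
have H3 := @tri_ltR tIn T2 _ _ _ isT erefl; set T3 := upd _ _ _ in H3.
have H4 := @tri_Incn beta tA0 0 T3 isT (init_blank w _); rewrite add0n in H4; set T4 := upd _ _ _ in H4.
have H5 := @tri_eps_pass alpha t ps beta _ T4 lps ps0 pst erefl erefl; rewrite -/a in H5.
set l5' := rev (flatten (map pairw (take t ps))) ++ _ in H5; set T5 := upd _ _ _ in H5.
have Ed : drop t ps = nth (false, false) ps t :: drop t.+1 ps by rewrite -(drop_nth _ lps).
have TI5 : T5 tIn = ltape l5' (Bit true :: Bit (nth (false, false) ps t).2 :: flatten (map pairw (drop t.+1 ps))).
  by rewrite -[T5 tIn]/(ltape _ _) Ed /= pst.
have nb5 : all (fun s => ~~ is_blank s) l5'.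
  rewrite /l5' all_cat all_rev /=; apply/andP; split.
    by elim: (take t ps) => // p s IH; rewrite /= IH.
  rewrite all_rev; elim: (nums cs tau) => // p s IH.
  by rewrite /= all_cat /= IH andbT all_cat /= andbT all_map; apply/allP.
have H6 := tri_rewind_in nb5 (isT : ~~ is_blank (Bit true : sym)) TI5; set T6 := upd _ _ _ in H6.
have sl5 : size l5' <= t * 2 + (2 * size cs + 1) * (B + 2) + 1.
  rewrite /l5' size_cat size_rev /= size_rev.
  have -> : size (flatten (map pairw (take t ps))) = t * 2.
    have : size (take t ps) = t by rewrite size_take lps.
    move: (take t ps) => s <-; elim: s => // p s IH /=.
    by rewrite IH.
  have -> : size (flatten (map numw (nums cs tau))) = (2 * size cs + 1) * (B + 2).
    have <- : size (nums cs tau) = 2 * size cs + 1.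
      rewrite /nums size_cat /=; congr (_ + 1); elim: (cs) => //= c s ->; lia.
    elim: (nums cs tau) sB => // x s IH /= /andP[/eqP sx /IH ss].
    by rewrite size_cat ss /numw /= size_cat size_map sx /=; lia.
  by lia.
have TI6 : T6 tIn = ltape [::] w.
  rewrite -[T6 tIn]/(ltape _ _); congr (ltape _ _).
  rewrite /l5' rev_cat rev_cons !revK -catA cat_rcons /w; congr (_ ++ Sep :: _).
  have -> : flatten (map pairw ps) = flatten (map pairw (take t ps)) ++ flatten (map pairw (drop t ps)).
    by rewrite -flatten_cat -map_cat cat_take_drop.
  by rewrite Ed /= pst.
have T60 i : 12 <= i <= 21 -> T6 i = ctr 0.
  move=> /andP[i12 i21].
  have -> : T6 i = T0 i by rewrite /T6 /T5 /T4 /T3 /T2 /T1 !upd_ne //; lia.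
  have [i' ->] : exists i', i = i'.+1 by exists i.-1; lia.
  exact: init_blank.
have [T7 H7 [p7 O7]] := triY_set_params EA A4 (erefl : T6 tA0 = ctr a) T60.
have [[_ [_ [_ [_ TL7]]]] [_ [TS7 _]]] := p7.
have H8 := @triY_init_acc Y (vL A) (vS A) T7 Y16 L0 TL7 TS7 lL lS lSL (O7 tAcc isT).
set T8 := upd _ _ _ in H8.
have [h [tl [En Ew]]] : exists h tl, nums cs tau = h :: tl /\
    w = numw (h.1, h.2) ++ (flatten (map numw tl) ++ Sep :: flatten (map pairw ps)).
  rewrite /w; case E : (nums cs tau) => [|h tl].
    by move: E => /(congr1 size); rewrite /nums size_cat addn1.
  by exists h, tl; split=> //=; case: (h) => hs hb; rewrite -catA.
have shB : size h.2 = B by move: sB; rewrite En => /andP[/eqP].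
have TI8 : T8 tIn = ltape [::] (numw (h.1, h.2) ++ (flatten (map numw tl) ++ Sep :: flatten (map pairw ps))).
  by rewrite -Ew -TI6 -(O7 tIn isT).
have leLp : vL A * 2 ^ (16 * a) <= Y by apply: leq_trans (leLpA EA A4) _; lia.
have EOr : T8 tOr = gtape Sep 0 (co o) by rewrite -[LHS]/(T7 tOr) (O7 tOr isT).
have EMu : T8 tMu = ctr 0 by rewrite -[LHS]/(T7 tMu) (O7 tMu isT) -(init_blank w 25).
have ESm : T8 tSm = sgn_tape false by rewrite -[LHS]/(T7 tSm) (O7 tSm isT).
have H9 := tri_read Y16 leY leLp N0 zB oz oz1 (p7 : par _ _ _ _ _ _ _ _ _ T8) shB TI8 EOr EMu ESm.
have Eh : (h.1, h.2) = h by case: (h).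
rewrite Eh in H9; set T9 := upd _ _ _ in H9.
have r9 : ready (vM A) (vJ A) (vN A) (vW A) (vL A) (vOff A) (vS A) (vLen A) (16 * a) z o
    (block_sum (vL A) (vS A)) 0 h T9.
  split; first (split; first exact: p7).
  - by rewrite -[LHS]/(T7 tj) (O7 tj isT) -(init_blank w 21).
  - by split; [rewrite -[LHS]/(T7 tw) (O7 tw isT) -(init_blank w 22)|rewrite -[LHS]/(T7 tr) (O7 tr isT) -(init_blank w 23)].
  - by split=> //; rewrite -[LHS]/(T7 tLam) (O7 tLam isT) -(init_blank w 24).
  - by split=> //; exists false; rewrite -[LHS]/(T7 tSl) (O7 tSl isT).
  split=> //.
  - split; last by rewrite -[LHS]/(T7 tNew) (O7 tNew isT).
    by rewrite -[LHS]/(T7 tCar) (O7 tCar isT) -ctr0 -(init_blank w 30).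
  - by rewrite -[LHS]/(T7 tOut) (O7 tOut isT) -ctr0 -(init_blank w 33).
  - by rewrite -[LHS]/(T7 tThr) (O7 tThr isT) -(init_blank w 26).
have vb k : block_sum (vL A) (vS A)
  * \prod_(c <- take k cs) csum (vM A) (vJ A) (vN A) (vW A) (vL A) (vOff A) (16 * a) z c < 2 ^ vLen A.
  by apply: leq_ltn_trans (value_bounds k); rewrite leq_pmulr // expn_gt0.
have sB' : all (fun x => size x.2 == B) (h :: tl) by rewrite -En.
have [T10 H10 r10] := tri_main_loop Y16 leY leLp N0 zB oz oz1 En sB'
  (fun j x y => off_bound EA A4 z x y (j:=j)) vb r9 erefl.
have [[p10 _] _ [Tl10 TM10] [[c10 TSl10] TSm10] [[TC10 TN10] TO10 _ TA10 Tt10]] := r10.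
set V := _ * \prod_(c <- cs) _ in TA10 r10.
have lrd : rd (vL A) (16 * a) z tau <= Y.
  by apply: leq_trans leLp; rewrite leq_mul2l; apply/orP; right; apply: leq_trans (ltnW (bits_val_lt _)) _;
     rewrite leq_exp2l // size_take; case: ltnP => // /ltnW.
have H11 := triY_transfer Y16 TM10 Tl10 TSm10 TSl10 lrd; set T11 := upd _ _ _ in H11.
have lV : V < 2 ^ vLen A by have := vb (size cs); rewrite take_size.
have lV2 : V * 2 ^ sadd tau.1 (vOff A) (vM A * (vM A * rd (vL A) (16 * a) z tau)) < 2 ^ vLen A.
  apply: leq_ltn_trans (value_bounds (size cs)); rewrite take_size leq_mul2l; apply/orP; right.
  have := tau_bound EA A4 z tau; rewrite leq_exp2l // /sadd; case: (tau.1); lia.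
have H12 := @triY_tau Y _ _ _ _ _ _ _ _ _ Y16 leY _ tau.1 V (0 + size cs * vOff A) T11 p10 erefl erefl TA10 TC10 TN10 Tt10 lrd
   (tau_bound EA A4 z tau) lV lV2; set T12 := upd _ _ _ in H12.
have Eth : 0 + size cs * vOff A + vOff A = final_thr by rewrite add0n /final_thr mulSnr.
have Tt12 : T12 tThr = ctr final_thr by rewrite -Eth.
have lth : final_thr + vS A * vL A <= Y.
  have : final_thr <= vS A by rewrite /final_thr /vS leq_mul2r; apply/orP; right; lia.
  by rewrite /Y /vY mulnC; move: l9 l10; set q := vL A * vS A; lia.
have lLL : vL A + vL A + 1 <= Y.
  by move: l7 l8 lS; lia.
have [T13 H13 O13] := @triY_readout Y _ _ _ _ _ _ _ _ _ Y16 leY final_value final_thr T12 p10 erefl Tt12 TO10 lth lLL S0.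
exists T13 => //.
have D8 := fun D c T t' T' (H : tri D c T t' T') (lD : D <= 8) => tri_wk H lD (leqnn t').
apply: tri_wk (tri_seq (D8 _ _ _ _ _ H1 isT) (tri_seq (D8 _ _ _ _ _ H2 isT) (tri_seq (D8 _ _ _ _ _ H3 isT)
  (tri_seq (D8 _ _ _ _ _ H4 isT) (tri_seq (D8 _ _ _ _ _ H5 isT) (tri_seq (D8 _ _ _ _ _ H6 isT)
  (tri_seq (D8 _ _ _ _ _ H7 isT) (tri_seq (D8 _ _ _ _ _ H8 isT) (tri_seq (D8 _ _ _ _ _ H9 isT)
  (tri_seq (D8 _ _ _ _ _ H10 isT) (tri_seq (D8 _ _ _ _ _ H11 isT) (tri_seq (D8 _ _ _ _ _ H12 isT)
  (D8 _ _ _ _ _ H13 isT))))))))))))) _ _ => //.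
have sn : size (nums cs tau) = 2 * size cs + 1.
  rewrite /nums size_cat /=; congr (_ + 1); elim: (cs) => //= c s ->; lia.
rewrite sn -/Y.
have lb : beta <= Y by apply: leq_trans la; rewrite leq_addr.
have y1 : Y <= Y ^ 31 by rewrite -{1}(expn1 Y) leq_Yexp.
have yle k : k <= 31 -> Y ^ k <= Y ^ 31 by exact: leq_Yexp.
have := yle 30 isT; have := yle 6 isT; have := yle 9 isT; have := yle 4 isT; have := yle 12 isT.
have ymul : size cs * Y ^ 30 <= Y ^ 31 by rewrite [Y ^ 31]expnS leq_mul2r lKY orbT.
have y40 : 256 * Y ^ 31 <= Y ^ 40.
  have -> : Y ^ 40 = Y ^ 9 * Y ^ 31 by rewrite -expnD.
  rewrite leq_mul2r; apply/orP; right; rewrite 2!expnS mulnA.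
  by apply: leq_trans (leq_mul Y16 Y16) _; rewrite leq_pmulr // expn_gt0; lia.
move=> y12 y4 y9 y6 y30.
exact: (@cost_sum _ _ t (t * (alpha + 4)) beta a Y _ (Y ^ 4) (Y ^ 6) (Y ^ 9) (Y ^ 12) (Y ^ 30) (Y ^ 31)).
Qed.

End Program.

(** * Digits of the final product *)

(** All coefficients together stay below [2 ^ L], so no digit carries into the next: indices below
    [k] contribute less than [2 ^ (L * k)], and indices above it a multiple of
    [2 ^ L * 2 ^ (L * k)]. *)
Lemma field_sum (I : finType) (c g : I -> nat) L k : 0 < L -> \sum_x c x < 2 ^ L ->
  ((\sum_x c x * 2 ^ (L * g x)) %/ 2 ^ (L * k)) %% 2 ^ L = \sum_(x | g x == k) c x.
Proof.
move=> L0 lc.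
have cle (P : pred I) : \sum_(x | P x) c x <= \sum_x c x.
  by rewrite [X in _ <= X](bigID P) /= leq_addr.
rewrite (bigID (fun x => g x < k)) /= (bigID (fun x => g x == k) (fun x => ~~ (g x < k))) /=.
set lo := \sum_(x | g x < k) _.
have llo : lo < 2 ^ (L * k).
  case: k @lo => [|k] lo.
    by rewrite /lo big_pred0 ?expn_gt0.
  apply: (@leq_ltn_trans ((\sum_(x | g x < k.+1) c x) * 2 ^ (L * k))).
    rewrite big_distrl; apply: leq_sum => x lx; rewrite leq_mul2l; apply/orP; right.
    by rewrite leq_exp2l // leq_mul2l; apply/orP; right.
  rewrite mulnS expnD ltn_pmul2r ?expn_gt0 //.
  exact: leq_ltn_trans (cle _) lc.
have -> : \sum_(i | ~~ (g i < k) && (g i == k)) c i * 2 ^ (L * g i) = (\sum_(x | g x == k) c x) * 2 ^ (L * k).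
  rewrite big_distrl; apply: eq_big => x; first by case: eqP => [->|]; rewrite ?ltnn ?andbT ?andbF.
  by move=> /andP[_ /eqP ->].
have [hi ->] : exists hi, \sum_(i | ~~ (g i < k) && (g i != k)) c i * 2 ^ (L * g i) = hi * 2 ^ L * 2 ^ (L * k).
  exists (\sum_(i | ~~ (g i < k) && (g i != k)) c i * 2 ^ (L * (g i - k.+1))).
  rewrite -mulnA -expnD big_distrl; apply: eq_bigr => x /andP[h1 h2] /=.
  rewrite -mulnA -expnD; congr (_ * 2 ^ _); rewrite -mulnS -mulnDr; congr (_ * _); lia.
rewrite -mulnDl addnC divnMDl ?expn_gt0 // (divn_small llo) addn0 addnC modnMDl modn_small //.
exact: leq_ltn_trans (cle _) lc.
Qed.

Lemma shift_pos_scale L S0 m sl sm l u neg j :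
  shift_pos (L * S0) m sl sm (L * l) (L * u) neg j = L * shift_pos S0 m sl sm l u neg j.
Proof.
rewrite /shift_pos /sadd.
have -> : j * (j * (L * l)) = L * (j * (j * l)) by lia.
have -> : m * (j * (L * u)) = L * (m * (j * u)) by lia.
by case: (_ (+) _); case: sl; rewrite -?mulnDr -?mulnBr -?mulnDr -?mulnBr.
Qed.

Lemma sadd_scale L b x y : sadd b (L * x) (L * y) = L * sadd b x y.
Proof. by rewrite /sadd; case: b; rewrite ?mulnBr ?mulnDr. Qed.

Lemma emits_bits B n : bits B n = emits n B B.
Proof.
apply: (@eq_from_nth _ false); first by rewrite !size_map size_rev.
move=> i; rewrite size_map size_rev size_iota => li.
rewrite (nth_map 0) ?size_rev ?size_iota // nth_rev ?size_iota // nth_iota; last by lia.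
by rewrite (nth_map 0) ?size_iota // nth_iota.
Qed.

Lemma take_emits V E k p : take p (emits V E k) = emits V E (minn p k).
Proof. by rewrite /emits -map_take take_iota. Qed.

Lemma drop_emits V E k z : z <= k -> drop z (emits V E k) = emits V (E - z) (k - z).
Proof.
move=> lz; rewrite /emits -map_drop drop_iota add0n.
have -> : iota z (k - z) = [seq z + i | i <- iota 0 (k - z)] by rewrite -iotaDl addn0.
by rewrite -map_comp; apply: eq_map => i /=; congr bit; lia.
Qed.

(** The subtraction [B - z - p] is truncated: if at most [p] digits are left, the window is the
    whole number and nothing is dropped. *)
Lemma bits_val_window B n z p : z <= B -> n < 2 ^ (B - z) ->
  bits_val (take p (drop z (bits B n))) = n %/ 2 ^ (B - z - p).
Proof.
move=> lz ln; rewrite emits_bits drop_emits // take_emits bits_val_emits ?geq_minr //.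
have -> : B - z - minn p (B - z) = B - z - p by rewrite /minn; case: ltnP; lia.
rewrite modn_small // ltn_divLR ?expn_gt0 // -expnD.
by apply: leq_trans ln _; rewrite leq_exp2l // /minn; case: ltnP; lia.
Qed.

Lemma nth_bits B n i : i < B -> nth false (bits B n) i = bit n (B - i.+1).
Proof. by move=> li; rewrite emits_bits (nth_map 0) ?size_iota // nth_iota. Qed.

Lemma lead_zeros_lt B n z : z <= B -> n < 2 ^ B ->
  (forall i, i < z -> nth false (bits B n) i = false) -> n < 2 ^ (B - z).
Proof.
elim: z => [|z IH] lz ln H; first by rewrite subn0.
have {}IH : n < 2 ^ (B - z) by apply: IH => // [|i li]; [exact: ltnW|apply: H; exact: ltnW].
have := H z (ltnSn z); rewrite nth_bits // /bit.
have E : B - z = (B - z.+1).+1 by lia.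
rewrite E expnS in IH => o.
have : n %/ 2 ^ (B - z.+1) < 2 by rewrite ltn_divLR ?expn_gt0.
case: (n %/ _) (divn_eq n (2 ^ (B - z.+1))) o => [|[|]] // En _ _.
by rewrite En mul0n add0n ltn_mod expn_gt0.
Qed.

(** * The truncated quadratic and the meaning of the digits *)

Local Open Scope ring_scope.

(** Rounding is toward zero because the machine drops low digits of the absolute value and keeps the
    sign. *)
Definition hat (sh : nat) (x : int) : int :=
  if x < 0 then - (`|x| %/ 2 ^ sh)%N%:Z else (`|x| %/ 2 ^ sh)%N%:Z.

Definition signed_index J (s : bool * 'I_J) : int := if s.1 then - (s.2 : nat)%:Z else (s.2 : nat)%:Z.

(** [m^2] times the polynomial with truncated coefficients at the grid point with coordinates
    [signed_index (f i) / m]; the factor makes it an integer. *)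
Definition qhat (K J m sh : nat) (lambda mu : 'I_K -> int) (tau : int)
    (f : {ffun 'I_K -> bool * 'I_J}) : int :=
  \sum_i (hat sh (lambda i) * signed_index (f i) ^+ 2 + hat sh (mu i) * (m%:Z * signed_index (f i)))
  + hat sh tau * m%:Z ^+ 2.

Definition fweight (K J N W0 : nat) (f : {ffun 'I_K -> bool * 'I_J}) : nat :=
  (\prod_i weight N W0 (f i).2)%N.

Definition encB (B : nat) (x : int) : bool * seq bool := (x < 0, bits B `|x|%N).

Definition enc_coeffs (K B : nat) (lambda mu : 'I_K -> int) :=
  [seq (encB B (lambda i), encB B (mu i)) | i <- enum 'I_K].

Lemma encode_nums (K B : nat) (lambda mu : 'I_K -> int) (tau : int) :
  flatten [seq encode_int void B (lambda i) ++ encode_int void B (mu i) | i <- enum 'I_K]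
    ++ encode_int void B tau =
  flatten (map numw (nums (enc_coeffs B lambda mu) (encB B tau))).
Proof.
rewrite /nums map_cat flatten_cat /= cats0; congr (_ ++ _).
by rewrite /enc_coeffs -map_comp; elim: (enum 'I_K) => //= i s ->; rewrite -!catA /numw.
Qed.

Lemma intz_sadd (b : bool) (x y : nat) : (b -> y <= x)%N -> (sadd b x y)%:Z = x%:Z + (if b then - y%:Z else y%:Z).
Proof. by rewrite /sadd; case: b => [/(_ isT) lxy|_]; rewrite ?PoszD // -subzn. Qed.

Section Fields.
Variables (alpha beta t B K : nat) (lambda mu : 'I_K -> int) (tau : int).
Let a := (beta + t * alpha)%N.
Let A := (2 ^ a)%N.
Hypothesis A4 : (4 <= A)%N.
Hypothesis KA : (K + 2 <= A)%N.
Hypothesis lB : forall i, bit_integer B (lambda i).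
Hypothesis mB : forall i, bit_integer B (mu i).
Hypothesis tB : bit_integer B tau.
Let cs := enc_coeffs B lambda mu.
Let tu := encB B tau.
Let z := lead_zeros B cs tu.
Let p := (16 * a)%N.
Definition the_shift := (B - z - p)%N.
Let sh := the_shift.

Lemma mem_nums x : x \in nums cs tu ->
  (exists i, x = encB B (lambda i) \/ x = encB B (mu i)) \/ x = tu.
Proof.
rewrite /nums mem_cat => /orP[/flatten_mapP[c cin]|]; last by rewrite inE => /eqP; right.
rewrite !inE => xc; left; case/mapP: cin => i _ Ec; exists i; move: xc; rewrite Ec /=.
by case/orP => /eqP; [left|right].
Qed.

Lemma coeff_nums x : (exists i, x = lambda i \/ x = mu i) \/ x = tau -> encB B x \in nums cs tu /\ (`|x| < 2 ^ B)%N.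
Proof.
rewrite /nums mem_cat => -[[i Ex]|->]; last by rewrite inE eqxx orbT; split=> //; exact: tB.
split; last by case: Ex => ->; [exact: lB|exact: mB].
apply/orP; left; apply/flatten_mapP; exists (encB B (lambda i), encB B (mu i)).
  by apply/mapP; exists i => //; rewrite mem_enum.
by rewrite !inE; case: Ex => ->; rewrite eqxx ?orbT.
Qed.

Lemma z_le : (z <= B)%N.
Proof. by rewrite /z /lead_zeros -{2}(size_iota 0 B) find_size. Qed.

Lemma coeff_window x : (exists i, x = lambda i \/ x = mu i) \/ x = tau -> (`|x| < 2 ^ (B - z))%N.
Proof.
move=> /coeff_nums[xin lx]; apply: lead_zeros_lt => //; first exact: z_le.
move=> i li; have lB' : (i < B)%N by exact: leq_trans li z_le.
have := before_find 0%N li; rewrite nth_iota // add0n => /negbT/hasPn/(_ _ xin) /=.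
exact: negbTE.
Qed.

(** Digits are dropped only if more than [p] remain after the [z] common zeros; then column [z]
    contains a one, of weight [2 ^ (B - z - 1)]. This bounds the truncation error relative to the
    largest coefficient. *)
Lemma coeff_large : (0 < sh)%N ->
  exists2 x, (exists i, x = lambda i \/ x = mu i) \/ x = tau & (2 ^ (sh + p).-1 <= `|x|)%N.
Proof.
rewrite /sh /the_shift => sh0; have zB : (z < B)%N by lia.
have hz : has (fun i => has (fun x => nth false x.2 i) (nums cs tu)) (iota 0 B).
  by rewrite has_find size_iota.
have := nth_find 0%N hz; rewrite -/(lead_zeros B cs tu) -/z nth_iota // add0n => /hasP[y yin].
have -> : ((B - z - p + p).-1 = B - z.+1)%N by lia.
case: (mem_nums yin) => [[i [->|->]]|->] /=; rewrite nth_bits // => bz.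
- exists (lambda i); first by left; exists i; left.
  by apply: leq_trans (bit_leq _ (B - z.+1)); rewrite bz mul1n.
- exists (mu i); first by left; exists i; right.
  by apply: leq_trans (bit_leq _ (B - z.+1)); rewrite bz mul1n.
- exists tau; first by right.
  by apply: leq_trans (bit_leq _ (B - z.+1)); rewrite bz mul1n.
Qed.

Lemma rd_hat x : (exists i, x = lambda i \/ x = mu i) \/ x = tau ->
  rd (vL A) p z (encB B x) = (vL A * (`|x| %/ 2 ^ sh))%N.
Proof. by move=> /coeff_window lx; rewrite /rd /= bits_val_window // z_le. Qed.

Let m := vM A.
Let J := vJ A.
Let S0 := (2 * (m * (m * (J * J))))%N.
Let h x := (`|x| %/ 2 ^ sh)%N.

Lemma off_S0 : vOff A = (vL A * S0)%N.
Proof. by rewrite /vOff /S0 -/m -/J; lia. Qed.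

Definition cell_pos (i : 'I_K) (s : bool * 'I_J) : nat :=
  shift_pos S0 m (lambda i < 0) (mu i < 0) (h (lambda i)) (h (mu i)) s.1 s.2.
Definition tau_pos : nat := sadd (tau < 0) S0 (m * (m * h tau)).
Definition total_pos (f : {ffun 'I_K -> bool * 'I_J}) : nat := (\sum_i cell_pos i (f i) + tau_pos)%N.

Lemma hat_pos_le x y j : (exists i, x = lambda i \/ x = mu i) \/ x = tau ->
  (exists i, y = lambda i \/ y = mu i) \/ y = tau -> (j < J)%N -> (j * (j * h x) + m * (j * h y) <= S0)%N.
Proof.
move=> cx cy lj; have [[_ _ _ _ L0] _] := values_pos (erefl : A = 2 ^ a)%N A4.
have := off_bound (erefl : A = 2 ^ a)%N A4 z (encB B x) (encB B y) lj.
rewrite -/p !rd_hat // off_S0 -/m.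
have -> : (j * (j * (vL A * h x)) + m * (j * (vL A * h y)) = vL A * (j * (j * h x) + m * (j * h y)))%N by lia.
by rewrite leq_mul2l; case: (vL A) L0.
Qed.

Lemma tau_pos_le : (m * (m * h tau) <= S0)%N.
Proof.
have [[M0 J0 _ _ L0] _] := values_pos (erefl : A = 2 ^ a)%N A4.
have := tau_bound (erefl : A = 2 ^ a)%N A4 z (encB B tau).
rewrite -/p rd_hat ?off_S0 -/m; last by right.
have -> : (m * (m * (vL A * h tau)) = vL A * (m * (m * h tau)))%N by lia.
by rewrite leq_mul2l; case: (vL A) L0.
Qed.

Lemma cell_posE i s : (cell_pos i s)%:Z = S0%:Z +
  (hat sh (lambda i) * signed_index s ^+ 2 + hat sh (mu i) * (m%:Z * signed_index s)).
Proof.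
have li : (exists i', lambda i = lambda i' \/ lambda i = mu i') \/ lambda i = tau by left; exists i; left.
have mi : (exists i', mu i = lambda i' \/ mu i = mu i') \/ mu i = tau by left; exists i; right.
case: s => neg j; have lo := hat_pos_le li mi (ltn_ord j).
rewrite /cell_pos /shift_pos /= intz_sadd; last first.
  by move=> _; rewrite /sadd; case: (lambda i < 0); lia.
rewrite intz_sadd; last by move=> _; lia.
rewrite /hat /signed_index /= -/(h (lambda i)) -/(h (mu i)) !PoszM.
by case: (lambda i < 0); case: (mu i < 0); case: neg => /=; ring.
Qed.

(** Each of the [K] coordinates and the constant term carries one offset [S0], so the value 0 sits
    at [K.+1 * S0]. *)
Lemma total_posE f : (((K.+1 * S0)%N <= total_pos f)%N = (0 <= qhat m sh lambda mu tau f)).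
Proof.
rewrite -lez_nat /total_pos PoszD.
have -> : (\sum_i cell_pos i (f i))%N%:Z = K%:Z * S0%:Z +
   \sum_i (hat sh (lambda i) * signed_index (f i) ^+ 2 + hat sh (mu i) * (m%:Z * signed_index (f i))).
  rewrite (big_morph Posz PoszD (erefl : Posz 0 = 0)).
  under eq_bigr => i _ do rewrite cell_posE.
  rewrite big_split /= sumr_const card_ord; congr (_ + _).
  by rewrite -mulr_natl natz.
have -> : tau_pos%:Z = S0%:Z + hat sh tau * m%:Z ^+ 2.
  rewrite /tau_pos intz_sadd; last by move=> _; exact: tau_pos_le.
  rewrite /hat -/(h tau) !PoszM; case: (tau < 0) => /=; ring.
rewrite /qhat PoszM -natz mulrS natz -subr_ge0; congr (0 <= _); ring.
Qed.

Lemma total_pos_le f : (total_pos f <= K.+1 * (2 * S0))%N.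
Proof.
rewrite /total_pos mulSnr; apply: leq_add; last first.
  by rewrite /tau_pos /sadd; have := tau_pos_le; case: (tau < 0); lia.
apply: (@leq_trans (\sum_(i < K) 2 * S0)); last by rewrite sum_nat_const card_ord.
apply: leq_sum => i _.
apply: shift_pos_le; apply: hat_pos_le; try exact: ltn_ord.
- by left; exists i; left.
- by left; exists i; right.
Qed.

Let N := vN A.
Let W0 := vW A.

Let L := vL A.
Let S := vS A.

Lemma double_le_expn x : (0 < x -> 2 * x <= 2 ^ x)%N.
Proof. by case: x => // x _; rewrite expnS leq_mul2l /= ltn_expl. Qed.

(** This is what the choice of [vL] is for. With [X = J * W0] the total weight is at most
    [(2 X)^K <= 2 ^ (K * X)], and [S <= X^2 < 2 ^ (2 * X)]; finally [(K + 2) * X <= A * X], which is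
    [L]. *)
Lemma fweight_sum_lt : (S * \sum_(f : {ffun 'I_K -> bool * 'I_J}) fweight N W0 f < 2 ^ L)%N.
Proof.
have [[M0 J0 N0 hW0 L0] [Of0 hS0 n0]] := values_pos (erefl : A = 2 ^ a)%N A4.
set X := (J * W0)%N; have X0 : (0 < X)%N by rewrite muln_gt0 J0.
have H1 : (\sum_(f : {ffun 'I_K -> bool * 'I_J}) fweight N W0 f <= 2 ^ (K * X))%N.
  rewrite /fweight -(bigA_distr_bigA (fun _ (s : bool * 'I_J) => weight N W0 s.2)) /=.
  rewrite mulnC expnM -[in X in (_ <= X)%N](card_ord K) -prod_nat_const; apply: leq_prod => i _.
  apply: leq_trans (double_le_expn X0).
  apply: (@leq_trans (\sum_(s : bool * 'I_J) W0)); first by apply: leq_sum => s _; exact: weight_le.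
  by rewrite sum_nat_const card_prod card_bool card_ord /X mulnA.
have H2 : (S <= X * X)%N.
  rewrite /S /vS /vOff /vL -/J -/W0 -/m -/X.
  have -> : (A * (2 * (A * X * (m * (m * (J * J))))) = X * (2 * (A * (A * (m * (m * (J * J)))))))%N by lia.
  rewrite leq_mul2l; apply/orP; right; rewrite /X /W0 /vW /vN -/m.
  have -> : (2 * (A * (A * (m * (m * (J * J))))) = J * (2 * (A * (A * (m * (m * J))))))%N by lia.
  rewrite leq_mul2l; apply/orP; right; rewrite /J /vJ -/m.
  have -> : (2 * (A * (A * (m * (m * (A * m))))) = A * (A * A) * 2 * (m * m * m))%N by lia.
  have -> : (2 * (m * m) * (2 * (m * m)) = m * 4 * (m * m * m))%N by lia.
  rewrite leq_mul2r; apply/orP; right; apply: leq_mul => //.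
  by rewrite /m /vM -[(A * (A * A))%N]/(A ^ 3)%N leq_exp2l //; lia.
have H3 : (X < 2 ^ X)%N by exact: ltn_expl.
apply: (@leq_ltn_trans (X * X * 2 ^ (K * X))); first exact: leq_mul.
apply: (@leq_trans (2 ^ X * 2 ^ X * 2 ^ (K * X))).
  by rewrite ltn_pmul2r ?expn_gt0 //; apply: ltn_mul.
rewrite -!expnD leq_exp2l // /L /vL -/J -/W0 -/X.
have -> : (X + X + K * X = (K + 2) * X)%N by lia.
by rewrite leq_mul2r KA orbT.
Qed.

Lemma csumE i : csum m J N W0 L (vOff A) p z (encB B (lambda i), encB B (mu i)) =
  (\sum_(s : bool * 'I_J) weight N W0 s.2 * 2 ^ (L * cell_pos i s))%N.
Proof.
rewrite /csum /coord_sum /= !rd_hat; [|by left; exists i; right|by left; exists i; left].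
rewrite off_S0 -(pair_bigA _ (fun (b : bool) (j : 'I_J) => weight N W0 j * 2 ^ (L * cell_pos i (b, j)))%N) big_bool /= -big_split /=.
by apply: eq_bigr => j _; rewrite !shift_pos_scale mulnDr addnC.
Qed.

(** Expanding the product of sums gives one term per choice of a grid cell in each coordinate; the
    block sum adds a free summand [x.1] to the position. *)
Lemma final_valueE : final_value alpha beta t B cs tu =
  (\sum_(x : 'I_S * {ffun 'I_K -> bool * 'I_J}) fweight N W0 x.2 * 2 ^ (L * (x.1 + total_pos x.2)))%N.
Proof.
rewrite /final_value -/a -/A -/p -/m -/J -/L -/N -/W0 -/S -/z.
rewrite {1}/cs /enc_coeffs big_map big_enum /=.
under eq_bigr => i _ do rewrite csumE.
rewrite bigA_distr_bigA /= /block_sum -mulnA big_distrl /=.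
rewrite -(pair_bigA _ (fun (u : 'I_S) f => fweight N W0 f * 2 ^ (L * (u + total_pos f)))%N) /=.
apply: eq_bigr => u _; rewrite big_distrl big_distrr /=; apply: eq_bigr => f _.
rewrite big_split /= -/(fweight N W0 f) rd_hat; last by right.
have -> : (m * (m * (vL A * (`|tau| %/ 2 ^ sh))) = L * (m * (m * h tau)))%N by rewrite /L /h; lia.
rewrite off_S0 sadd_scale -/tau_pos.
have -> : (\prod_(i < K) 2 ^ (L * cell_pos i (f i)) = 2 ^ (L * \sum_i cell_pos i (f i)))%N.
  by rewrite big_distrr /= expn_sum.
by rewrite /total_pos !mulnDr !expnD -!mulnA mulnCA.
Qed.

Lemma pos_le_S f : (total_pos f < S)%N.
Proof.
have [[M0 J0 N0 hW0 L0] [Of0 hS0 n0]] := values_pos (erefl : A = 2 ^ a)%N A4.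
apply: leq_ltn_trans (total_pos_le f) _; rewrite /S /vS off_S0 -/L.
have S00 : (0 < S0)%N by have := Of0; rewrite off_S0 muln_gt0 => /andP[].
have L2 : (2 <= L)%N.
  have [[? ? ? ? [? ?]] _] := values_le (erefl : A = 2 ^ a)%N A4; lia.
apply: (@leq_trans (A * (2 * S0))); first by rewrite ltn_mul2r muln_gt0 S00 /=; lia.
by rewrite leq_mul2l leq_mul2r L2 !orbT.
Qed.

(** Multiplication by the block spreads a point at [total_pos f] over the [S] consecutive digits
    that start there. *)
Lemma value_field k : (((final_value alpha beta t B cs tu) %/ 2 ^ (L * k)) %% 2 ^ L =
  \sum_(f | (total_pos f <= k < total_pos f + S)) fweight N W0 f)%N.
Proof.
have [[M0 J0 N0 hW0 L0] _] := values_pos (erefl : A = 2 ^ a)%N A4.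
rewrite final_valueE (@field_sum ('I_S * {ffun 'I_K -> bool * 'I_J})%type (fun x => fweight N W0 x.2)
  (fun x => x.1 + total_pos x.2)%N) //; last first.
  rewrite -(pair_bigA _ (fun (u : 'I_S) f => fweight N W0 f)) /= sum_nat_const card_ord.
  exact: fweight_sum_lt.
rewrite -(pair_big_dep xpredT (fun (u : 'I_S) f => u + total_pos f == k)%N (fun (u : 'I_S) f => fweight N W0 f)) /=.
rewrite (exchange_big_dep xpredT) //= [RHS]big_mkcond /=; apply: eq_bigr => f _.
case: ifP => [/andP[l1 l2]|nk].
  have lu : (k - total_pos f < S)%N by lia.
  rewrite (big_pred1 (Ordinal lu)) // => u /=; apply/eqP/eqP => [E|->] /=; last by lia.
  by apply: val_inj => /=; lia.
by rewrite big_pred0 // => u; apply/negP => /eqP E; move: nk; rewrite -E leq_addl addnC ltn_add2l ltn_ord.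
Qed.

Lemma num_field : bits_val (emits (final_value alpha beta t B cs tu) (final_thr alpha beta t cs + S * L) L) =
  (\sum_(f : {ffun 'I_K -> bool * 'I_J} | (0 <= qhat m sh lambda mu tau f)%R) fweight N W0 f)%N.
Proof.
have [[M0 J0 N0 hW0 L0] [Of0 hS0 n0]] := values_pos (erefl : A = 2 ^ a)%N A4.
have lSL : (L <= S * L)%N by rewrite leq_pmull.
have Ethr : final_thr alpha beta t cs = (L * (K.+1 * S0))%N.
  by rewrite /final_thr -/a -/A off_S0 /cs size_map size_enum_ord -/L; lia.
rewrite bits_val_emits ?Ethr; last by lia.
(* For the digit [k = K.+1 * S0 + S - 1], the condition [k < total_pos f + S] says that the point is
   at or above the threshold; [total_pos f <= k] follows from [pos_le_S]. *)
have -> : (L * (K.+1 * S0) + S * L - L = L * (K.+1 * S0 + S.-1))%N.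
  by rewrite mulnDr -addnBA // -[in RHS](subn1 S) mulnBr muln1 [(S * L)%N]mulnC.
rewrite value_field; apply: eq_bigl => f; rewrite -total_posE.
have := pos_le_S f; move: (total_pos f) (K.+1 * S0)%N => x y; rewrite /S -/S; lia.
Qed.

Lemma den_field : bits_val (emits (final_value alpha beta t B cs tu) (S * L) L) =
  (\sum_(f : {ffun 'I_K -> bool * 'I_J}) fweight N W0 f)%N.
Proof.
have [[M0 J0 N0 hW0 L0] [Of0 hS0 n0]] := values_pos (erefl : A = 2 ^ a)%N A4.
have lSL : (L <= S * L)%N by rewrite leq_pmull.
rewrite bits_val_emits //.
have -> : (S * L - L = L * S.-1)%N by rewrite -(subn1 S) mulnBr muln1 mulnC.
rewrite value_field; apply: eq_bigl => f.
have := pos_le_S f; move: (total_pos f) => x; lia.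
Qed.

End Fields.

Local Open Scope classical_set_scope.
Local Open Scope ring_scope.

(** * One-dimensional Gaussian estimates *)

Section Gauss1.
Context {R : realType}.
Let mu := @lebesgue_measure R.
Let nu : set R -> \bar R := @normal_prob R 0 1.
Let peak : R := normal_peak 1.

Lemma peak_gt0 : 0 < peak.
Proof. exact: normal_peak_gt0. Qed.

Lemma peak_le1 : peak <= 1.
Proof.
rewrite /peak /normal_peak invf_le1 ?sqrtr_gt0 ?expr1n ?mul1r; last by rewrite mulrn_wgt0 // pi_gt0.
rewrite -[leLHS]sqrtr1 ler_wsqrtr // mulr2n.
have := pi_ge2 R; lra.
Qed.

Lemma normal_pdf01 (x : R) : normal_pdf 0 1 x = peak * expR (- (x ^+ 2 / 2)).
Proof.
rewrite normal_pdfE ?oner_neq0 // /normal_fun subr0 expr1n mulNr; congr (_ * expR (- (_ / _))).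
Qed.

Lemma measurable_npdf (D : set (measurableTypeR R)) (m : R) :
  measurable_fun D (EFin \o normal_pdf m (1 : R)).
Proof. by apply/measurable_EFinP; apply: measurable_funTS; exact: measurable_normal_pdf. Qed.

Lemma lebesgue_cc (a b : R) : a <= b -> mu `[a, b] = (b - a)%:E.
Proof.
rewrite /mu lebesgue_measure_itv /= lte_fin le_eqVlt => /predU1P[->|->]; last by rewrite EFinB.
by rewrite ltxx subrr.
Qed.

Lemma lebesgue_co (a b : R) : a <= b -> mu `[a, b[ = (b - a)%:E.
Proof.
rewrite /mu lebesgue_measure_itv /= lte_fin le_eqVlt => /predU1P[->|->]; last by rewrite EFinB.
by rewrite ltxx subrr.
Qed.

Lemma nu_le_length (V : set R) (a b : R) : measurable V -> V `<=` `[a, b] -> a <= b ->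
  (nu V <= (b - a)%:E)%E.
Proof.
move=> mV VS ab; rewrite /nu /normal_prob.
apply: (@le_trans _ _ (\int[mu]_(x in `[a, b]) (normal_pdf 0 1 x)%:E)%E).
  apply: ge0_subset_integral => //; first exact: measurable_npdf.
  by move=> x _; rewrite lee_fin normal_pdf_ge0.
apply: (@le_trans _ _ (\int[mu]_(x in `[a, b]) (cst 1%:E x))%E).
  apply: ge0_le_integral => //.
  - by move=> x _; rewrite lee_fin normal_pdf_ge0.
  - exact: measurable_npdf.
  - move=> x _; rewrite lee_fin; apply: le_trans peak_le1.
    exact: normal_pdf_ub (oner_neq0 R).
by rewrite integral_cst // mul1e [leLHS](lebesgue_cc ab).
Qed.

Lemma nu_co_bounds (a b lo hi : R) : a <= b -> 0 <= lo ->
  (forall x, a <= x < b -> lo <= normal_pdf 0 1 x <= hi) ->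
  ((lo * (b - a))%:E <= nu `[a, b[ <= (hi * (b - a))%:E)%E.
Proof.
move=> ab lo0 H; rewrite /nu /normal_prob; apply/andP; split.
  apply: (@le_trans _ _ (\int[mu]_(x in `[a, b[) (cst lo%:E x))%E).
    by rewrite integral_cst // [X in (_ * X)%E](lebesgue_co ab) EFinM.
  apply: ge0_le_integral => //; first exact: measurable_npdf.
  by move=> x /=; rewrite in_itv /= => /H /andP[l _]; rewrite lee_fin.
apply: (@le_trans _ _ (\int[mu]_(x in `[a, b[) (cst hi%:E x))%E).
  apply: ge0_le_integral => //.
  - by move=> x _; rewrite lee_fin normal_pdf_ge0.
  - exact: measurable_npdf.
  by move=> x /=; rewrite in_itv /= => /H /andP[_ l]; rewrite lee_fin.
by rewrite integral_cst // [X in (_ * X)%E](lebesgue_co ab) EFinM.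
Qed.

Lemma expRN_le_inv (x : R) : 0 < x -> expR (- x) <= x^-1.
Proof.
move=> x0; rewrite expRN lef_pV2 ?posrE ?expR_gt0 //.
by apply: le_trans (expR_ge1Dx x); lra.
Qed.

(* Comparison with the Gaussian density centred at +-T. *)
Lemma nu_tail_side (T s : R) (D : set R) : 0 < T -> s ^+ 2 = 1 -> measurable D ->
  (forall x, D x -> T <= s * x) -> (nu D <= (2 / T ^+ 2)%:E)%E.
Proof.
move=> T0 s1 mD HD; rewrite /nu /normal_prob.
have E1 : (\int[mu]_(x in D) (normal_pdf (s * T) 1 x)%:E <= 1)%E.
  have := @probability_le1 _ _ _ (normal_prob (s * T) 1 : probability _ R) D mD.
  by [].
apply: (@le_trans _ _ (\int[mu]_(x in D) ((2 / T ^+ 2)%:E * (normal_pdf (s * T) 1 x)%:E))%E); last first.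
  rewrite ge0_integralZl_EFin //.
  - by rewrite -[leRHS]mule1 lee_pmul2l ?lte_fin ?divr_gt0 ?exprn_gt0.
  - by move=> x _; rewrite lee_fin normal_pdf_ge0.
  - exact: measurable_npdf.
  - by rewrite ltW // divr_gt0 // exprn_gt0.
apply: ge0_le_integral => //.
- by move=> x _; rewrite lee_fin normal_pdf_ge0.
- exact: measurable_npdf.
- by apply: measurable_funeM; exact: measurable_npdf.
move=> x /HD Tx; rewrite -EFinM lee_fin normal_pdf01 normal_pdfE ?oner_neq0 //.
rewrite -/peak /normal_fun mulrCA ler_pM2l ?peak_gt0 //.
have e2 : expR (- (T ^+ 2 / 2)) <= 2 / T ^+ 2.
  by apply: le_trans (expRN_le_inv _) _; rewrite ?divr_gt0 ?exprn_gt0 // invf_div.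
apply: le_trans (ler_wpM2r (expR_ge0 _) e2).
rewrite -expRD ler_expR.
have -> : (x - s * T) ^+ 2 = x ^+ 2 - 2 * (s * x * T) + s ^+ 2 * T ^+ 2 by ring.
have -> : (1 : R) ^+ 2 *+ 2 = 2 by rewrite expr1n.
have : T ^+ 2 <= (s * x) * T by rewrite expr2 ler_pM2r.
rewrite s1; move: (T ^+ 2) (x ^+ 2) (s * x * T) => u v w; lra.
Qed.

Lemma nu_box (T : R) : 0 < T -> ((1 - 4 / T ^+ 2)%:E <= nu `[(- T)%R, T[)%E.
Proof.
move=> T0.
have P1 : nu setT = 1%:E by exact: (@probability_setT _ _ _ (normal_prob 0 1 : probability _ R)).
have tl1 : (nu `]-oo, (- T)%R[ <= (2 / T ^+ 2)%:E)%E.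
  apply: (@nu_tail_side T (-1)) => //; first by rewrite sqrrN expr1n.
  by move=> x /=; rewrite in_itv /=; lra.
have tl2 : (nu `[T, +oo[ <= (2 / T ^+ 2)%:E)%E.
  apply: (@nu_tail_side T 1) => //; first by rewrite expr1n.
  by move=> x /=; rewrite in_itv /= mul1r andbT.
have sub : [set: R] `<=` (`[(- T)%R, T[ `|` (`]-oo, (- T)%R[ `|` `[T, +oo[)).
  move=> x _ /=; rewrite !in_itv /=.
  case: (ltP x (- T)) => h1; first by right; left.
  by case: (ltP x T) => h2; [left|right; right].
pose nu' := (normal_prob 0 1 : probability _ R).
have : (1%:E <= nu `[(- T)%R, T[ + ((2 / T ^+ 2)%:E + (2 / T ^+ 2)%:E))%E.
  rewrite -P1; apply: (@le_trans _ _ (nu' (`[(- T)%R, T[ `|` (`]-oo, (- T)%R[ `|` `[T, +oo[)))%E).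
    by apply: le_measure => //; rewrite inE //; do 2 apply: measurableU => //.
  apply: le_trans (measureU2 _ _ _) _ => //; first by apply: measurableU.
  by apply: leeD => //; apply: le_trans (measureU2 _ _ _) _ => //; apply: leeD.
have fin : nu `[(- T)%R, T[ \is a fin_num by apply: (@fin_num_measure _ _ _ nu').
rewrite -EFinD -(fineK fin) -EFinD !lee_fin => H.
have -> : 4 / T ^+ 2 = 2 / T ^+ 2 + 2 / T ^+ 2 by field; rewrite gt_eqF.
lra.
Qed.

Lemma nuU2_le (V : set R) (a b d : R) : measurable V -> 0 <= d ->
  V `<=` `[a, a + d] `|` `[b, b + d] -> (nu V <= (2 * d)%:E)%E.
Proof.
move=> mV d0 VS; pose nu' := (normal_prob 0 1 : probability _ R).
apply: (@le_trans _ _ (nu' (`[a, (a + d)%R] `|` `[b, (b + d)%R]))).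
  by apply: le_measure => //; rewrite inE //; apply: measurableU.
apply: le_trans (measureU2 _ _ _) _ => //.
have -> : (2 * d)%:E = ((a + d - a)%:E + (b + d - b)%:E)%E by rewrite -EFinD; congr EFin; ring.
by apply: leeD; apply: nu_le_length => //; rewrite lerDl.
Qed.

(* The sublevel set of a quadratic with large leading coefficient is covered by
   two intervals obtained by completing the square. *)
Lemma quad_anticonc_lead (V : set R) (a b c t d : R) : measurable V -> a != 0 -> 0 <= t -> 0 <= d ->
  2 * t <= `|a| * d ^+ 2 ->
  (forall x, V x -> `|a * x ^+ 2 + b * x + c| <= t) -> (nu V <= (2 * d)%:E)%E.
Proof.
move=> mV a0 t0 d0 hd HV.
pose h := b / (2 * a); pose e := h ^+ 2 - c / a; pose k := t / `|a|.
(* [r] is a lower bound for [|x + h|], equal to 0 if [e - k] is negative. The upper bound is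
   [r + d], since [e + k = (e - k) + 2 k <= r^2 + d^2]. *)
pose r := Num.sqrt (Num.max 0 (e - k)).
have na0 : 0 < `|a| by rewrite normr_gt0.
have k0 : 0 <= k by rewrite divr_ge0.
have kd : 2 * k <= d ^+ 2.
  by rewrite /k mulrA ler_pdivrMr // [leRHS]mulrC.
apply: (@nuU2_le V (- h + r) (- h - r - d) d mV d0).
move=> x /HV Hx /=; rewrite !in_itv /=.
have {Hx} : `|(x + h) ^+ 2 - e| <= k.
  rewrite /k ler_pdivlMr // -normrM; apply: le_trans Hx; rewrite le_eqVlt; apply/orP; left; apply/eqP.
  by congr (`| _ |); rewrite /e /h; field.
set y := x + h => Hy.
have r0 : 0 <= r by exact: sqrtr_ge0.
have r2 : r ^+ 2 = Num.max 0 (e - k) by rewrite sqr_sqrtr // le_max lexx.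
have m1 : e - k <= r ^+ 2 by rewrite r2 le_max lexx orbT.
have m2 : r ^+ 2 = 0 \/ r ^+ 2 = e - k by rewrite r2; case: (leP 0 (e - k)); [right|left].
have [y1 y2] : e - k <= y ^+ 2 /\ y ^+ 2 <= e + k by move: Hy; rewrite ler_norml => /andP[]; split; lra.
have ry : r <= `|y|.
  rewrite -(@ler_pXn2r _ 2) ?nnegrE // -normrX ger0_norm ?sqr_ge0 //.
  by case: m2 => ->; rewrite ?sqr_ge0.
have yr : `|y| <= r + d.
  rewrite -(@ler_pXn2r _ 2) ?nnegrE // ?addr_ge0 // -normrX ger0_norm ?sqr_ge0 //.
  have : 0 <= r * d by rewrite mulr_ge0.
  move: y2 m1 kd; rewrite [(r + d) ^+ 2]sqrrD [r * d *+ 2]mulr2n.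
  move: (y ^+ 2) (r ^+ 2) (d ^+ 2) (r * d) (e : R) (k : R) => u1 u2 u3 u4 u5 u6; lra.
have -> : x = y - h by rewrite /y; ring.
case: (leP 0 y) => y0.
  rewrite ger0_norm // in ry yr; left; apply/andP; split; lra.
rewrite ltr0_norm // in ry yr; right; apply/andP; split; lra.
Qed.

(** Two values differ by [(x - x0) * (a * (x + x0) + b)], and on [-T, T] the second factor is at
    least [B / 2] in absolute value. So all points of [V] are within [4 t / B] of any chosen one. *)
Lemma quad_anticonc_lin (V : set R) (a b c t T B : R) : measurable V -> 0 < B -> 0 <= t -> 0 < T ->
  `|a| * (4 * T) <= B -> B <= `|b| ->
  (forall x, V x -> `|x| <= T /\ `|a * x ^+ 2 + b * x + c| <= t) -> (nu V <= (2 * (4 * t / B))%:E)%E.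
Proof.
move=> mV B0 t0 T0 aB bB HV.
set d := 4 * t / B; have d0 : 0 <= d by rewrite divr_ge0 ?mulr_ge0 // ltW.
have [V0|/set0P[x0 Vx0]] := eqVneq V set0.
  rewrite V0 /nu /normal_prob integral_set0 lee_fin; lra.
apply: (@nuU2_le V (x0 - d) x0 d mV d0) => x Vx /=; rewrite !in_itv /=.
have [Tx hx] := HV x Vx; have [Tx0 hx0] := HV x0 Vx0.
suff : `|x - x0| <= d.
  rewrite ler_norml => /andP[h1 h2]; case: (leP x x0) => h3; [left|right]; apply/andP; split; lra.
have E : (a * x ^+ 2 + b * x + c) - (a * x0 ^+ 2 + b * x0 + c) = (x - x0) * (a * (x + x0) + b) by ring.
have h2 : `|(x - x0) * (a * (x + x0) + b)| <= 2 * t.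
  rewrite -E; apply: le_trans (ler_normB _ _) _; lra.
have h3 : B / 2 <= `|a * (x + x0) + b|.
  have h4 : `|a * (x + x0)| <= B / 2.
    rewrite normrM; have : `|x + x0| <= 2 * T by apply: le_trans (ler_normD _ _) _; lra.
    have := normr_ge0 a; nra.
  have := ler_normB (a * (x + x0) + b) (a * (x + x0)); rewrite [X in `|X| <= _](_ : _ = b); last by ring.
  lra.
rewrite normrM in h2; rewrite /d ler_pdivlMr //.
have := normr_ge0 (x - x0); nra.
Qed.

End Gauss1.

(** * Total variation between the discretised Gaussian and the weights *)

Section Weights.
Context {R : realType}.

(** The floors do not accumulate: a step adds an error of at most 1 and contracts the earlier ones
    by [1 - 1/N], and [N] is the fixed point of [x -> (1 - 1/N) x + 1]. *)
Lemma decay_iter_bounds (N w n : nat) : (0 < N)%N ->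
  (1 - N%:R^-1) ^+ n * w%:R <= ((iter n (decay_fun N) w)%:R : R) <= (1 - N%:R^-1) ^+ n * w%:R + (N%:R : R).
Proof.
move=> N0; set r : R := 1 - N%:R^-1; have N1 : (0 : R) < N%:R by rewrite ltr0n.
have r0 : 0 <= r by rewrite subr_ge0 invf_le1 // ler1n.
have rN : r * N%:R = N%:R - 1 by rewrite mulrBl mul1r mulVf ?gt_eqF.
elim: n => [|n /andP[IH1 IH2]]; first by rewrite expr0 mul1r lexx /= lerDl ler0n.
rewrite iterS /decay_fun; set x := iter n _ w in IH1 IH2 *.
rewrite natrB ?leq_div //.
have q1 : (x %/ N)%:R * N%:R <= x%:R :> R by rewrite -natrM ler_nat leq_trunc_div.
have q2 : x%:R <= ((x %/ N)%:R + 1) * N%:R :> R.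
  by rewrite natr1 -natrM ler_nat mulSnr; have := ltn_ceil x N0; rewrite mulSnr => /ltnW.
have e1 : (x %/ N)%:R <= x%:R * N%:R^-1 :> R by rewrite ler_pdivlMr.
have e2 : x%:R * N%:R^-1 <= (x %/ N)%:R + 1 :> R by rewrite ler_pdivrMr.
have rx : r * x%:R = x%:R - x%:R * N%:R^-1 by rewrite /r; ring.
have h1 := ler_wpM2l r0 IH1; have h2 := ler_wpM2l r0 IH2.
rewrite exprS -mulrA; rewrite mulrDr rN in h2; apply/andP; split; lra.
Qed.

Lemma expR_sub_le (x y : R) : 0 <= x <= y -> expR (- x) - expR (- y) <= y - x.
Proof.
move=> /andP[x0 xy].
have -> : - y = - x + (- (y - x)) by ring.
rewrite expRD -[X in X - _]mulr1 -mulrBr.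
have h1 : expR (- x) <= 1 by rewrite -expR0 ler_expR; lra.
have h2 := expR_ge1Dx (- (y - x)).
have h3 : expR (- (y - x)) <= 1 by rewrite -expR0 ler_expR; lra.
have := expR_gt0 (- x); nra.
Qed.

Lemma pow_expR_bounds (N n : nat) : (1 < N)%N ->
  expR (- (n%:R / (N%:R - 1))) <= ((1 - N%:R^-1) ^+ n : R) <= expR (- (n%:R / (N%:R : R))).
Proof.
move=> N1; set r : R := 1 - N%:R^-1; have N0 : (1 : R) < N%:R by rewrite ltr1n.
have r0 : 0 <= r by rewrite subr_ge0 invf_le1 ?ltW // (lt_trans ltr01).
have E x : expR (- (n%:R / x)) = expR (- x^-1) ^+ n :> R by rewrite -mulrN expRM_natl.
rewrite !E; apply/andP; split; apply: lerXn2r; rewrite ?nnegrE ?expR_ge0 //.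
  have h := expR_ge1Dx ((N%:R - 1)^-1 : R).
  rewrite expRN; apply: le_trans (_ : (1 + (N%:R - 1)^-1)^-1 <= _).
    rewrite lef_pV2 ?posrE ?expR_gt0 // ?addr_gt0 // ?invr_gt0; lra.
  rewrite le_eqVlt; apply/orP; left; apply/eqP; rewrite /r; field.
  by repeat (apply/andP; split); apply/eqP; lra.
by apply: le_trans (expR_ge1Dx _); rewrite /r.
Qed.

(** [k] stands for the normalising constant, which the algorithm does not know. Comparing the two
    sums shows that [k W] is within [rho + tl] of 1, so dividing by [W] is nearly the same as
    multiplying by [k]. *)
Lemma normalize_tv (I : finType) (p w : I -> R) (k rho tl : R) :
  (forall s, 0 <= w s) -> 0 < \sum_s w s -> \sum_s `|p s - k * w s| <= rho ->
  1 - tl <= \sum_s p s <= 1 ->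
  \sum_s `|p s - w s / \sum_u w u| <= 2 * rho + tl.
Proof.
move=> w0 W0 hr /andP[p1 p2]; set W := \sum_u w u in W0 *.
apply: (@le_trans _ _ (\sum_s `|p s - k * w s| + \sum_s w s / W * `|k * W - 1|)).
  rewrite -big_split; apply: ler_sum => s _ /=.
  have -> : p s - w s / W = (p s - k * w s) + w s / W * (k * W - 1) by field; rewrite gt_eqF.
  apply: le_trans (ler_normD _ _) _; rewrite lerD2l normrM ger0_norm //.
  by rewrite divr_ge0 // ltW.
rewrite -mulr_suml -mulr_suml divff ?gt_eqF // mul1r.
have h : `|\sum_s p s - k * W| <= rho.
  apply: le_trans hr; rewrite /W mulr_sumr -sumrB; exact: ler_norm_sum.
have : `|k * W - 1| <= rho + tl.
  move: h; rewrite !ler_norml => /andP[h1 h2]; apply/andP; split; lra.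
lra.
Qed.

(** Hybrid argument: the factors are exchanged one at a time, so the i-th difference has factors [b]
    before [i] and [a] after it. *)
Lemma prod_telescope_le (n : nat) (a b : 'I_n -> R) :
  (forall i, 0 <= a i) -> (forall i, 0 <= b i) ->
  `|\prod_i a i - \prod_i b i| <=
    \sum_(i < n) \prod_(k < n) (if (k < i)%N then b k else if k == i then `|a k - b k| else a k).
Proof.
elim: n a b => [|n IH] a b a0 b0; first by rewrite !big_ord0 subrr normr0.
rewrite !big_ord_recr /=; set Pa := \prod_(i < n) a _; set Pb := \prod_(i < n) b _.
set wd := widen_ord _; set am := a ord_max; set bm := b ord_max.
have Pb0 : 0 <= Pb by apply: prodr_ge0.
have -> : Pa * am - Pb * bm = (Pa - Pb) * am + Pb * (am - bm) by ring.
apply: le_trans (ler_normD _ _) _; rewrite !normrM (ger0_norm (a0 _ : 0 <= am)) (ger0_norm Pb0).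
apply: lerD; last first.
  rewrite ltnn eqxx; apply: ler_wpM2r => //.
  by apply: ler_prod => i _; rewrite ltn_ord b0 lexx.
have := IH (fun i => a (wd i)) (fun i => b (wd i)) (fun i => a0 _) (fun i => b0 _).
move=> /(ler_wpM2r (a0 ord_max)) /le_trans; apply; rewrite mulr_suml; apply: ler_sum => i _.
rewrite big_ord_recr /= ltnNge ltnW ?ltn_ord //=.
rewrite ifN_eqC; last by rewrite -val_eqE /= neq_ltn ltn_ord.
exact: ler_wpM2r.
Qed.

(** In each hybrid the factors other than the exchanged one sum to at most 1. Sub-probabilities are
    allowed because the cells leave out the Gaussian tails. *)
Lemma prod_tv (n : nat) (I : finType) (p q : I -> R) (Q : pred {ffun 'I_n -> I}) (tv : R) :
  (forall s, 0 <= p s) -> (forall s, 0 <= q s) -> \sum_s p s <= 1 -> \sum_s q s <= 1 ->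
  \sum_s `|p s - q s| <= tv ->
  `|\sum_(f | Q f) \prod_i p (f i) - \sum_(f | Q f) \prod_i q (f i)| <= n%:R * tv.
Proof.
move=> p0 q0 p1 q1 htv; rewrite -sumrB.
apply: le_trans (ler_norm_sum _ _ _) _.
apply: (@le_trans _ _ (\sum_(f : {ffun 'I_n -> I}) `|\prod_i p (f i) - \prod_i q (f i)|)).
  by rewrite [leRHS](bigID Q) /= lerDl sumr_ge0.
pose F (i k : 'I_n) s := if (k < i)%N then q s else if k == i then `|p s - q s| else p s.
apply: (@le_trans _ _ (\sum_(f : {ffun 'I_n -> I}) \sum_(i < n) \prod_(k < n) F i k (f k))).
  by apply: ler_sum => f _; exact: prod_telescope_le.
rewrite exchange_big /=.
have -> : n%:R * tv = \sum_(i < n) tv by rewrite sumr_const card_ord mulr_natl.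
apply: ler_sum => i _; rewrite -(bigA_distr_bigA (F i)) /= (bigD1 i) //=.
have F0 k s : 0 <= F i k s by rewrite /F; case: ifP => // _; case: ifP.
have E1 : \sum_s F i i s <= tv.
  by apply: le_trans htv; apply: ler_sum => s _; rewrite /F ltnn eqxx.
have E2 : \prod_(k < n | k != i) \sum_s F i k s <= 1.
  apply: prodr_ile1 => k ki; rewrite sumr_ge0 //=.
  by rewrite /F (negbTE ki); case: (k < i)%N.
have : 0 <= \sum_s F i i s by rewrite sumr_ge0.
have : 0 <= \prod_(k < n | k != i) \sum_s F i k s by apply: prodr_ge0 => k _; rewrite sumr_ge0.
nra.
Qed.

End Weights.

(** * Gaussian probability of a grid cell against its weight *)

Section Cells.
Context {R : realType}.
Variable A : nat.
Hypothesis A4 : (4 <= A)%N.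
Let m := vM A.
Let J := vJ A.
Let N := vN A.
Let W0 := vW A.
Let nu : set R -> \bar R := @normal_prob R 0 1.
Let peak : R := normal_peak 1.

Definition cell_set (s : bool * 'I_J) : set R :=
  if s.1 then [set` `[(- (s.2.+1%:R / m%:R)), (- (s.2%:R / m%:R))[%R]
  else [set` `[(s.2%:R / m%:R), (s.2.+1%:R / m%:R)[%R].

Definition cell_prob (s : bool * 'I_J) : R := fine (nu (cell_set s)).

Lemma measurable_cell s : measurable (cell_set s).
Proof. by rewrite /cell_set; case: s.1. Qed.

Lemma nu_cell s : nu (cell_set s) = (cell_prob s)%:E.
Proof.
rewrite /cell_prob fineK //; apply: (@fin_num_measure _ _ _ (normal_prob 0 1 : probability _ R)).
exact: measurable_cell.
Qed.

Let m0 : (0 : R) < m%:R.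
Proof. by rewrite ltr0n /m /vM expn_gt0; case: A A4. Qed.

Let g (j : nat) : R := expR (- ((j * j)%:R / N%:R)).

Let NE : N%:R = 2 * m%:R ^+ 2 :> R.
Proof. by rewrite /N /vN !natrM expr2. Qed.

(** The density decreases in [|x|], so on a cell it lies between its values at the two ends, which
    are [peak * g] because [N = 2 m^2]. *)
Lemma cell_prob_bounds (s : bool * 'I_J) : peak / m%:R * g s.2.+1 <= cell_prob s <= peak / m%:R * g s.2.
Proof.
have pk := @peak_gt0 R; have mn := m0.
have H (a b : R) (j : nat) : b - a = m%:R^-1 ->
    (forall x, a <= x < b -> (j%:R / m%:R) ^+ 2 <= x ^+ 2 <= (j.+1%:R / m%:R) ^+ 2) ->
    ((peak / m%:R * g j.+1)%:E <= nu `[a, b[ <= (peak / m%:R * g j)%:E)%E.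
  move=> ab hx; have lab : a <= b by have : 0 < m%:R^-1 :> R by [rewrite invr_gt0]; lra.
  have := @nu_co_bounds R a b (peak * g j.+1) (peak * g j) lab.
  rewrite ab mulrAC [peak * g j * _]mulrAC; apply; first by rewrite mulr_ge0 ?expR_ge0 // ltW.
  move=> x /hx /andP[h1 h2]; rewrite normal_pdf01 -/peak !ler_pM2l // !ler_expR.
  have E k : (k * k)%:R / N%:R = (k%:R / m%:R) ^+ 2 / 2 :> R.
    by rewrite NE natrM; field; rewrite gt_eqF.
  by rewrite !E; apply/andP; split; lra.
have j1 : s.2.+1%:R = s.2%:R + 1 :> R by rewrite -natr1.
have j0 : 0 <= s.2%:R / m%:R :> R by rewrite divr_ge0 // ltW.
have jm : s.2.+1%:R / m%:R = s.2%:R / m%:R + m%:R^-1 :> R by rewrite j1 mulrDl mul1r.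
have mi : 0 < m%:R^-1 :> R by rewrite invr_gt0.
suff : ((peak / m%:R * g s.2.+1)%:E <= nu (cell_set s) <= (peak / m%:R * g s.2)%:E)%E.
  by rewrite nu_cell !lee_fin.
rewrite /cell_set; case: (s.1); apply: H; rewrite ?jm; try by ring.
- move=> x /andP[h1 h2]; apply/andP; split; nra.
- move=> x /andP[h1 h2]; apply/andP; split; nra.
Qed.

(** Three errors, each relative to [peak / m]: the variation [(2 j + 1) / N] of the density over the
    cell, the rounding [1/N] of the weight, and at most [j^2 / (N (N - 1))] from replacing the
    exponential by the power. As [j < A m], their combination is at most [A / m]. *)
Lemma cell_weight_close (s : bool * 'I_J) :
  `|cell_prob s - peak / m%:R / W0%:R * (weight N W0 s.2)%:R| <= A%:R / m%:R ^+ 2.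
Proof.
have pk := @peak_gt0 R; have pk1 := @peak_le1 R; have mn := m0.
have A0 : (0 : R) < A%:R by rewrite ltr0n; lia.
have Am : A%:R <= m%:R :> R.
  by rewrite ler_nat /m /vM expnS leq_pmulr // expn_gt0; case: A A4.
have m1 : (1 : R) <= m%:R by rewrite ler1n; move: m0; rewrite ltr0n.
have N1 : (1 < N)%N by rewrite -(ltr1n R) NE; nra.
have N0 : (0 < N)%N by exact: ltnW.
have N0r : (0 : R) < N%:R by rewrite ltr0n.
have W0E : W0%:R = N%:R ^+ 2 :> R by rewrite /W0 /vW natrM expr2.
set j : nat := s.2; have jJ : j%:R + 1 <= A%:R * m%:R :> R.
  by rewrite natr1 -natrM ler_nat; exact: ltn_ord.
have /andP[p1 p2] := cell_prob_bounds s; rewrite -/j in p1 p2.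
have /andP[u1 u2] := @decay_iter_bounds R N W0 (j * j) N0; rewrite -/(weight N W0 j) in u1 u2.
have /andP[r1 r2] := @pow_expR_bounds R N (j * j) N1.
set r := (1 - N%:R^-1) ^+ (j * j) in u1 u2 r1 r2.
set u := (weight N W0 j)%:R / W0%:R : R.
have W0r : (0 : R) < W0%:R by rewrite W0E exprn_gt0.
have u1' : r <= u by rewrite /u ler_pdivlMr.
have u2' : u <= r + N%:R^-1.
  rewrite /u ler_pdivrMr // mulrDl; apply: le_trans u2 _; rewrite lerD2l W0E expr2 mulrA mulVf ?mul1r ?gt_eqF //.
have j0 : 0 <= j%:R :> R by [].
have g1 : g j - g j.+1 <= (2 * j%:R + 1) / N%:R.
  have := @expR_sub_le R ((j * j)%:R / N%:R) ((j.+1 * j.+1)%:R / N%:R).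
  have -> : (j.+1 * j.+1)%:R / N%:R - (j * j)%:R / N%:R = (2 * j%:R + 1) / N%:R :> R.
    by rewrite -mulrBl !natrM -natr1; congr (_ / _); ring.
  apply; rewrite divr_ge0 //= ?ler_pM2r ?invr_gt0 // ler_nat leq_mul //.
have r1' : g j - r <= A%:R / m%:R.
  have := @expR_sub_le R ((j * j)%:R / N%:R) ((j * j)%:R / (N%:R - 1)).
  have Nm1 : 0 < N%:R - 1 :> R by rewrite NE; nra.
  have E : (j * j)%:R / (N%:R - 1) - (j * j)%:R / N%:R = (j * j)%:R / (N%:R * (N%:R - 1)) :> R.
    by field; apply/andP; split; rewrite gt_eqF.
  rewrite E => /(_ _) h; have : g j - expR (- ((j * j)%:R / (N%:R - 1))) <= (j * j)%:R / (N%:R * (N%:R - 1)).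
    apply: h; rewrite divr_ge0 //=; by rewrite -subr_ge0 E divr_ge0 // mulr_ge0 // ltW.
  have : (j * j)%:R / (N%:R * (N%:R - 1)) <= A%:R / m%:R :> R.
    rewrite ler_pdivrMr ?mulr_gt0 // mulrAC ler_pdivlMr //.
    have jj : (j * j)%:R <= (A%:R * m%:R) ^+ 2 :> R by rewrite natrM expr2; apply: ler_pM => //; lra.
    apply: (@le_trans _ _ ((A%:R * m%:R) ^+ 2 * m%:R)); first by rewrite ler_pM2r.
    have -> : (A%:R * m%:R) ^+ 2 * m%:R = A%:R * (A%:R * m%:R ^+ 3) :> R by ring.
    rewrite ler_pM2l //; apply: (@le_trans _ _ (m%:R * m%:R ^+ 3)); first by rewrite ler_pM2r ?exprn_gt0.
    rewrite NE; have -> : m%:R * m%:R ^+ 3 = m%:R ^+ 2 * m%:R ^+ 2 :> R by ring.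
    have : 1 <= m%:R ^+ 2 :> R by rewrite expr_ge1.
    by move: (m%:R ^+ 2) => y; nra.
  by move: r1; lra.
have d2 : (2 * j%:R + 1) / N%:R + N%:R^-1 <= A%:R / m%:R :> R.
  rewrite -[X in _ + X]mul1r -mulrDl ler_pdivrMr // NE.
  have -> : A%:R / m%:R * (2 * m%:R ^+ 2) = 2 * (A%:R * m%:R) :> R by field; rewrite gt_eqF.
  lra.
have -> : peak / m%:R / W0%:R * (weight N W0 j)%:R = peak / m%:R * u.
  by rewrite /u; field; rewrite !gt_eqF.
have c0 : 0 <= peak / m%:R by rewrite divr_ge0 ?ltW.
have cA : peak / m%:R * (A%:R / m%:R) <= A%:R / m%:R ^+ 2.
  have -> : peak / m%:R * (A%:R / m%:R) = peak * (A%:R / m%:R ^+ 2) by field; rewrite gt_eqF.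
  by rewrite ler_piMl // divr_ge0 // ?ltW // exprn_gt0.
have h1 : peak / m%:R * (g j - u) <= peak / m%:R * (A%:R / m%:R) by apply: ler_wpM2l => //; lra.
have h2 : peak / m%:R * (u - g j.+1) <= peak / m%:R * (A%:R / m%:R).
  by apply: ler_wpM2l => //; move: r2; rewrite -/(g j); lra.
rewrite !mulrBr in h1 h2; rewrite ler_norml; apply/andP; split; lra.
Qed.

End Cells.

(** * The Gaussian measure of the sign set *)

Section ProductBounds.
Context d1 d2 (T1 : measurableType d1) (T2 : measurableType d2) (R : realType).
Variables (m1 : probability T1 R) (m2 : probability T2 R).

Lemma integral_prob_le d (T' : measurableType d) (m : probability T' R) (f : T' -> \bar R) (e : R) :
  measurable_fun setT f -> (forall x, 0 <= f x)%E -> (forall x, f x <= e%:E)%E -> (\int[m]_x f x <= e%:E)%E.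
Proof.
move=> mf f0 fe.
apply: (@le_trans _ _ (\int[m]_x (cst e%:E x))%E).
  by apply: ge0_le_integral.
by rewrite integral_cst // [X in (_ * X)%E](_ : _ = 1%E) ?mule1 //; exact: probability_setT.
Qed.

Lemma prod_xsection_le (A : set (T1 * T2)) (e : R) : measurable A ->
  (forall x, m2 (xsection A x) <= e%:E)%E -> ((m1 \x m2)%E A <= e%:E)%E.
Proof.
move=> mA H; apply: integral_prob_le => //.
exact: measurable_fun_xsection.
Qed.

Lemma prod_ysection_le (A : set (T1 * T2)) (e : R) : measurable A ->
  (forall y, m1 (ysection A y) <= e%:E)%E -> ((m1 \x m2)%E A <= e%:E)%E.
Proof.
move=> mA H.
(* The product measure integrates over the first factor; uniqueness of the product measure allows
   the other order. *)
have -> : (m1 \x m2)%E A = (m1 \x^ m2)%E A.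
  by apply: (@product_measure_unique _ _ _ _ _ _ _ (m1 \x^ m2)%E) => // A1 A2 mA1 mA2; exact: product_measure2E.
apply: integral_prob_le => //.
exact: measurable_fun_ysection.
Qed.

End ProductBounds.

Lemma measure_big_disjoint d (T : measurableType d) (R : realType) (mu : {measure set T -> \bar R})
    (I : choiceType) (F : I -> set T) (s : seq I) : uniq s -> (forall i, measurable (F i)) ->
  (forall i j, i != j -> F i `&` F j = set0) ->
  mu (\big[setU/set0]_(i <- s) F i) = (\sum_(i <- s) mu (F i))%E.
Proof.
move=> + mF dF; elim: s => [|x s IH] /=; first by rewrite !big_nil measure0.
move=> /andP[xs us]; have mS : measurable (\big[setU/set0]_(i <- s) F i).
  by apply: bigsetU_measurable => i _; exact: mF.
have dS : F x `&` \big[setU/set0]_(i <- s) F i = set0.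
  rewrite -bigcup_seq; apply/seteqP; split=> // y [Fx [j /= js Fj]].
  have nxj : x != j by apply/eqP => E; rewrite E js in xs.
  by have : (F x `&` F j) y by []; rewrite dF.
by rewrite !big_cons -(IH us); apply: measureU.
Qed.

(** * Anticoncentration of a quadratic in several variables *)

Section QuadTuple.
Context {R : realType}.
Local Notation T := (measurableTypeR R).

(** The constant is real, unlike in [quadratic], because fixing a coordinate moves its terms into
    the constant. *)
Definition quadr n (a b : 'I_n -> R) (c : R) (y : n.-tuple T) : R :=
  \sum_(i < n) (a i * tnth y i ^+ 2 + b i * tnth y i) + c.

Lemma measurable_quadr n (a b : 'I_n -> R) c : measurable_fun setT (quadr a b c).
Proof.
apply: measurable_funD => //; apply: measurable_sum => i.
have mt : measurable_fun setT (fun y : n.-tuple T => tnth y i : R) by exact: measurable_tnth.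
apply: measurable_funD; first by apply: measurable_funM => //; exact: measurable_funX.
exact: measurable_funM.
Qed.

(** The points where an error up to [t] may flip the sign. The restriction to a box is what the
    linear case of anticoncentration needs. *)
Definition small_set n (a b : 'I_n -> R) (c t S : R) : set (n.-tuple T) :=
  [set y | (forall i, `|tnth y i| <= S) /\ `|quadr a b c y| <= t].

Lemma measurable_norm_le n (f : n.-tuple T -> R) t : measurable_fun setT f ->
  measurable [set y | `|f y| <= t].
Proof.
move=> mf; have -> : [set y | `|f y| <= t] = setT `&` (f @^-1` `[(- t), t]).
  by apply/seteqP; split=> y /=; rewrite in_itv /= ler_norml // => -[].
exact: mf.
Qed.

Lemma measurable_small_set n (a b : 'I_n -> R) c t S : measurable (small_set a b c t S).
Proof.
have -> : small_set a b c t S = [set y | forall i, [set x : T | `|x| <= S] (tnth y i)] `&` [set y | `|quadr a b c y| <= t].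
  by apply/seteqP; split=> y /=.
apply: measurableI; last by apply: measurable_norm_le; exact: measurable_quadr.
apply: (@measurable_box R n (fun=> [set x : T | `|x| <= S])) => i.
have -> : [set x : T | `|x| <= S] = `[(- S), S]%classic :> set R.
  by apply/seteqP; split=> y /=; rewrite in_itv /= ler_norml.
exact: measurable_itv.
Qed.

(* One coordinate with a large coefficient suffices, by Fubini. *)
Lemma small_set_le n (a b : 'I_n -> R) c t S (e : R) (i0 : 'I_n) :
  (forall c' (V : set T), measurable V ->
    (forall x, V x -> `|x| <= S /\ `|a i0 * x ^+ 2 + b i0 * x + c'| <= t) ->
    (normal_prob 0 1 V <= e%:E)%E) ->
  (std_gaussian n (small_set a b c t S) <= e%:E)%E.
Proof.
elim: n a b c i0 => [a b c []//|n IH] a b c i0 H /=.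
rewrite /distribution /pushforward /=.
set X := _ @^-1` _; have mX : measurable X.
  by rewrite -[X]setTI; apply: measurable_tuple_cons => //; exact: measurable_small_set.
have qE x (y : n.-tuple T) : quadr a b c (tuple_cons (x, y)) =
    quadr (fun i => a (lift ord0 i)) (fun i => b (lift ord0 i)) (a ord0 * x ^+ 2 + b ord0 * x + c) y.
  rewrite /quadr big_ord_recl.
  have -> : tnth (tuple_cons (x, y)) ord0 = x by rewrite (tnth_nth x).
  under eq_bigr => i _ do rewrite tnthS.
  set u := \sum_(i < n) _; ring.
(* If [i0] is not the first coordinate, the first one is fixed and induction applies; otherwise all
   the others are fixed. *)
have [j E|E] := unliftP ord0 i0.
  apply: prod_xsection_le => // x.
  apply: (@le_trans _ _ (std_gaussian n (small_set (fun i => a (lift ord0 i)) (fun i => b (lift ord0 i))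
       (a ord0 * x ^+ 2 + b ord0 * x + c) t S))).
    apply: le_measure; rewrite ?inE; [exact: measurable_xsection|exact: measurable_small_set|].
    move=> y; rewrite /xsection /= inE => -[h1 h2]; split; last by rewrite -qE.
    by move=> i; have := h1 (lift ord0 i); rewrite tnthS.
  apply: (IH _ _ _ j) => c' V mV HV; apply: (H c') => // x' /HV; rewrite E.
  by [].
apply: prod_ysection_le => // y.
pose c' := \sum_(i < n) (a (lift ord0 i) * tnth y i ^+ 2 + b (lift ord0 i) * tnth y i) + c.
apply: (H c'); first exact: measurable_ysection.
move=> x; rewrite /ysection /= inE => -[h1 h2]; rewrite E; split.
  by have := h1 ord0; rewrite (tnth_nth x).
move: h2; rewrite qE /quadr /c'; congr (`| _ | <= _); ring.
Qed.

End QuadTuple.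

(** * Accuracy of the discretised and truncated sign probability *)

Section Approx.
Context {R : realType}.
Variables (K a A sh : nat) (lambda mu : 'I_K -> int) (tau : int).
Hypothesis EA : A = (2 ^ a)%N.
Hypothesis A4 : (4 <= A)%N.
Hypothesis KA : (K + 2 <= A)%N.
Hypothesis K0 : (0 < K)%N.
Let m := vM A.
Let J := vJ A.
Let N := vN A.
Let W0 := vW A.
Let isc (x : int) := (exists i, x = lambda i \/ x = mu i) \/ x = tau.
Hypothesis large : (0 < sh)%N -> exists2 x, isc x & (2 ^ (sh + 16 * a).-1 <= `|x|)%N.
Local Notation T := (measurableTypeR R).
Let nu : set R -> \bar R := @normal_prob R 0 1.
Let cset := @cell_set R A.
Let cprob := @cell_prob R A.
Let Ar : R := A%:R.
Let Kr : R := K%:R.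
Let mr : R := m%:R.

Let Ar4 : 4 <= Ar. Proof. by rewrite (ler_nat R 4 A). Qed.
Let mE : mr = Ar ^+ 8. Proof. by rewrite /mr /m /vM natrX. Qed.
Let mr0 : 0 < mr. Proof. by rewrite mE exprn_gt0 //; have := Ar4; lra. Qed.
Let Kr1 : 1 <= Kr. Proof. by rewrite ler1n. Qed.
Let KrA : Kr <= Ar. Proof. by rewrite ler_nat; lia. Qed.
Let Am : Ar <= mr.
Proof. by rewrite mE exprS ler_peMr ?exprn_ege1 //; have := Ar4; lra. Qed.
Let JE : J%:R = Ar * mr :> R. Proof. by rewrite natrM. Qed.

Definition max_coeff : nat := maxn (\max_i maxn `|lambda i| `|mu i|) `|tau|%N.
Let M : R := max_coeff%:R.

Lemma max_coeff_ge x : isc x -> (`|x| <= max_coeff)%N.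
Proof.
move=> [[i Ex]|->]; last exact: leq_maxr.
apply: leq_trans (leq_maxl _ _); apply: leq_trans (leq_bigmax i).
by case: Ex => ->; rewrite ?leq_maxl ?leq_maxr.
Qed.

Lemma max_coeff_att : (exists i, max_coeff = maxn `|lambda i| `|mu i|) \/ max_coeff = `|tau|%N.
Proof.
rewrite /max_coeff; set X := (\max_i _)%N.
have [i Xi] : exists i, X = maxn `|lambda i| `|mu i|.
  by have [|i Xi] := @bigop.eq_bigmax _ (fun i => maxn `|lambda i| `|mu i|); [rewrite card_ord|exists i].
by case: (leqP X `|tau|) => h; [right|left; exists i].
Qed.

Lemma coeff_le x : isc x -> `|x%:~R| <= M :> R.
Proof. by move=> /max_coeff_ge lx; rewrite -intr_norm -abszE -pmulrn ler_nat. Qed.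

(** The dropped part is below [2 ^ sh], and [2 ^ sh * m^2 = 2 ^ (sh + 16 a)] is at most twice the
    largest coefficient by [large]; if [sh = 0] nothing is dropped. *)
Lemma trunc_error x : isc x -> `|x%:~R - 2 ^+ sh * (hat sh x)%:~R| * mr ^+ 2 <= 2 * M :> R.
Proof.
move=> cx; set q := (`|x| %/ 2 ^ sh)%N; set r := (`|x| %% 2 ^ sh)%N.
have Ex : `|x|%:R = q%:R * 2 ^+ sh + r%:R :> R by rewrite -natrX -natrM -natrD -divn_eq.
have -> : `|x%:~R - 2 ^+ sh * (hat sh x)%:~R| = r%:R :> R.
  rewrite /hat -/q; have xE : x%:~R = (if x < 0 then - `|x|%:R else `|x|%:R) :> R.
    case: (ltP x 0) => hx; first by rewrite -{1}[x]opprK -(ltz0_abs hx) rmorphN.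
    by rewrite -{1}(gez0_abs hx).
  rewrite xE Ex; case: (x < 0).
    rewrite rmorphN /= (_ : _ - _ = - r%:R); first by rewrite normrN ger0_norm.
    by ring.
  rewrite (_ : _ - _ = r%:R); first by rewrite ger0_norm.
  by ring.
rewrite -natrX -natrM -natrM ler_nat.
have m2 : (m ^ 2 = 2 ^ (16 * a))%N by rewrite /m /vM EA -!expnM; congr expn; lia.
case: (posnP sh) => [s0|/large[y cy ly]].
  by rewrite /r s0 modn1 mul0n.
have rl : (r < 2 ^ sh)%N by rewrite ltn_mod expn_gt0.
apply: (@leq_trans (2 ^ sh * 2 ^ (16 * a))); first by rewrite m2 leq_mul2r (ltnW rl) orbT.
have := leq_trans ly (max_coeff_ge cy); rewrite -expnD.
case: (sh + 16 * a)%N => [|k] /= h; first by rewrite expn0; move: h; rewrite expn0; lia.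
by rewrite expnS leq_mul2l h orbT.
Qed.

Let yhat (s : bool * 'I_J) : R := (signed_index s)%:~R / mr.

Lemma cell_facts s x : cset s x -> [/\ `|x| <= Ar, `|yhat s| <= Ar & `|x - yhat s| <= mr^-1].
Proof.
have j1 : s.2.+1%:R / mr <= Ar by rewrite ler_pdivrMr // -JE ler_nat ltn_ord.
have j0 : 0 <= s.2%:R / mr by rewrite divr_ge0 // ltW.
have jS : s.2.+1%:R / mr = s.2%:R / mr + mr^-1 by rewrite -natr1 mulrDl mul1r.
have mi : 0 < mr^-1 by rewrite invr_gt0.
rewrite /cset /cell_set /yhat /signed_index; case: s j1 j0 jS => [[] j] /= j1 j0 jS;
  rewrite in_itv /= -/m -/mr => /andP[h1 h2].
  rewrite mulrNz mulNr -pmulrn opprK; split; rewrite ler_norml; apply/andP; split; lra.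
rewrite -pmulrn; split; rewrite ler_norml; apply/andP; split; lra.
Qed.

Lemma cell_cover x : - Ar <= x < Ar -> exists s, cset s x.
Proof.
move=> /andP[x1 x2]; rewrite /cset /cell_set.
case: (leP 0 x) => x0.
  have ex : exists k, x * mr < k%:R by exists J; rewrite JE ltr_pM2r.
  case: (ex_minnP ex) => [[|j] hk mk]; first by move: hk; rewrite ltNge mulr_ge0 // ltW.
  have lj : j%:R <= x * mr by rewrite leNgt; apply/negP => /mk; rewrite ltnn.
  have jJ : (j < J)%N by rewrite -(ltr_nat R) JE; apply: le_lt_trans lj _; rewrite ltr_pM2r.
  exists (false, Ordinal jJ); rewrite /= in_itv /= -/m -/mr ler_pdivrMr // ltr_pdivlMr //.
  by rewrite lj.
have ex : exists k, - x * mr <= k%:R by exists J; rewrite JE ler_pM2r //; lra.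
case: (ex_minnP ex) => [[|j] hk mk].
  by move: hk; rewrite leNgt mulr_gt0 //; lra.
have lj : j%:R < - x * mr by rewrite ltNge; apply/negP => /mk; rewrite ltnn.
have jJ : (j < J)%N.
  by rewrite -(ltr_nat R) JE; apply: lt_le_trans lj _; rewrite ler_pM2r //; lra.
exists (true, Ordinal jJ); rewrite /= in_itv /= -/m -/mr; apply/andP; split.
  by rewrite lerNl ler_pdivlMr.
by rewrite ltrNr ltr_pdivrMr.
Qed.

Lemma cell_inj s s' x : cset s x -> cset s' x -> s = s'.
Proof.
rewrite /cset /cell_set; case: s => b j; case: s' => b' j' /=.
have jn (k : nat) : 0 <= k%:R / mr by rewrite divr_ge0 // ltW.
case: b; case: b'; rewrite /= !in_itv /= -/m -/mr => /andP[h1 h2] /andP[h3 h4].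
- have l1 : (j < j'.+1)%N by rewrite -(ltr_nat R) -(@ltr_pM2r _ (mr^-1)) ?invr_gt0 //; lra.
  have l2 : (j' < j.+1)%N by rewrite -(ltr_nat R) -(@ltr_pM2r _ (mr^-1)) ?invr_gt0 //; lra.
  by congr (_, _); apply: val_inj => /=; lia.
- by exfalso; have := jn j; have := jn j'; lra.
- by exfalso; have := jn j; have := jn j'; lra.
- have l1 : (j < j'.+1)%N by rewrite -(ltr_nat R) -(@ltr_pM2r _ (mr^-1)) ?invr_gt0 //; lra.
  have l2 : (j' < j.+1)%N by rewrite -(ltr_nat R) -(@ltr_pM2r _ (mr^-1)) ?invr_gt0 //; lra.
  by congr (_, _); apply: val_inj => /=; lia.
Qed.

Let al i : R := (lambda i)%:~R.
Let bl i : R := (mu i)%:~R.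
Let cl : R := tau%:~R.
(** Each of the [K] coordinates errs by at most [7 A M / m], the constant term by at most
    [2 A M / m]. *)
Let t : R := 9 * Kr * Ar / mr * M.

Lemma norm_prod_le (x y X Y : R) : `|x| <= X -> `|y| <= Y -> `|x * y| <= X * Y.
Proof. by move=> hx hy; rewrite normrM ler_pM. Qed.

Lemma coord_error (x xh y yh u uh : R) : `|x| <= M -> `|u| <= M ->
  `|x - xh| * mr ^+ 2 <= 2 * M -> `|u - uh| * mr ^+ 2 <= 2 * M ->
  `|y| <= Ar -> `|yh| <= Ar -> `|y - yh| <= mr^-1 ->
  `|(x * y ^+ 2 + u * y) - (xh * yh ^+ 2 + uh * yh)| <= 7 * Ar / mr * M.
Proof.
move=> hx hu hxh huh hy hyh hd.
have m2 : 0 < mr ^+ 2 by rewrite exprn_gt0.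
have {}hxh : `|x - xh| <= 2 * M / mr ^+ 2 by rewrite ler_pdivlMr.
have {}huh : `|u - uh| <= 2 * M / mr ^+ 2 by rewrite ler_pdivlMr.
have M0 : 0 <= M by [].
have -> : (x * y ^+ 2 + u * y) - (xh * yh ^+ 2 + uh * yh) =
  x * ((y - yh) * (y + yh)) + u * (y - yh) + (x - xh) * (yh * yh) + (u - uh) * yh by ring.
have e1 : `|x * ((y - yh) * (y + yh))| <= M * (mr^-1 * (2 * Ar)).
  by apply: norm_prod_le => //; apply: norm_prod_le => //; apply: le_trans (ler_normD _ _) _; lra.
have e2 : `|u * (y - yh)| <= M * mr^-1 by exact: norm_prod_le.
have e3 : `|(x - xh) * (yh * yh)| <= 2 * M / mr ^+ 2 * (Ar * Ar).
  by apply: norm_prod_le => //; exact: norm_prod_le.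
have e4 : `|(u - uh) * yh| <= 2 * M / mr ^+ 2 * Ar by exact: norm_prod_le.
apply: (@le_trans _ _ (M * (mr^-1 * (2 * Ar)) + M * mr^-1 + 2 * M / mr ^+ 2 * (Ar * Ar) + 2 * M / mr ^+ 2 * Ar)).
  do 3 (apply: le_trans (ler_normD _ _) _; apply: lerD => //); exact: e1.
have i0 : 0 < mr^-1 by rewrite invr_gt0.
have i1 : Ar * mr^-1 <= 1 by rewrite ler_pdivrMr // mul1r.
have -> : M * (mr^-1 * (2 * Ar)) + M * mr^-1 + 2 * M / mr ^+ 2 * (Ar * Ar) + 2 * M / mr ^+ 2 * Ar =
  M * (2 * (Ar * mr^-1) + mr^-1 + 2 * (Ar * mr^-1) * (Ar * mr^-1) + 2 * (Ar * mr^-1) * mr^-1).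
  by field; rewrite gt_eqF.
have -> : 7 * Ar / mr * M = M * (7 * (Ar * mr^-1)) by field; rewrite gt_eqF.
apply: ler_wpM2l => //.
have : mr^-1 <= Ar * mr^-1 by rewrite ler_peMl //; [exact: ltW|have := Ar4; lra].
move: (mr^-1) (Ar * mr^-1) i0 i1 => i w; nra.
Qed.

Lemma point_error (f : {ffun 'I_K -> bool * 'I_J}) (y : K.-tuple T) :
  (forall i, cset (f i) (tnth y i)) ->
  `|quadr al bl cl y - 2 ^+ sh / mr ^+ 2 * (qhat m sh lambda mu tau f)%:~R| <= t.
Proof.
move=> Hy; set sg : R := 2 ^+ sh.
have -> : sg / mr ^+ 2 * (qhat m sh lambda mu tau f)%:~R =
  \sum_i (sg * (hat sh (lambda i))%:~R * yhat (f i) ^+ 2 + sg * (hat sh (mu i))%:~R * yhat (f i))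
  + sg * (hat sh tau)%:~R.
  have mz : (m%:Z)%:~R = mr :> R by [].
  rewrite /qhat intrD mulrDr rmorph_sum /= mulr_sumr; congr (_ + _).
    apply: eq_bigr => i _; rewrite !expr2 intrD !intrM mz /yhat.
    by field; rewrite gt_eqF.
  rewrite !expr2 !intrM mz; by field; rewrite gt_eqF.
rewrite /quadr opprD addrACA -sumrB; apply: le_trans (ler_normD _ _) _.
have h1 : `|cl - sg * (hat sh tau)%:~R| <= 2 * Ar / mr * M.
  have := trunc_error (or_intror erefl : isc tau); rewrite -/sg -/cl => h.
  have m2 : 0 < mr ^+ 2 by rewrite exprn_gt0.
  apply: (@le_trans _ _ (2 * M / mr ^+ 2)); first by rewrite ler_pdivlMr.
  have -> : 2 * M / mr ^+ 2 = 2 * M / mr * mr^-1 by field; rewrite gt_eqF.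
  have -> : 2 * Ar / mr * M = 2 * M / mr * Ar by field; rewrite gt_eqF.
  apply: ler_wpM2l; first by rewrite divr_ge0 ?mulr_ge0 // ltW.
  apply: (@le_trans _ _ 1); last by have := Ar4; lra.
  by rewrite invf_le1 //; apply: le_trans Am; have := Ar4; lra.
have h2 : `|\sum_i ((al i * tnth y i ^+ 2 + bl i * tnth y i) -
    (sg * (hat sh (lambda i))%:~R * yhat (f i) ^+ 2 + sg * (hat sh (mu i))%:~R * yhat (f i)))| <= Kr * (7 * Ar / mr * M).
  apply: le_trans (ler_norm_sum _ _ _) _.
  apply: (@le_trans _ _ (\sum_(i < K) 7 * Ar / mr * M)); last by rewrite sumr_const card_ord -[leLHS]mulr_natl.
  apply: ler_sum => i _; have [c1 c2 c3] := cell_facts (Hy i).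
  have li : isc (lambda i) by left; exists i; left.
  have mi : isc (mu i) by left; exists i; right.
  by apply: coord_error => //; [exact: coeff_le|exact: coeff_le|exact: trunc_error|exact: trunc_error].
have q0 : 0 <= Ar / mr * M by rewrite mulr_ge0 // divr_ge0 // ltW.
have -> : t = Kr * (7 * Ar / mr * M) + 2 * Kr * (Ar / mr * M) by rewrite /t; field; rewrite gt_eqF.
apply: lerD => //; apply: le_trans h1 _.
have -> : 2 * Ar / mr * M = 2 * (Ar / mr * M) by field; rewrite gt_eqF.
have := Kr1; nra.
Qed.

(** If some coordinate has a coefficient of size at least [B], either its quadratic coefficient
    exceeds [B / (4 A)] and completing the square applies, or its linear coefficient dominates on
    [-A, A]. Otherwise the constant term attains [M], the rest of q is at most [M / 2] on the box,
    and the set is empty. *)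
Lemma small_prob : 0 < M -> (std_gaussian K (small_set al bl cl t Ar) <= (34 * Kr / Ar ^+ 2)%:E)%E.
Proof.
move=> M0; have a4 := Ar4; have k1 := Kr1; have kA := KrA.
have A0 : 0 < Ar by lra.
have A2 : 0 < Ar ^+ 2 by rewrite exprn_gt0.
(* With all coefficients of the coordinates at most [B], their part of q is at most
   [2 K B A^2 = M / 2] on the box. *)
pose B : R := M / (4 * Kr * Ar ^+ 2).
have B0 : 0 < B by rewrite divr_gt0 // !mulr_gt0 //; lra.
have t0 : 0 <= t by rewrite /t !mulr_ge0 // ?invr_ge0 ?ltW //; lra.
have good i : B <= Num.max `|al i| `|bl i| ->
    (std_gaussian K (small_set al bl cl t Ar) <= (34 * Kr / Ar ^+ 2)%:E)%E.
  move=> hB; apply: (@small_set_le R K al bl cl t Ar _ i) => c' V mV HV.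
  case: (leP (`|al i| * (4 * Ar)) B) => hl.
    have hb : B <= `|bl i|.
      move: hB; rewrite le_max => /orP[h|//]; have := normr_ge0 (al i); nra.
    apply: le_trans (quad_anticonc_lin mV B0 t0 A0 hl hb HV) _; rewrite lee_fin.
    have -> : 2 * (4 * t / B) = 288 * Kr ^+ 2 / Ar ^+ 5.
      by rewrite /t /B mE; field; rewrite !gt_eqF //; lra.
    rewrite ler_pdivrMr ?exprn_gt0 //.
    have -> : 34 * Kr / Ar ^+ 2 * Ar ^+ 5 = 34 * Kr * (Ar ^+ 2 * Ar) by field; rewrite gt_eqF.
    have : 16 <= Ar ^+ 2 by rewrite expr2; nra.
    rewrite [Kr ^+ 2]expr2; move: (Ar ^+ 2) => u hu.
    have : Kr * 16 <= u * Ar by nra.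
    nra.
  have a0 : al i != 0.
    by apply/eqP => E0; move: hl; rewrite E0 normr0 mul0r; lra.
  (* 17 is the least integer for which [2 t <= B / (4 A) * d^2]: this amounts to
     [18 <= 17^2 / 16]. *)
  pose d : R := 17 * Kr / Ar ^+ 2.
  have d0 : 0 <= d by rewrite divr_ge0 ?mulr_ge0 // ?ltW //; lra.
  have := @quad_anticonc_lead R V (al i) (bl i) c' t d mV a0 t0 d0.
  have -> : 2 * d = 34 * Kr / Ar ^+ 2 by rewrite /d; field; rewrite gt_eqF.
  apply; last by move=> x /HV[].
  have h1 : B / (4 * Ar) * d ^+ 2 <= `|al i| * d ^+ 2.
    by apply: ler_wpM2r; rewrite ?sqr_ge0 // ler_pdivrMr ?mulr_gt0 // ltW.
  apply: le_trans h1.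
  have -> : B / (4 * Ar) * d ^+ 2 = 289 / 16 * (Kr * M / Ar ^+ 7).
    by rewrite /B /d; field; rewrite !gt_eqF //; lra.
  have -> : 2 * t = 18 * (Kr * M / Ar ^+ 7) by rewrite /t mE; field; rewrite gt_eqF.
  have : 0 <= Kr * M / Ar ^+ 7 by rewrite divr_ge0 ?mulr_ge0 ?exprn_ge0 ?ltW //; lra.
  lra.
have BM : B <= M.
  rewrite /B ler_pdivrMr ?mulr_gt0 //; last by lra.
  rewrite ler_peMr // ?ltW //; have : 16 <= Ar ^+ 2 by rewrite expr2; nra.
  move: (Ar ^+ 2) => u; nra.
have absE (x : int) : `|x%:~R| = (`|x|%N)%:R :> R by rewrite -intr_norm -abszE -pmulrn.
case: max_coeff_att => [[i Mi]|Mt].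
  apply: (good i); apply: le_trans BM _.
  by rewrite /M Mi /al /bl !absE le_max !ler_nat; case: (leqP `|lambda i| `|mu i|) => h; rewrite leqnn ?orbT.
have [[i hi]|nB] := pselect (exists i, B <= Num.max `|al i| `|bl i|); first exact: (good i).
have -> : small_set al bl cl t Ar = set0.
  apply/seteqP; split=> // y [hy hq] /=.
  have cM : `|cl| = M by rewrite /cl absE /M Mt.
  have hs : `|\sum_i (al i * tnth y i ^+ 2 + bl i * tnth y i)| <= M / 2.
    apply: le_trans (ler_norm_sum _ _ _) _.
    apply: (@le_trans _ _ (\sum_(i < K) 2 * B * Ar ^+ 2)).
      apply: ler_sum => i _.
      have /andP[ha hb] : (`|al i| <= B) && (`|bl i| <= B).
        have : ~ (B <= Num.max `|al i| `|bl i|) by move=> h; apply: nB; exists i.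
        by move=> /negP; rewrite -ltNge gt_max => /andP[/ltW-> /ltW->].
      apply: le_trans (ler_normD _ _) _.
      have e1 : `|al i * tnth y i ^+ 2| <= B * (Ar * Ar).
        by apply: norm_prod_le => //; rewrite expr2; exact: norm_prod_le.
      have e2 : `|bl i * tnth y i| <= B * Ar by exact: norm_prod_le.
      have e3 : B * Ar <= B * (Ar * Ar) by rewrite ler_pM2l // ler_peMr // ?ltW //; lra.
      have -> : 2 * B * Ar ^+ 2 = B * (Ar * Ar) + B * (Ar * Ar) by ring.
      lra.
    rewrite sumr_const card_ord -mulr_natl -/Kr /B.
    by rewrite le_eqVlt; apply/orP; left; apply/eqP; field; rewrite !gt_eqF //; lra.
  have tM : t < M / 2.
    have -> : t = 9 * (Kr * (Ar / mr)) * M by rewrite /t; field; rewrite gt_eqF.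
    have : Kr * (Ar / mr) <= 1 / 256.
      rewrite mulrA ler_pdivrMr // mE.
      have -> : 1 / 256 * Ar ^+ 8 = Ar * Ar * (Ar ^+ 3 * Ar ^+ 3 / 256) by field.
      have h64 : 64 <= Ar ^+ 3.
        have -> : 64 = 4 ^+ 3 :> R by ring.
        by apply: lerXn2r; rewrite ?nnegrE //; lra.
      apply: (@le_trans _ _ (Ar * Ar)); first by rewrite ler_pM2r.
      rewrite ler_peMr ?mulr_ge0 ?ltW //; move: (Ar ^+ 3) h64 => u hu; nra.
    move: (Kr * (Ar / mr)) => w; nra.
  have := ler_normB (quadr al bl cl y) (\sum_i (al i * tnth y i ^+ 2 + bl i * tnth y i)).
  rewrite {1}/quadr [X in `|X| <= _](_ : _ = cl); last by ring.
  move: hq hs; lra.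
by rewrite measure0 lee_fin divr_ge0 ?mulr_ge0 // ?ltW //; lra.
Qed.

Let w (s : bool * 'I_J) : R := (weight N W0 s.2)%:R.
Let W : R := \sum_s w s.

Lemma weight_pos : 0 < W.
Proof.
have [[M0 J0 N0 hW0 L0] _] := values_pos EA A4.
rewrite /W (bigD1 (false, Ordinal (J0 : (0 < J)%N))) //= ltr_pwDl //; last by apply: sumr_ge0.
by rewrite /w /weight /= ltr0n.
Qed.

Lemma cell_prob_ge0 s : 0 <= cprob s.
Proof. by apply: fine_ge0; exact: (@measure_ge0 _ _ _ (normal_prob 0 1 : probability _ R)). Qed.

Lemma nu_line : nu [set` `[(- Ar), Ar[%R] = (\sum_s cprob s)%:E.
Proof.
have -> : [set` `[(- Ar), Ar[%R] = \big[setU/set0]_(s <- index_enum (bool * 'I_J)%type) cset s.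
  rewrite -bigcup_seq; apply/seteqP; split=> x /=.
    rewrite in_itv /= => /cell_cover[s cs]; exists s => //=; exact: mem_index_enum.
  move=> [s _ cs]; rewrite in_itv /=.
  have jn (k : nat) : 0 <= k%:R / mr by rewrite divr_ge0 // ltW.
  have j1 : s.2.+1%:R / mr <= Ar by rewrite ler_pdivrMr // -JE ler_nat ltn_ord.
  have A0 := Ar4; move: cs; rewrite /cset /cell_set -/m -/mr.
  case: (s.1); rewrite /= in_itv /= => /andP[h1 h2]; apply/andP; have := jn s.2; split; lra.
have dis s s' : s != s' -> cset s `&` cset s' = set0.
  by move=> /eqP ns; apply/seteqP; split=> // x [h1 h2]; exact: ns (cell_inj h1 h2).
apply: etrans (@measure_big_disjoint _ _ R (normal_prob 0 1 : probability _ R) _ cset _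
  (index_enum_uniq _) (@measurable_cell R A) dis) _.
by rewrite -sumEFin; apply: eq_bigr => s _; exact: nu_cell.
Qed.

Lemma line_prob : 1 - 4 / Ar ^+ 2 <= \sum_s cprob s <= 1.
Proof.
have A0 : 0 < Ar by have := Ar4; lra.
apply/andP; split; rewrite -lee_fin -nu_line; first exact: nu_box.
exact: (@probability_le1 _ _ _ (normal_prob 0 1 : probability _ R)).
Qed.

Lemma cell_tv : \sum_s `|cprob s - w s / W| <= 12 / Ar ^+ 2.
Proof.
have A0 : 0 < Ar by have := Ar4; lra.
have rho : \sum_s `|cprob s - normal_peak 1 / mr / W0%:R * w s| <= 4 / Ar ^+ 2.
  apply: (@le_trans _ _ (\sum_(s : bool * 'I_J) Ar / mr ^+ 2)).
    by apply: ler_sum => s _; exact: cell_weight_close.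
  rewrite sumr_const card_prod card_bool card_ord -[leLHS]mulr_natl natrM JE.
  have -> : 2 * (Ar * mr) * (Ar / mr ^+ 2) = 2 / Ar ^+ 6 by rewrite mE; field; rewrite gt_eqF.
  rewrite ler_pdivrMr ?exprn_gt0 //.
  have -> : 4 / Ar ^+ 2 * Ar ^+ 6 = 4 * Ar ^+ 4 by field; rewrite gt_eqF.
  have : 1 <= Ar ^+ 4 by apply: exprn_ege1; have := Ar4; lra.
  lra.
have := normalize_tv (fun s => ler0n R _ : 0 <= w s) weight_pos rho line_prob.
rewrite -/W => /le_trans; apply.
have -> : 2 * (4 / Ar ^+ 2) + 4 / Ar ^+ 2 = 12 / Ar ^+ 2 by field; rewrite gt_eqF.
exact: lexx.
Qed.

Let box (f : {ffun 'I_K -> bool * 'I_J}) := [set y : K.-tuple T | forall i, cset (f i) (tnth y i)].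
Let Q (f : {ffun 'I_K -> bool * 'I_J}) := (0 <= qhat m sh lambda mu tau f).
Let D : R := \sum_(f | Q f) \prod_i cprob (f i).
Let U : set (K.-tuple T) := \big[setU/set0]_(f <- enum Q) box f.

Lemma measurable_cbox f : measurable (box f).
Proof. by apply: (@measurable_box R K (fun i => cset (f i))) => i; exact: measurable_cell. Qed.

Lemma prob_U : std_gaussian K U = D%:E.
Proof.
have := @measure_big_disjoint _ _ R (std_gaussian K) _ box (enum Q).
move=> ->; first last.
- move=> f g fg; apply/seteqP; split=> // y [h1 h2] /=; move/eqP: fg; apply.
  by apply/ffunP => i; exact: cell_inj (h1 i) (h2 i).
- exact: measurable_cbox.
- exact: enum_uniq.
rewrite big_enum /= /D -sumEFin; apply: eq_bigr => f _.
rewrite (std_gaussian_box (A := fun i => cset (f i))); last by move=> i; exact: measurable_cell.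
rewrite (big_morph EFin EFinM erefl); apply: eq_bigr => i _; exact: nu_cell.
Qed.

Definition approx_num : nat := (\sum_(f : {ffun 'I_K -> bool * 'I_J} | Q f) fweight N W0 f)%N.
Definition approx_den : nat := (\sum_(f : {ffun 'I_K -> bool * 'I_J}) fweight N W0 f)%N.

Lemma approx_denE : approx_den%:R = W ^+ K.
Proof.
rewrite /approx_den natr_sum.
under eq_bigr => f _ do rewrite /fweight natr_prod.
by rewrite -(bigA_distr_bigA (fun _ s => w s)) /= prodr_const card_ord.
Qed.

Lemma discrete_close : `|D - approx_num%:R / approx_den%:R| <= Kr * (12 / Ar ^+ 2).
Proof.
have W1 := weight_pos.
have -> : approx_num%:R / approx_den%:R = \sum_(f | Q f) \prod_i (w (f i) / W).
  rewrite approx_denE /approx_num natr_sum mulr_suml; apply: eq_bigr => f _.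
  by rewrite /fweight natr_prod prodf_div prodr_const card_ord.
have /andP[_ p1] := line_prob.
apply: (@prod_tv R K _ cprob (fun s => w s / W) Q) => //.
- exact: cell_prob_ge0.
- by move=> s; rewrite divr_ge0 // ltW.
- by rewrite -mulr_suml divff // gt_eqF.
- exact: cell_tv.
Qed.

(** Bernoulli's inequality, which turns the tail of one coordinate into a bound on the probability
    of leaving the box. *)
Lemma bernoulli_ge (n : nat) (x : R) : 0 <= x <= 1 -> 1 - n%:R * (1 - x) <= x ^+ n.
Proof.
move=> /andP[x0 x1]; elim: n => [|n IH]; first by rewrite mul0r subr0 expr0.
rewrite exprS -natr1; have := ler_wpM2l x0 IH; have : 0 <= n%:R * (1 - x) :> R by rewrite mulr_ge0 // subr_ge0.
nra.
Qed.

Let QQ : set (K.-tuple T) := [set y | (0 <= quadratic lambda mu tau y)%R].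

Lemma measurable_QQ : measurable QQ.
Proof.
have -> : QQ = setT `&` ((quadr al bl cl) @^-1` [set` `[0, +oo[%R]).
  by apply/seteqP; split=> y /=; rewrite in_itv /= andbT // => -[].
exact: measurable_quadr.
Qed.

Lemma mem_U y : U y -> exists2 f, Q f & forall i, cset (f i) (tnth y i).
Proof. by rewrite /U -bigcup_seq => -[f /=]; rewrite mem_enum => Qf bf; exists f. Qed.

Lemma U_mem y f : Q f -> (forall i, cset (f i) (tnth y i)) -> U y.
Proof. by move=> Qf bf; rewrite /U -bigcup_seq; exists f => //=; rewrite mem_enum. Qed.

(** [U], the union of the cells on which the truncated quadratic is nonnegative, agrees with the
    sign set [QQ] up to [E] and the outside of the box. The constant 50 is 34 for [E], 4 for the
    outside and 12 for replacing cell probabilities by weights. *)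
Lemma sign_approx : 0 < M ->
  (`| std_gaussian K QQ - (approx_num%:R / approx_den%:R)%:E | <= (50 * Kr / Ar ^+ 2)%:E)%E.
Proof.
move=> M0; have A0 : 0 < Ar by have := Ar4; lra.
set E := small_set al bl cl t Ar; have hE := small_prob M0; rewrite -/E in hE.
pose bx := [set y : K.-tuple T | forall i, [set` `[(- Ar), Ar[%R] (tnth y i)].
have mbx : measurable bx by apply: (@measurable_box R K (fun=> [set` `[(- Ar), Ar[%R])) => i; exact: measurable_itv.
have mE' : measurable E by exact: measurable_small_set.
have mU : measurable U by apply: bigsetU_measurable => f _; exact: measurable_cbox.
have mQ := measurable_QQ.
have sg0 : 0 < 2 ^+ sh / mr ^+ 2 by rewrite divr_gt0 // exprn_gt0.
have inE y f : (forall i, cset (f i) (tnth y i)) -> `|quadr al bl cl y| <= t -> E y.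
  by move=> hf hq; split=> // i; have [] := cell_facts (hf i).
have sub1 : U `<=` QQ `|` E.
  move=> y /mem_U[f Qf hf]; case: (leP 0 (quadr al bl cl y)) => hq; first by left.
  right; apply: (inE _ f) => //; have := point_error hf; rewrite !ler_norml => /andP[h1 h2].
  have : 0 <= 2 ^+ sh / mr ^+ 2 * (qhat m sh lambda mu tau f)%:~R :> R by rewrite mulr_ge0 ?ler0z // ltW.
  move: h1 h2; set u := _ * _%:~R => h1 h2 h3; apply/andP; split; lra.
have sub2 : QQ `<=` U `|` E `|` ~` bx.
  move=> y hq; case: (pselect (bx y)) => hb; last by right.
  left; have /choice[f0 hf0] : forall i, exists s, cset s (tnth y i).
    by move=> i; apply: cell_cover; have := hb i; rewrite /= in_itv.
  pose f := [ffun i => f0 i]; have hf i : cset (f i) (tnth y i) by rewrite ffunE.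
  case: (boolP (Q f)) => Qf; first by left; exact: (U_mem Qf).
  right; apply: (inE _ f) => //; have := point_error hf; rewrite !ler_norml => /andP[h1 h2].
  have : 2 ^+ sh / mr ^+ 2 * (qhat m sh lambda mu tau f)%:~R <= 0 :> R.
    by rewrite pmulr_rle0 // lerz0 ltW // ltNge.
  have hq' : 0 <= quadr al bl cl y by [].
  move: h1 h2; set u := _ * _%:~R => h1 h2 h3; apply/andP; split; lra.
have Pbx : std_gaussian K bx = ((\sum_s cprob s) ^+ K)%:E.
  rewrite (std_gaussian_box (A := fun=> [set` `[(- Ar), Ar[%R])); last by move=> i; exact: measurable_itv.
  rewrite -[X in (_ ^+ X)%:E](card_ord K) -prodr_const (big_morph EFin EFinM erefl).
  by apply: eq_bigr => i _; exact: nu_line.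
have PC : (std_gaussian K (~` bx) <= (4 * Kr / Ar ^+ 2)%:E)%E.
  rewrite probability_setC // Pbx -EFinB lee_fin.
  have /andP[l1 l2] := line_prob; set s := \sum_s _ in l1 l2 *.
  have s0 : 0 <= s by apply: sumr_ge0 => u _; exact: cell_prob_ge0.
  have := @bernoulli_ge K s; rewrite s0 l2 -/Kr => /(_ isT).
  have : Kr * (1 - s) <= Kr * (4 / Ar ^+ 2) by apply: ler_wpM2l; have := Kr1; lra.
  have -> : 4 * Kr / Ar ^+ 2 = Kr * (4 / Ar ^+ 2) by ring.
  lra.
have U1 : (D%:E <= std_gaussian K QQ + (34 * Kr / Ar ^+ 2)%:E)%E.
  rewrite -prob_U; apply: (@le_trans _ _ (std_gaussian K (QQ `|` E))).
    by apply: le_measure; [exact/mem_set|apply/mem_set; apply: measurableU|exact: sub1].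
  by apply: le_trans (measureU2 _ _ _) _ => //; exact: leeD.
have U2 : (std_gaussian K QQ <= D%:E + (34 * Kr / Ar ^+ 2)%:E + (4 * Kr / Ar ^+ 2)%:E)%E.
  rewrite -prob_U; apply: (@le_trans _ _ (std_gaussian K (U `|` E `|` ~` bx))).
    apply: le_measure; [exact/mem_set|apply/mem_set|exact: sub2].
    by apply: measurableU; [apply: measurableU|apply: measurableC].
  apply: le_trans (measureU2 _ _ _) _ => //; [by apply: measurableU|by apply: measurableC|].
  by apply: leeD => //; apply: le_trans (measureU2 _ _ _) _ => //; exact: leeD.
have fin : std_gaussian K QQ \is a fin_num by exact: fin_num_measure.
move: U1 U2; rewrite -(fineK fin) -!EFinD !lee_fin => U1 U2.
rewrite -?EFinB /= ?lee_fin.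
have := discrete_close; set v := _ / _; rewrite !ler_norml => /andP[d1 d2].
have i0 : 0 <= Kr / Ar ^+ 2 by rewrite divr_ge0 // exprn_ge0 // ltW.
have e12 : Kr * (12 / Ar ^+ 2) = 12 * (Kr / Ar ^+ 2) by ring.
have e34 : 34 * Kr / Ar ^+ 2 = 34 * (Kr / Ar ^+ 2) by ring.
have e4 : 4 * Kr / Ar ^+ 2 = 4 * (Kr / Ar ^+ 2) by ring.
have e50 : 50 * Kr / Ar ^+ 2 = 50 * (Kr / Ar ^+ 2) by ring.
rewrite e12 in d1 d2; rewrite e34 in U1 U2; rewrite e4 in U2; rewrite e50.
apply/andP; split; lra.
Qed.

(** The zero polynomial has no anticoncentration at all, but truncation leaves it unchanged, and
    both probabilities are exactly 1. *)
Lemma approx_zero : max_coeff = 0%N -> std_gaussian K QQ = 1%E /\ approx_num = approx_den.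
Proof.
move=> m0; have z x : isc x -> x = 0 by move=> /max_coeff_ge; rewrite m0 leqn0 absz_eq0 => /eqP.
have zl i : lambda i = 0 by apply: z; left; exists i; left.
have zm i : mu i = 0 by apply: z; left; exists i; right.
have zt : tau = 0 by apply: z; right.
split.
  rewrite -(@probability_setT _ _ _ (std_gaussian K)); congr (std_gaussian K _).
  apply/seteqP; split=> // y _; rewrite /QQ /mkset /quadratic zt addr0.
  by rewrite big1 // => i _; rewrite zl zm !mul0r addr0.
rewrite /approx_num /approx_den; apply: eq_bigl => f.
have h0 : hat sh 0 = 0 by rewrite /hat ltxx absz0 div0n.
rewrite /Q /qhat zt h0 mul0r addr0.
by rewrite big1 ?lexx // => i _; rewrite zl zm h0 !mul0r addr0.
Qed.

Theorem approx_sign_prob :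
  (`| std_gaussian K QQ - (approx_num%:R / approx_den%:R)%:E | <= (50 * Kr / Ar ^+ 2)%:E)%E.
Proof.
have A0 : 0 < Ar by have := Ar4; lra.
case: (posnP max_coeff) => [/approx_zero[-> ->]|M0]; last by apply: sign_approx; rewrite ltr0n.
rewrite divff; last by rewrite approx_denE expf_neq0 // gt_eqF // weight_pos.
by rewrite subee // abse0 lee_fin divr_ge0 ?mulr_ge0 ?exprn_ge0 // ltW.
Qed.

Lemma approx_den_gt0 : (0 < approx_den)%N.
Proof. by rewrite -(ltr0n R) approx_denE exprn_gt0 // weight_pos. Qed.

End Approx.

(** * Output format, encoding of eps and choice of the constants *)

Lemma take_find_blank (r o : seq sym) : nth Blank r = nth Blank o ->
  all (fun s => ~~ is_blank s) o -> take (find (@is_blank _) r) r = o.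
Proof.
move=> E nb.
have nbi i : (i < size o)%N -> ~~ is_blank (nth Blank r i).
  by move=> li; rewrite E; exact: (all_nthP Blank nb).
have lor : (size o <= size r)%N.
  rewrite leqNgt; apply/negP => /nbi; by rewrite nth_default.
have Ef : find (@is_blank _) r = size o.
  apply/eqP; rewrite eqn_leq; apply/andP; split.
    rewrite leqNgt; apply/negP => lt; have := before_find Blank lt.
    by rewrite E nth_default.
  rewrite leqNgt; apply/negP => lt.
  have h : has (@is_blank _) r by rewrite has_find; exact: leq_trans lt lor.
  by have := nth_find Blank h; apply/negP; exact: nbi.
rewrite Ef; apply: (@eq_from_nth _ Blank); first by rewrite size_takel.
by move=> i; rewrite size_takel // => li; rewrite nth_take // E.
Qed.

(** The numerator has [w - t] digits, so it lies between [2 ^ (w - t - 1)] and [2 ^ (w - t)]. The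
    denominator is below [2 ^ w] and, if [t > 0], at least [2 ^ (w - 1)], because [w] is the length
    of the longer of the two. *)
Lemma encode_rat_pairs (x : rat) : 0 < x ->
  exists (ps : seq (bool * bool)) (t : nat),
  [/\ encode_rat void x = flatten (map pairw ps), (t < size ps)%N,
      (forall i, (i < t)%N -> (nth (false, false) ps i).1 = false),
      (nth (false, false) ps t).1 &
      x^-1 <= (2 ^ t.+1)%:R /\ (2 ^ t.+1)%:R <= 4 * (1 + x^-1)].
Proof.
move=> x0; set a := `|numq x|%N; set b := `|denq x|%N.
set w := up_log 2 (maxn a b).+1.
have a0 : (0 < a)%N by rewrite absz_gt0 numq_eq0 gt_eqF.
have b0 : (0 < b)%N by rewrite absz_gt0 denq_neq0.
have xE : x^-1 = b%:R / a%:R.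
  rewrite -[in LHS](divq_num_den x) invf_div; congr (_ / _).
    by rewrite /b -[in LHS](gtz0_abs (denq_gt0 x)).
  by rewrite /a -[in LHS](gtz0_abs (_ : 0 < numq x)) // numq_gt0.
have mx : (1 < (maxn a b).+1)%N by rewrite ltnS; apply: leq_trans a0 (leq_maxl _ _).
have /andP[w1 w2] := up_log_bounds (isT : (1 < 2)%N) mx; rewrite -/w in w1 w2.
have aw : (a < 2 ^ w)%N by apply: leq_trans w2; rewrite ltnS leq_maxl.
have bw : (b < 2 ^ w)%N by apply: leq_trans w2; rewrite ltnS leq_maxr.
pose ps := zip (bits w a) (bits w b).
have sw n : size (bits w n) = w by rewrite size_map size_rev size_iota.
have sps : size ps = w by rewrite size_zip !sw minnn.
have nps i : (nth (false, false) ps i).1 = nth false (bits w a) i by rewrite nth_zip ?sw.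
have hps : has (fun p => p.1) ps.
  apply/negPn/negP => /hasPn nh; have : (a < 2 ^ (w - w))%N.
    apply: lead_zeros_lt => // i li; rewrite -nps; apply/negbTE; apply: nh; apply: mem_nth; by rewrite sps.
  by rewrite subnn expn0 ltnS leqn0 gtn_eqF.
pose t := find (fun p => p.1) ps.
have tw : (t < w)%N by rewrite -sps -has_find.
have t0 i : (i < t)%N -> (nth (false, false) ps i).1 = false by move=> /(before_find (false, false)).
have t1 : (nth (false, false) ps t).1 by exact: nth_find.
exists ps, t; split=> //; first by rewrite sps.
have alt : (a < 2 ^ (w - t))%N by apply: lead_zeros_lt => // [|i /t0]; [exact: ltnW|rewrite nps].
have age : (2 ^ (w - t.+1) <= a)%N.
  by apply: leq_trans (bit_leq a (w - t.+1)); rewrite -nth_bits // -nps t1 mul1n.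
have a0r : 0 < a%:R :> rat by rewrite ltr0n.
rewrite xE; split.
  rewrite ler_pdivrMr // -natrM ler_nat; apply: leq_trans (ltnW bw) _.
  have -> : (2 ^ w = 2 ^ t.+1 * 2 ^ (w - t.+1))%N by rewrite -expnD subnKC.
  by rewrite leq_mul2l age orbT.
case: (posnP t) => [->|tp].
  have : 0 <= b%:R / a%:R :> rat by rewrite divr_ge0.
  by rewrite expn1; lra.
have bge : (2 ^ w.-1 <= b)%N.
  have : (a < 2 ^ w.-1)%N by apply: leq_trans alt _; rewrite leq_exp2l //; lia.
  by move: w1; rewrite ltnS /maxn; case: ltnP; lia.
have : (2 ^ t.-1)%:R <= b%:R / a%:R :> rat.
  rewrite ler_pdivlMr // -natrM ler_nat; apply: leq_trans bge.
  have -> : (2 ^ w.-1 = 2 ^ t.-1 * 2 ^ (w - t))%N by rewrite -expnD; congr expn; lia.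
  by rewrite leq_mul2l ltnW ?orbT.
have -> : (2 ^ t.+1 = 4 * 2 ^ t.-1)%N by rewrite -{1}(prednK tp) !expnS mulnA.
rewrite natrM; lra.
Qed.

Lemma vY_le A : (4 <= A)%N -> (vY A <= A ^ 126)%N.
Proof.
move=> A4; have A2 : (2 <= A ^ 1)%N by rewrite expn1; lia.
have e x y i j : (x <= A ^ i)%N -> (y <= A ^ j)%N -> (x * y <= A ^ (i + j))%N.
  by move=> h1 h2; rewrite expnD leq_mul.
have A1 : (A <= A ^ 1)%N by rewrite expn1.
have M8 : (vM A <= A ^ 8)%N by [].
have J9 : (vJ A <= A ^ 9)%N by exact: (e _ _ 1 8)%N.
have N17 : (vN A <= A ^ 17)%N by apply: (e _ _ 1 16)%N => //; exact: (e _ _ 8 8)%N.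
have W34 : (vW A <= A ^ 34)%N by exact: (e _ _ 17 17)%N.
have L44 : (vL A <= A ^ 44)%N by apply: (e _ _ 1 43)%N => //; exact: (e _ _ 9 34)%N.
have O79 : (vOff A <= A ^ 79)%N.
  apply: (e _ _ 1 78)%N => //; apply: (e _ _ 44 34)%N => //; apply: (e _ _ 8 26)%N => //.
  by apply: (e _ _ 8 18)%N => //; exact: (e _ _ 9 9)%N.
have S80 : (vS A <= A ^ 80)%N by exact: (e _ _ 1 79)%N.
by apply: (e _ _ 1 125)%N => //; apply: (e _ _ 1 124)%N => //; exact: (e _ _ 44 80)%N.
Qed.

Lemma machine_output c w k n T' (s u : seq bool) : kexec last_tape c (init_tapes w) k T' -> (k <= n)%N ->
  T' tOut = gtape Blank 0 (nth Blank (map Bit s ++ Sep :: map Bit u)) -> (0 < bits_val u)%N ->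
  outputs_within (kmachine last_tape c) w n ((bits_val s)%:R / (bits_val u)%:R).
Proof.
move=> ex lk TO u0; have [t' Er mt] := kexec_run ex lk.
rewrite /outputs_within Er; split=> //; exists s, u; split=> //.
rewrite /output; apply: take_find_blank; last first.
  by rewrite all_cat /= !all_map; apply/andP; split; apply/allP.
have := mt ord_max; rewrite /= TO => /(congr1 snd) /= ->.
by apply/funext => i; rewrite add0n.
Qed.

Theorem theorem43 (R : realType) (C0 c0 : nat) :
  exists (M : machine) (C c C' c' : nat),
  forall (K B : nat) (lambda mu : 'I_K -> int) (tau : int) (eps : rat),
    (0 < K)%N ->
    0 < eps ->
    let inv_eps : R := (ratr eps)^-1 in
    K%:R <= C0%:R * inv_eps ^+ 4 * ln (2 + inv_eps) ^+ c0 ->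
    (forall i, bit_integer B (lambda i)) ->
    (forall i, bit_integer B (mu i)) ->
    bit_integer B tau ->
    exists (n : nat) (v : rat),
      [/\ n%:R <= C%:R * (K * B)%:R * ln (2 + inv_eps) ^+ c
                  + C'%:R * (1 + inv_eps) ^+ c',
          outputs_within M (encode_instance (work M) B lambda mu tau eps) n v,
          0 <= v <= 1 &
          (`| std_gaussian K [set y : K.-tuple R |
                                (0 <= quadratic lambda mu tau y)%R]
              - (ratr v)%:E | <= (ratr eps)%:E)%E].
Proof.
(* Let [E = 2 ^ t.+1], which is at least 1/eps. From [ln (2 + x) <= 1 + x <= E^2] one gets
   [K <= C0 E^(4 + 2 c0)]; one more factor [E] pays for eps, whence [alpha]. The summand [alpha] of
   [beta] accounts for the successor in [t.+1], so that [A = 2 ^ b0 * E ^ alpha], and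
   [2 ^ b0 >= 50 C0 + 4] gives [50 K E + 4 <= A]. *)
pose alpha := (5 + 2 * c0)%N; pose b0 := (50 * C0 + 4)%N; pose beta := (alpha + b0)%N.
(* [vY A <= A ^ 126], and the part of the running time independent of [B] is [vY A ^ 40]. *)
pose dd := (126 * 40)%N.
exists (kmachine last_tape (program alpha beta 0)), 60%N, 0%N, ((2 ^ b0 * 4 ^ alpha) ^ dd)%N, (alpha * dd)%N.
move=> K B lambda mu tau eps K0 eps0 inv_eps HK lB mB tB.
have [ps [t [Eps lt Hf Ht [inv1 inv2]]]] := encode_rat_pairs eps0.
pose a := (beta + t * alpha)%N; pose A := (2 ^ a)%N.
set E : nat := (2 ^ t.+1)%N in inv1 inv2.
have Er : inv_eps = ratr eps^-1 by rewrite fmorphV.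
have i1 : inv_eps <= E%:R by rewrite Er -(ratr_nat R) ler_rat.
have i2 : E%:R <= 4 * (1 + inv_eps).
  have h : ratr (4 * (1 + eps^-1)) = 4 * (1 + inv_eps) :> R.
    have e1 : ratr (4 * (1 + eps^-1)) = ratr 4 * ratr (1 + eps^-1) :> R by exact: rmorphM.
    have e2 : ratr (1 + eps^-1) = ratr 1 + ratr eps^-1 :> R by exact: rmorphD.
    by rewrite e1 e2 Er; congr (_ * (_ + _)); [exact: (ratr_nat R 4)|exact: (ratr_nat R 1)].
  by have := inv2; rewrite -(ler_rat R) h ratr_nat.
have i0 : 0 < inv_eps by rewrite invr_gt0 ltr0q.
have E2 : (2 <= E)%N by rewrite /E expnS leq_pmulr // expn_gt0.
have E2r : 2 <= E%:R :> R by rewrite (ler_nat R 2).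
have AE : A = (2 ^ b0 * E ^ alpha)%N.
  by rewrite /A /a /beta /E -expnM -expnD; congr expn; rewrite mulSn; lia.
have KE : (K <= C0 * E ^ (4 + 2 * c0))%N.
  have l0 : 0 <= ln (2 + inv_eps) by apply: ln_ge0; lra.
  have l1 : ln (2 + inv_eps) <= E%:R ^+ 2.
    have l2 : ln (1 + (1 + inv_eps)) <= 1 + inv_eps by apply: le_ln1Dx; lra.
    have -> : 2 + inv_eps = 1 + (1 + inv_eps) by ring.
    apply: le_trans l2 _; rewrite expr2; nra.
  have p1 : inv_eps ^+ 4 <= E%:R ^+ 4 by apply: lerXn2r; rewrite ?nnegrE //; lra.
  have p2 : ln (2 + inv_eps) ^+ c0 <= (E%:R ^+ 2) ^+ c0 by apply: lerXn2r; rewrite ?nnegrE ?exprn_ge0.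
  rewrite -(ler_nat R) natrM natrX; apply: le_trans HK _.
  rewrite -mulrA; apply: ler_wpM2l => //; rewrite exprD exprM.
  by apply: ler_pM => //; rewrite exprn_ge0 // ltW.
have b0p : (b0 <= 2 ^ b0)%N by exact: ltnW (ltn_expl _ _).
have KEA : (50 * K * E + 4 <= A)%N.
  have h1 : (K * E <= C0 * E ^ alpha)%N.
    have -> : (C0 * E ^ alpha = C0 * E ^ (4 + 2 * c0) * E)%N by rewrite -mulnA -expnSr; congr (_ * expn _ _)%N.
    by rewrite leq_mul2r KE orbT.
  have h2 : (0 < E ^ alpha)%N by rewrite expn_gt0; lia.
  rewrite AE; apply: (@leq_trans (b0 * E ^ alpha)); last by rewrite leq_mul2r b0p orbT.
  rewrite /b0; move: (E ^ alpha)%N h1 h2 => q; nia.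
have A4 : (4 <= A)%N by lia.
have KA : (K + 2 <= A)%N by nia.
pose cs := enc_coeffs B lambda mu; pose tu := encB B tau.
have scs : size cs = K by rewrite /cs size_map size_enum_ord.
have sB : all (fun x => size x.2 == B) (nums cs tu).
  apply/allP => x; rewrite /nums mem_cat => /orP[/flatten_mapP[c /mapP[i _ ->]]|].
    by rewrite !inE => /orP[]/eqP->; rewrite /= size_map size_rev size_iota.
  by rewrite inE => /eqP->; rewrite /= size_map size_rev size_iota.
have al0 : (0 < alpha)%N by [].
have csA : (size cs + 2 <= A)%N by rewrite scs.
have cs0 : (0 < size cs)%N by rewrite scs.
have [T' H1 O1] := @run_program alpha beta t B cs tu ps al0 A4 csA cs0 sB lt Hf Ht.
rewrite scs in H1.
set w := flatten _ ++ _ in H1.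
have Ew : encode_instance void B lambda mu tau eps = w.
  by rewrite /encode_instance Eps catA encode_nums.
(* The program runs at depth 0 with blank loop tapes, which is the actual initial configuration. *)
have [k lk ex] := H1 0%N (fun=> blank) isT (fun _ _ => erefl).
have Em : merge (init_tapes w) (fun=> blank) = init_tapes w.
  apply/funext => -[|i]; rewrite /merge //; case: ifP => // _.
  by rewrite (init_blank w i) ctr0.
rewrite Em in ex.
have numE := num_field A4 KA lB mB tB; have denE := den_field A4 KA lB mB tB.
set sh := the_shift alpha beta t B lambda mu tau in numE.
set s1 := emits _ (_ + _) _ in numE O1; set s2 := emits _ (_ * _) _ in denE O1.
have {}numE : bits_val s1 = approx_num A sh lambda mu tau by exact: numE.
have {}denE : bits_val s2 = approx_den K A by exact: denE.
have den0 : (0 < bits_val s2)%N by rewrite denE; exact: (@approx_den_gt0 R K a A erefl A4).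
exists (60 * (K * B) + vY A ^ 40)%N, ((bits_val s1)%:R / (bits_val s2)%:R).
split.
- rewrite expr0 mulr1 natrD natrM lerD2l.
  have A0 : 0 <= A%:R :> R by [].
  have Ar : A%:R <= (2 ^ b0 * 4 ^ alpha)%:R * (1 + inv_eps) ^+ alpha :> R.
    rewrite AE (natrM R (2 ^ b0) (E ^ alpha)) (natrM R (2 ^ b0) (4 ^ alpha)) -mulrA; apply: ler_wpM2l => //.
    have -> : (4 ^ alpha)%:R * (1 + inv_eps) ^+ alpha = (4 * (1 + inv_eps)) ^+ alpha :> R by rewrite natrX exprMn.
    by rewrite natrX; apply: lerXn2r; rewrite ?nnegrE //; lra.
  apply: (@le_trans _ _ ((A ^ dd)%:R)).
    rewrite ler_nat /dd expnM; apply: leq_trans (_ : ((A ^ 126) ^ 40 <= _)%N); last exact: leqnn.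
    by rewrite leq_exp2r //; exact: vY_le.
  have Z0 : 0 <= (2 ^ b0 * 4 ^ alpha)%:R * (1 + inv_eps) ^+ alpha :> R by exact: le_trans A0 Ar.
  have -> : (A ^ dd)%:R = A%:R ^+ dd :> R by exact: natrX.
  have -> : ((2 ^ b0 * 4 ^ alpha) ^ dd)%:R = (2 ^ b0 * 4 ^ alpha)%:R ^+ dd :> R by exact: natrX.
  by rewrite exprM -exprMn; apply: lerXn2r; rewrite ?nnegrE.
- have -> : encode_instance (work (kmachine last_tape (program alpha beta 0))) B lambda mu tau eps = w by exact: Ew.
  exact: (machine_output ex lk O1 den0).
- apply/andP; split; first by rewrite divr_ge0.
  rewrite ler_pdivrMr ?ltr0n // mul1r ler_nat numE denE /approx_num /approx_den /=.
  by rewrite [leqRHS](bigID (fun f => 0 <= qhat (vM A) sh lambda mu tau f)) /= leq_addr.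
- have := @approx_sign_prob R K a A sh lambda mu tau erefl A4 KA K0 (@coeff_large alpha beta t B K lambda mu tau A4 KA).
  have -> : ratr ((bits_val s1)%:R / (bits_val s2)%:R) = (approx_num A sh lambda mu tau)%:R / (approx_den K A)%:R :> R.
    by rewrite fmorph_div /= !ratr_nat numE denE.
  move=> /le_trans; apply; rewrite lee_fin.
  have e0 : 0 < ratr eps :> R by rewrite ltr0q.
  have eE : 1 <= ratr eps * E%:R :> R.
    by rewrite mulrC -ler_pdivrMr // div1r.
  have A0 : 0 < A%:R :> R by rewrite ltr0n; exact: leq_trans A4.
  rewrite ler_pdivrMr ?exprn_gt0 //.
  have h : 50 * K%:R * E%:R <= A%:R :> R.
    by rewrite -!natrM ler_nat; exact: leq_trans (leq_addr 4 _) KEA.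
  have A1 : 1 <= A%:R :> R by rewrite ler1n; exact: leq_trans A4.
  have h2 : A%:R <= A%:R ^+ 2 :> R by rewrite expr2 ler_peMr // ltW.
  (* As [eps * E >= 1], the bound [50 K E <= A <= A^2] gives [50 K <= eps * A^2]. *)
  apply: (@le_trans _ _ (50 * K%:R * (ratr eps * E%:R))).
    by rewrite ler_peMr // mulr_ge0.
  have -> : 50 * K%:R * (ratr eps * E%:R) = ratr eps * (50 * K%:R * E%:R) :> R by ring.
  by apply: ler_wpM2l; [exact: ltW|exact: le_trans h h2].
Qed.
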